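(* (a) Let $G$ be a connected, quasi-transitive, locally finite, infinite graph whose Bernoulli bond percolation threshold satisfies $p_c=p_c(G)\in(0,1)$, and let $0<\lambda_1<\lambda_c(G)<\lambda_2<\infty$. Then the family $\left((G,\mathbf{C}_{\lambda_1},\mathbf{C}_{\lambda_2},p)\right)_{p\in[0,1]}$ has a non-trivial recurrence/transience phase transition: there is a deterministic threshold $p_c^*\in(0,1)$ such that almost surely, $(G,\mathbf{C}_{\lambda_1},\mathbf{C}_{\lambda_2},p)$ is recurrent for every $p<p_c^*$ and transient for every $p>p_c^*$ (with $p\in[0,1]$). (b) Let $G$ be any Cayley graph of any group which is virtually $\mathbb{Z}$, and let $0<\lambda_1<\lambda_c(G)<\lambda_2<\infty$. Then there is no non-trivial recurrence/transience phase transition for $\left((G,\mathbf{C}_{\lambda_1},\mathbf{C}_{\lambda_2},p)\right)_{p\in[0,1]}$, that is, $p_c^*=p_c(G)=1$.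
   Context: Graphs $G=(V,E)$ have a fixed root $o\in V$. $G$ is quasi-transitive if its automorphism group has only finitely many orbits on $V$. For such $G$, $\mathrm{gr}(G)=\lim_{n\to\infty}|B_n(o)|^{1/n}$, where $B_n(o)$ is the closed ball of radius $n$ about $o$ in the graph distance. A network $(G,\mathbf{c})$ is a graph with a conductance function $\mathbf{c}:E\to[0,\infty)$; its random walk moves from $x$ to a neighbour $y$ with probability $\mathbf{c}(\{x,y\})/\sum_{e\ni x}\mathbf{c}(e)$. The network is recurrent (transient) if this random walk is recurrent (transient). For $\lambda>0$ and $e=\{x,y\}\in E$ let $|e|=\min\{\mathrm{dist}(x,o),\mathrm{dist}(y,o)\}$ and $\mathbf{C}_\lambda(e)=\lambda^{-|e|}$. $\lambda_c(G)$ denotes the critical parameter such that $(G,\mathbf{C}_\lambda)$ is transient for $\lambda<\lambda_c(G)$ and recurrent for $\lambda>\lambda_c(G)$; for quasi-transitive infinite $G$ one has $\lambda_c(G)=\mathrm{gr}(G)$. Grand coupling: let $(U_e)_{e\in E}$ be i.i.d. uniform on $[0,1]$. For $p\in[0,1]$, edge $e$ is open in $\omega_p$ (Bernoulli-$p$ bond percolation) if $U_e\le p$ and closed otherwise. $p_c(G)$ is the critical probability for existence of an infinite open cluster. The disordered random network $(G,\mathbf{c}_1,\mathbf{c}_2,p)$ is the random network on $G$ in which every open edge $e$ of $\omega_p$ has conductance $\mathbf{c}_1(e)$ and every closed edge $e$ has conductance $\mathbf{c}_2(e)$; all $p\in[0,1]$ are realized on the same probability space via $(U_e)$. The threshold is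 $p_c^*=\sup\{p\in[0,1]:\ \text{almost surely, }(G,\mathbf{C}_{\lambda_1},\mathbf{C}_{\lambda_2},q)\text{ is recurrent for all }q\in[0,p)\}$. A group $\Gamma$ is virtually $\mathbb{Z}$ if it contains a subgroup isomorphic to $\mathbb{Z}$ of finite index (this includes every $\Gamma$ having a finite normal subgroup $Q$ with $\Gamma/Q\cong\mathbb{Z}$). Cayley graphs are with respect to finite generating sets. *)

(* Defs.v *)
From HB Require Import structures.
From mathcomp Require Import all_boot all_order all_algebra.
From mathcomp Require Import all_classical all_reals all_analysis.

Set Implicit Arguments.
Unset Strict Implicit.
Unset Printing Implicit Defensive.

Import Order.TTheory GRing.Theory Num.Theory.
Import numFieldNormedType.Exports.

Local Open Scope classical_set_scope.
Local Open Scope ring_scope.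

(* Simple graphs on a possibly infinite vertex type.  The undirected edge     *)
(* {x, y} is the set [set x; y]; functions on edges are total functions on    *)
(* [set V] and are only meaningful on [edges G].                              *)
Record graph (V : Type) := Graph {
  adj :> rel V;
  adj_sym : symmetric adj;
  adj_irr : irreflexive adj }.

Section Graphs.
Variables (V : Type) (G : graph V).

Definition edges : set (set V) :=
  [set e | exists x y, adj G x y /\ e = [set x; y]].

Definition connected_graph :=
  forall x y, exists p : seq V, path (adj G) x p /\ last x p = y.

Definition locally_finite := forall x, finite_set [set y | adj G x y].

Definition graph_automorphism (f : V -> V) :=
  set_bij setT setT f /\ forall x y, adj G (f x) (f y) = adj G x y.

Definition vertex_orbit (x : V) : set V :=
  [set y | exists2 f, graph_automorphism f & y = f x].

Definition quasi_transitive := finite_set (range vertex_orbit).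

(* The least element of a set of natural numbers (0 if the set is empty). *)
Definition least (A : set nat) : nat :=
  xget 0%N [set n | A n /\ forall m, A m -> (n <= m)%N].

Definition dist (x y : V) : nat :=
  least [set n | exists p : seq V,
    [/\ path (adj G) x p, last x p = y & size p = n]].

(* For e = {x, y} this is min (dist x o) (dist y o). *)
Definition edge_height (o : V) (e : set V) : nat :=
  least [set n | exists2 x, e x & n = dist x o].

End Graphs.

Section Networks.
Variables (R : realType) (V : Type) (G : graph V).
Implicit Types (c : set V -> R) (x y : V).

Definition vertex_conductance c x : R :=
  \sum_(e \in [set e | edges G e /\ e x]) c e.

Definition trans_prob c x y : R :=
  if adj G x y then c [set x; y] / vertex_conductance c x else 0.

(* [X] is a realization, on the probability space (Omega, P), of the random   *)
(* walk on (G, c) started at [x], specified by its finite-dimensional laws.   *)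
Definition random_walk c x (d : measure_display) (Omega : measurableType d)
    (P : probability Omega R) (X : nat -> Omega -> V) :=
  (forall n v, measurable [set w | X n w = v]) /\
  forall (n : nat) (v : nat -> V),
    P [set w | forall k, (k <= n)%N -> X k w = v k] =
    (if `[< v 0%N = x >] then \prod_(k < n) trans_prob c (v k) (v k.+1)
     else 0)%:E.

(* The walk started at any vertex almost surely returns to it; this only      *)
(* depends on the law of the walk, hence not on the realization.              *)
Definition recurrent c :=
  forall x (d : measure_display) (Omega : measurableType d)
    (P : probability Omega R) (X : nat -> Omega -> V),
  random_walk c x P X -> {ae P, forall w, exists2 n, (0 < n)%N & X n w = x}.

(* On a connected graph with positive conductances the walk is irreducible,   *)
(* so its vertices are either all recurrent or all transient.                 *)
Definition transient c := ~ recurrent c.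

Definition Clambda (o : V) (lambda : R) : set V -> R :=
  fun e => lambda ^- edge_height G o e.

Definition lambda_c (o : V) : \bar R :=
  ereal_sup [set lambda%:E | lambda in
    [set lambda : R | 0 < lambda /\ transient (Clambda o lambda)]].

End Networks.

Section Percolation.
Variables (R : realType) (V : Type) (G : graph V).
Variables (d : measure_display) (Omega : measurableType d).
Variables (P : probability Omega R).

(* Mutual independence is the product rule over every finite set of edges. *)
Definition iid_uniform (U : set V -> {RV P >-> R}) :=
  (forall e, edges G e -> forall A : set R, measurable A ->
     distribution P (U e) A = uniform_prob (@ltr01 R) A) /\
  (forall (s : seq (set V)) (B : set V -> set R),
     uniq s -> (forall e, e \in s -> edges G e) ->
     (forall e, measurable (B e)) ->
     P [set w | forall e, e \in s -> B e (U e w)] =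
     (\prod_(e <- s) P [set w | B e (U e w)])%E).

Variable U : set V -> {RV P >-> R}.

Definition open_edge (p : R) (w : Omega) (e : set V) : bool := U e w <= p.

Definition open_cluster (p : R) (w : Omega) (x : V) : set V :=
  [set y | exists s : seq V,
    path (fun u v => adj G u v && open_edge p w [set u; v]) x s /\
    last x s = y].

Definition p_c : R :=
  sup [set p : R | 0 <= p <= 1 /\
    {ae P, forall w, ~ exists x, infinite_set (open_cluster p w x)}].

Definition disordered (c1 c2 : set V -> R) (p : R) (w : Omega) : set V -> R :=
  fun e => if open_edge p w e then c1 e else c2 e.

Definition p_c_star (o : V) (lambda1 lambda2 : R) : R :=
  sup [set p : R | 0 <= p <= 1 /\
    {ae P, forall w, forall q, 0 <= q < p ->
       recurrent G
         (disordered (Clambda G o lambda1) (Clambda G o lambda2) q w)}].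

End Percolation.

Section Groups.
Variable gT : groupType.
Implicit Types H S : set gT.

Definition subgroup H := H 1%g /\ forall x y, H x -> H y -> H (x * y^-1)%g.

Definition generates S := forall H, subgroup H -> S `<=` H -> H = setT.

Definition finite_index H :=
  finite_set (range (fun g : gT => [set (g * h)%g | h in H])).

Definition isomorphic_to_Z H :=
  exists f : int -> gT,
    set_bij setT H f /\ forall m n, f (m + n) = (f m * f n)%g.

Definition virtually_Z :=
  exists H, [/\ subgroup H, finite_index H & isomorphic_to_Z H].

Definition cayley_rel S : rel gT := fun x y =>
  `[< x <> y /\ exists2 s, S s & (y = x * s)%g \/ (x = y * s)%g >].

Lemma cayley_rel_sym S : symmetric (cayley_rel S).
Proof.
move=> x y; apply/asboolP/asboolP => -[xy [s Ss xys]];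
  by split; [exact: nesym | exists s => //; case: xys; [right|left]].
Qed.

Lemma cayley_rel_irr S : irreflexive (cayley_rel S).
Proof. by move=> x; apply/asboolP => -[]. Qed.

Definition cayley_graph S : graph gT :=
  Graph (@cayley_rel_sym S) (@cayley_rel_irr S).

End Groups.

(* Main.v *)
Require Import Defs.
From HB Require Import structures.
From mathcomp Require Import all_boot all_order all_algebra.
From mathcomp Require Import all_classical all_reals all_analysis.
From mathcomp Require Import measurable_realfun ring lra zify.

Set Implicit Arguments.
Unset Strict Implicit.
Unset Printing Implicit Defensive.

Import Order.TTheory GRing.Theory Num.Theory.
Import numFieldNormedType.Exports.

Local Open Scope classical_set_scope.
Local Open Scope ring_scope.

(** Recurrence is decided by finite sums. A network with positive conductances
    is recurrent exactly when every vertex x has finitely supported functions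
    f with f x = 1 and arbitrarily small Dirichlet energy ([recurrentP]). In
    this form networks can be compared edge by edge ([null_energy_le]) and
    finitely many conductances do not matter; recurrence follows from one
    good test function, and transience from one path or flow.

    Recurrence for small p. If the balls grow more slowly than l^n, the edges
    far from o have small total C_l-conductance. Hence a finite set that
    contains a large ball, and whose boundary edges have conductance at most
    l^-|e|, has an indicator function of small energy ([null_energy_cut]).
    When all open clusters are finite, the union of those meeting a ball is
    such a set, because its boundary edges are closed and have conductance
    C_lambda2. So p_c^* >= p_c ([pc_le_pstar]), provided lambda2 exceeds the
    growth rate.

    Transience for large p. Let T be a breadth-first spanning tree and let l be
    below the growth rate. A finite cut of T of total weight sum l^-|v| cannot
    be too small: the part of G beyond a cut vertex v lies in balls around v,
    which are no larger than balls around o up to a constant shift of the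
    radius, and a small cut could be iterated to bound the growth of G by l
    ([cap_growth]). So T carries to each generation a flow of
    strength bounded below that sends at most l^-|v| through each v. Restricted
    to open branches and multiplied by p^-n, this flow keeps its mean strength,
    and its second moment and mean energy stay bounded as soon as
    p * l > max(1, lambda1). Hence with probability bounded away from 0 it
    has large strength and small energy, which gives transience for some p < 1
    ([tree_percolation_transient]). Used with two equal conductance functions,
    the same statement shows that lambda_c is at least the growth rate
    ([growth_above]). This settles the case lambda_c > 1. If lambda_c <= 1,
    then lambda1 < 1 and the resistances lambda1^|e| are summable, so each
    infinite open cluster contains a path of finite resistance to infinity
    ([infinite_cluster_transient]) and every p > p_c will do.

    Sharpness. Recurrence at a fixed p is a tail event of the independent
    edges, hence has probability 0 or 1 ([recurrent_zero_one]); since it is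
    monotone in p, it is enough to know it along the sequences p_c^* +- 1/n
    ([sharp_threshold]).

    Virtually cyclic groups. Their Cayley graphs have a Lipschitz coordinate
    in Z with fibres of bounded size ([virtually_Z_coordinate]). This gives
    infinitely many disjoint edge cuts of bounded size on both sides of any
    vertex; for p < 1 almost surely some cut on either side is closed, so all
    clusters are finite, and p_c = 1 <= p_c^*. *)

(** * Dirichlet energy and return probabilities *)

Section Sums.
Variables (R : realType) (T : eqType).

Lemma ler_sum_subset (s t : seq T) (F : T -> R) :
  uniq s -> (forall x, x \in s -> F x != 0 -> x \in t) ->
  (forall x, 0 <= F x) -> \sum_(x <- s) F x <= \sum_(x <- t) F x.
Proof.
move=> us st F0; rewrite (bigID (mem t)) /= [X in _ + X]big_seq_cond.
rewrite [X in _ + X]big1 ?addr0; last first.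
  by move=> x /andP[xs xt]; apply: contraNeq xt => /(st _ xs).
rewrite -big_filter.
elim: s t us {st} => [|a s IH] t /=; first by rewrite big_nil sumr_ge0.
case/andP => nas us; case: ifP => at_; last exact: IH.
rewrite big_cons (perm_big _ (perm_to_rem at_)) /= big_cons lerD2l.
have -> : [seq x <- s | x \in t] = [seq x <- s | x \in rem a t].
  apply: eq_in_filter => x xs.
  have xa : x != a by apply: contraNneq nas => <-.
  by rewrite (perm_mem (perm_to_rem at_)) inE (negPf xa).
exact: IH.
Qed.

End Sums.

Section Energy.
Variables (R : realType) (V : choiceType) (G : graph V) (nb : V -> seq V).
Hypotheses (nb_uniq : forall x, uniq (nb x)).
Hypotheses (mem_nb : forall x y, (y \in nb x) = adj G x y).

Implicit Types (c : set V -> R) (f h : V -> R) (s : seq V).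

Definition positive c := forall e, edges G e -> 0 < c e.

Definition cond c x y : R := if adj G x y then c [set x; y] else 0.

(** Each edge inside s is counted in both directions, so this is twice the
    usual Dirichlet form. *)
Definition energy c s f : R :=
  \sum_(x <- s) \sum_(y <- s) cond c x y * (f x - f y) ^+ 2.

(** The neighbours of the support are included so that no edge with f x != f y
    leaves s. *)
Definition covers s f :=
  uniq s /\ forall x, f x != 0 -> x \in s /\ {subset nb x <= s}.

(** The effective conductance from x to infinity vanishes. *)
Definition null_energy c x := forall eps, 0 < eps ->
  exists s f, [/\ covers s f, f x = 1 & energy c s f <= eps].

Lemma cond_sym c x y : cond c x y = cond c y x.
Proof. by rewrite /cond adj_sym setUC. Qed.

Lemma edge_adj x y : adj G x y -> edges G [set x; y].
Proof. by move=> xy; exists x, y. Qed.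

Lemma cond_ge0 c x y : positive c -> 0 <= cond c x y.
Proof.
by move=> c0; rewrite /cond; case: ifP => // /edge_adj/c0/ltW.
Qed.

Lemma energy_le c c' (k : R) s f :
  (forall e, edges G e -> c e <= k * c' e) -> energy c s f <= k * energy c' s f.
Proof.
move=> cc; rewrite /energy mulr_sumr; apply: ler_sum => x _.
rewrite mulr_sumr; apply: ler_sum => y _.
rewrite mulrA ler_wpM2r ?sqr_ge0 //.
by rewrite /cond; case: ifP => [/edge_adj/cc//|_]; rewrite mulr0.
Qed.

Lemma null_energy_le c c' (k : R) x : 0 < k ->
  (forall e, edges G e -> c e <= k * c' e) -> null_energy c' x -> null_energy c x.
Proof.
move=> k0 cc rc e e0.
have [|s [f [cov fx Ee]]] := rc (e / k); first exact: divr_gt0.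
exists s, f; split=> //; apply: (le_trans (energy_le s f cc)).
by rewrite mulrC -ler_pdivlMr.
Qed.

Lemma sum_nb_cond c s x (F : V -> R) : uniq s -> {subset nb x <= s} ->
  \sum_(y <- nb x) cond c x y * F y = \sum_(y <- s) cond c x y * F y.
Proof.
move=> us xs; rewrite [RHS](bigID (mem (nb x))) /=.
rewrite [X in _ = _ + X]big1 ?addr0; last first.
  by move=> y; rewrite mem_nb /cond => /negPf ->; rewrite mul0r.
rewrite -[RHS]big_filter; apply: perm_big; apply: uniq_perm => //.
  by rewrite filter_uniq.
by move=> y; rewrite mem_filter; case: (boolP (y \in nb x)) => // /xs ->.
Qed.

Lemma sum_sym c s (a h : V -> R) :
  \sum_(x <- s) a x * \sum_(y <- s) cond c x y * (h x - h y) =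
  2^-1 * \sum_(x <- s) \sum_(y <- s) cond c x y * ((a x - a y) * (h x - h y)).
Proof.
pose A := \sum_(x <- s) \sum_(y <- s) cond c x y * (a x * (h x - h y)).
pose B := \sum_(x <- s) \sum_(y <- s) cond c x y * (a y * (h y - h x)).
have AB : A = B.
  rewrite /A /B exchange_big /=; apply: eq_bigr => x _; apply: eq_bigr => y _.
  by rewrite cond_sym.
have -> : \sum_(x <- s) a x * \sum_(y <- s) cond c x y * (h x - h y) = A.
  apply: eq_bigr => x _; rewrite mulr_sumr; apply: eq_bigr => y _.
  by rewrite mulrCA.
have -> : \sum_(x <- s) \sum_(y <- s) cond c x y * ((a x - a y) * (h x - h y))
        = A + B.
  rewrite /A /B -big_split; apply: eq_bigr => x _ /=.
  rewrite -big_split; apply: eq_bigr => y _ /=; ring.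
by rewrite -AB; lra.
Qed.

Definition vcond c x : R := \sum_(y <- nb x) cond c x y.

(** A positive function h that is harmonic off x and has Laplacian q at x
    gives the spectral gap inequality D(f) >= f(x)^2 q / h(x) of Hardy and
    Barta: summing by parts against f^2/h, each edge contributes (f y)^2/h y -
    (f z)^2/h z times h y - h z, which falls short of (f y - f z)^2 by a
    square. *)
Lemma energy_ge_superharmonic c s f h x (q : R) : positive c -> covers s f ->
  (forall y, 0 < h y) ->
  (forall y, y != x -> \sum_(z <- nb y) cond c y z * (h y - h z) = 0) ->
  \sum_(z <- nb x) cond c x z * (h x - h z) = q -> f x != 0 ->
  2 * (f x ^+ 2 / h x * q) <= energy c s f.
Proof.
move=> c0 [us cov] h0 hh hx fx.
pose a y := f y ^+ 2 / h y.
have -> : 2 * (f x ^+ 2 / h x * q) =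
  2 * \sum_(y <- s) a y * \sum_(z <- s) cond c y z * (h y - h z).
  congr (_ * _); rewrite (bigD1_seq x) //=; last by have [] := cov x fx.
  rewrite -(sum_nb_cond _ _ us) ?hx; last by have [] := cov x fx.
  rewrite big1 ?addr0 // => y yx.
  have [fy|fy] := eqVneq (f y) 0; first by rewrite /a fy expr0n /= !mul0r.
  rewrite -(sum_nb_cond _ _ us) ?hh ?mulr0 //; by have [] := cov y fy.
rewrite sum_sym mulrA divff ?mul1r //.
apply: ler_sum => y _; apply: ler_sum => z _.
rewrite ler_wpM2l ?cond_ge0 // /a.
rewrite -subr_ge0.
have -> : (f y - f z) ^+ 2 - (f y ^+ 2 / h y - f z ^+ 2 / h z) * (h y - h z) =
  (f y * h z - f z * h y) ^+ 2 / (h y * h z).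
  field; by rewrite !gt_eqF.
by rewrite divr_ge0 ?sqr_ge0 // ltW // mulr_gt0.
Qed.

Definition step c x y : R := cond c x y / vcond c x.

Definition avg c (h : V -> R) x : R := \sum_(y <- nb x) step c x y * h y.

(** The probability of visiting x within the first n steps, by the Markov
    property at time 1. *)
Fixpoint hit c x n : V -> R :=
  match n with
  | 0%N => fun y => (y == x)%:R
  | m.+1 => fun y => if y == x then 1 else avg c (hit c x m) y
  end.

(** The probability of returning to x at a time between 1 and n + 1. *)
Definition ret c x n := avg c (hit c x n) x.

Definition no_isolated := forall x, nb x != [::].

Hypothesis noiso : no_isolated.

Lemma vcond_gt0 c x : positive c -> 0 < vcond c x.
Proof.
move=> c0; rewrite /vcond; have := noiso x; have := mem_nb x.
case: (nb x) => // y l my _; rewrite big_cons ltr_pwDl ?sumr_ge0 //.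
  have xy : adj G x y by rewrite -my mem_head.
  by rewrite /cond xy; exact/c0/edge_adj.
by move=> z _; exact: cond_ge0.
Qed.

Lemma step_ge0 c x y : positive c -> 0 <= step c x y.
Proof. by move=> c0; rewrite divr_ge0 ?cond_ge0 // ltW // vcond_gt0. Qed.

Lemma sum_step c x : positive c -> \sum_(y <- nb x) step c x y = 1.
Proof.
by move=> c0; rewrite /step -mulr_suml divff // gt_eqF // vcond_gt0.
Qed.

Lemma avg_le c h h' x : positive c -> (forall y, h y <= h' y) ->
  avg c h x <= avg c h' x.
Proof.
by move=> c0 hh; apply: ler_sum => y _; rewrite ler_wpM2l ?step_ge0.
Qed.

Lemma avg_cst c (k : R) x : positive c -> avg c (fun _ => k) x = k.
Proof. by move=> c0; rewrite /avg -mulr_suml sum_step // mul1r. Qed.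

Lemma hit_ge0 c x n y : positive c -> 0 <= hit c x n y.
Proof.
move=> c0; elim: n y => [|n IH] y /=; first by rewrite ler0n.
case: ifP => // _; rewrite -(avg_cst 0 y c0); exact: avg_le.
Qed.

Lemma hit_le1 c x n y : positive c -> hit c x n y <= 1.
Proof.
move=> c0; elim: n y => [|n IH] y /=; first by rewrite lern1 leq_b1.
case: ifP => // _; rewrite -(avg_cst 1 y c0); exact: avg_le.
Qed.

Lemma hit_self c x n : hit c x n x = 1.
Proof. by case: n => [|n] /=; rewrite eqxx. Qed.

Lemma hit_mono c x n y : positive c -> hit c x n y <= hit c x n.+1 y.
Proof.
move=> c0; elim: n y => [|n IH] y.
  rewrite [hit c x 1 y]/=; case: ifP => [/eqP->|yx]; first by rewrite hit_self.
  rewrite /= yx -[X in X <= _](avg_cst 0 y c0).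
  by apply: avg_le => // z; rewrite ler0n.
rewrite {1}/hit -/hit [hit c x n.+2 y]/=; case: ifP => // _; exact: avg_le.
Qed.

Lemma sum_cond_diff c h x : positive c ->
  \sum_(y <- nb x) cond c x y * (h x - h y) = vcond c x * (h x - avg c h x).
Proof.
move=> c0; rewrite mulrBr /avg mulr_sumr {1}/vcond mulr_suml -sumrB.
apply: eq_bigr => y _; rewrite /step mulrBr; congr (_ - _).
by field; rewrite gt_eqF // vcond_gt0.
Qed.

Lemma supp_cover x : forall n, exists s, forall c, covers s (hit c x n).
Proof.
suff H n : exists s, forall c y, hit c x n y != 0 -> y \in s.
  move=> n; have [s ss] := H n.
  exists (undup (s ++ flatten [seq nb y | y <- s])) => c; split.
    exact: undup_uniq.
  move=> y /ss ys; rewrite mem_undup mem_cat ys; split=> // z yz.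
  rewrite mem_undup mem_cat; apply/orP; right; apply/flattenP.
  by exists (nb y) => //; exact: map_f.
elim: n => [|n [s ss]].
  exists [:: x] => c y /=; rewrite inE; by case: (y == x) => //=; rewrite eqxx.
exists (x :: flatten [seq nb y | y <- s]) => c y /=; rewrite inE.
case: (y == x) => //= nz; apply/flattenP.
have [z [zy hz]] : exists z, z \in nb y /\ hit c x n z != 0.
  apply/not_existsP => K; move: nz; rewrite /avg big_seq big1 ?eqxx //.
  move=> z zy; have /not_andP[//|/negP] := K z; rewrite negbK => /eqP ->.
  by rewrite mulr0.
exists (nb z); first by apply: map_f; exact: ss hz.
by rewrite mem_nb adj_sym -mem_nb.
Qed.

(** Off x the function hit is subharmonic in time, hit n <= avg (hit n), so in
    the summation by parts only the term at x is positive, and it is the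
    escape probability times the total conductance. *)
Lemma energy_hit c x s n : positive c -> covers s (hit c x n) ->
  energy c s (hit c x n) <= 2 * (vcond c x * (1 - ret c x n)).
Proof.
move=> c0 [us cov]; set h := hit c x n.
have -> : energy c s h =
    2 * \sum_(y <- s) h y * \sum_(z <- s) cond c y z * (h y - h z).
  by rewrite sum_sym mulrA divff ?mul1r // pnatr_eq0.
rewrite ler_wpM2l ?ler0n //.
have hx1 : h x = 1 by rewrite /h hit_self.
have [xs nxs] : x \in s /\ {subset nb x <= s}.
  by apply: cov; rewrite -/h hx1 oner_eq0.
rewrite (bigD1_seq x) //= -(sum_nb_cond _ _ us) //.
rewrite sum_cond_diff // hx1 mul1r gerDl sumr_le0 // => y yx.
have [->|fy] := eqVneq (h y) 0; first by rewrite mul0r.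
have [_ nys] := cov y fy.
rewrite -(sum_nb_cond _ _ us) //.
rewrite sum_cond_diff //.
rewrite mulr_ge0_le0 ?hit_ge0 // mulr_ge0_le0 ?(ltW (vcond_gt0 _ _)) //.
by rewrite subr_le0; have := hit_mono x n y c0; rewrite /= (negPf yx).
Qed.

(** Truncated hitting probabilities are test functions whose energy tends to
    the escape probability; conversely their limit is superharmonic, and a
    positive escape probability bounds every energy from below. *)
Lemma null_energyP c x : positive c ->
  null_energy c x <-> (forall eps, 0 < eps -> exists n, 1 - eps <= ret c x n).
Proof.
move=> c0; split=> H eps e0; last first.
  have k0 : 0 < 2 * vcond c x by rewrite mulr_gt0 ?vcond_gt0 ?ltr0n.
  have [|n Hn] := H (eps / (2 * vcond c x)); first exact: divr_gt0.
  have [s ss] := supp_cover x n.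
  exists s, (hit c x n); split=> //; first by rewrite hit_self.
  apply: (le_trans (energy_hit c0 (ss c))).
  rewrite mulrA mulrC -ler_pdivlMr //; lra.
apply: contrapT => /forallNP K.
have {}K n : ret c x n < 1 - eps by rewrite ltNge; apply/negP.
pose h y := lim (hit c x n y @[n --> \oo]).
have hcv y : hit c x n y @[n --> \oo] --> h y.
  apply: nondecreasing_is_cvgn.
    by apply/nondecreasing_seqP => n; exact: hit_mono.
  by exists 1 => _ [n _ <-]; exact: hit_le1.
have avgcv y : avg c (hit c x n) y @[n --> \oo] --> avg c h y.
  rewrite /avg; apply: cvg_big => [|z _]; first exact: add_continuous.
  by apply: cvgMr; exact: hcv.
have h0 y : 0 <= h y.
  by apply: limr_ge; [apply/cvg_ex; exists (h y); exact: hcv|apply: nearW => n; exact: hit_ge0].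
have hx : h x = 1.
  by rewrite /h; under eq_fun do rewrite hit_self; apply: lim_cst.
have hh y : y != x -> h y = avg c h y.
  move=> yx; apply: (cvg_unique _ _ (avgcv y)) => //.
  have := hcv y; rewrite -(cvg_shiftS (fun n => hit c x n y)) /=.
  by rewrite (negPf yx).
have hr : avg c h x <= 1 - eps.
  rewrite -(cvg_lim _ (avgcv x)) //; apply: limr_le.
    by apply/cvg_ex; exists (avg c h x); exact: avgcv.
  by apply: nearW => n; exact: ltW (K n).
have q0 : 0 < vcond c x * eps by rewrite mulr_gt0 ?vcond_gt0.
have [|s [f [cov fx Ef]]] := H (vcond c x * eps / 2); first by rewrite divr_gt0.
(* Adding 1 makes the limit h strictly positive without changing its
   Laplacian. *)
pose g y := h y + 1.
have gd y z : g y - g z = h y - h z by rewrite /g; ring.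
have := @energy_ge_superharmonic c s f g x (vcond c x * (1 - avg c h x)) c0 cov.
have -> : f x ^+ 2 / g x = 2^-1 by rewrite fx /g hx expr1n; field.
rewrite mulrA divff ?pnatr_eq0 // mul1r => /(_ _ _ _ _) L.
have {}L : vcond c x * (1 - avg c h x) <= energy c s f.
  apply: L.
  - by move=> y; rewrite /g ltr_wpDl.
  - move=> y yx; under eq_bigr do rewrite gd.
    by rewrite sum_cond_diff // -hh // subrr mulr0.
  - by under eq_bigr do rewrite gd; rewrite sum_cond_diff // hx.
  - by rewrite fx oner_eq0.
have : vcond c x * eps <= vcond c x * (1 - avg c h x).
  by apply: ler_wpM2l; [exact/ltW/vcond_gt0|lra].
by move: L Ef q0; lra.
Qed.

End Energy.

(** * Return probabilities of a realization *)

Section Pr.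
Variables (R : realType) (d : measure_display) (Omega : measurableType d).
Variable P : probability Omega R.

(** Real-valued probabilities, so that ring and linear arithmetic apply. *)
Definition pr (A : set Omega) : R := fine (P A).

Lemma prE A : measurable A -> P A = (pr A)%:E.
Proof. by move=> mA; rewrite /pr fineK // fin_num_measure. Qed.

Lemma pr_ge0 A : 0 <= pr A.
Proof. exact: fine_ge0. Qed.

Lemma prU A B : measurable A -> measurable B -> A `&` B = set0 ->
  pr (A `|` B) = pr A + pr B.
Proof.
move=> mA mB AB; rewrite /pr measureU // fineD //; exact: fin_num_measure.
Qed.

Lemma pr_splitI A B : measurable A -> measurable B ->
  pr A = pr (A `&` B) + pr (A `&` ~` B).
Proof.
move=> mA mB; rewrite -prU; last 1 first.
- by rewrite setIACA setICr setI0.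
- by rewrite -setIUr setUv setIT.
- exact: measurableI.
- by apply: measurableI => //; exact: measurableC.
Qed.

Lemma pr_le A B : measurable A -> measurable B -> A `<=` B -> pr A <= pr B.
Proof.
move=> mA mB AB; apply: fine_le; [exact: fin_num_measure..|].
by apply: le_measure; rewrite ?inE.
Qed.

Lemma pr0 : pr set0 = 0.
Proof. by rewrite /pr measure0. Qed.

Lemma prT : pr setT = 1.
Proof. by rewrite /pr probability_setT. Qed.

Lemma pr_le1 A : measurable A -> pr A <= 1.
Proof. by move=> mA; rewrite -prT; exact: pr_le. Qed.

Lemma pr_bigcup_nd (F : nat -> set Omega) : (forall n, measurable (F n)) ->
  nondecreasing_seq F -> pr (F n) @[n --> \oo] --> pr (\bigcup_n F n).
Proof.
move=> mF ndF; have mU : measurable (\bigcup_n F n) by exact: bigcup_measurable.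
have : P (F n) @[n --> \oo] --> P (\bigcup_n F n).
  exact: nondecreasing_cvg_mu.
by rewrite prE // => /fine_cvgP[].
Qed.

Lemma pr_bigcap_ni (F : nat -> set Omega) : (forall n, measurable (F n)) ->
  nonincreasing_seq F -> pr (F n) @[n --> \oo] --> pr (\bigcap_n F n).
Proof.
move=> mF niF; have mU : measurable (\bigcap_n F n).
  by apply: bigcap_measurable => //; exists 0%N.
have F0 : (P (F 0%N) < +oo)%E.
  by rewrite (le_lt_trans (probability_le1 _ _)) // ltry.
have : P (F n) @[n --> \oo] --> P (\bigcap_n F n).
  exact: nonincreasing_cvg_mu.
by rewrite prE // => /fine_cvgP[].
Qed.

Lemma pr_ae (A : set Omega) : measurable A ->
  {ae P, forall w, A w} <-> pr A = 1.
Proof.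
move=> mA; have mC := measurableC mA.
have H : pr A + pr (~` A) = 1.
  by rewrite -prU ?setUv ?prT // setICr.
split=> [|A1].
  move/(negligibleP P mC) => nA.
  by move: H; rewrite {2}/pr nA addr0.
have : P (~` A) = 0%E by rewrite prE //; congr EFin; lra.
by move/(negligibleP P mC).
Qed.

End Pr.

Section Walks.
Variables (R : realType) (V : choiceType) (G : graph V) (nb : V -> seq V).
Hypotheses (nb_uniq : forall x, uniq (nb x)).
Hypotheses (mem_nb : forall x y, (y \in nb x) = adj G x y).
Hypothesis noiso : no_isolated nb.
Implicit Types (c : set V -> R).

Lemma set2_inj (x y z : V) : [set x; y] = [set x; z] -> y = z.
Proof.
move=> H; have : [set x; y] y by right.
rewrite H => -[yx|//]; have : [set x; z] z by right.
by rewrite -H => -[->|//].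
Qed.

Lemma vertex_conductanceE c x : vertex_conductance G c x = vcond G nb c x.
Proof.
rewrite /vertex_conductance.
have -> : [set e | edges G e /\ e x] = [set` [seq [set x; y] | y <- nb x]].
  apply/seteqP; split=> e /=.
    move=> [[a [b [ab ->]]] [] E]; apply/mapP.
      by exists b; rewrite ?mem_nb E.
    by exists a; rewrite ?mem_nb E 1?adj_sym // setUC.
  move=> /mapP[y]; rewrite mem_nb => xy ->; split; last by left.
  by exists x, y.
rewrite -fsbig_seq; last first.
  rewrite map_inj_in_uniq // => y z _ _; exact: set2_inj.
rewrite big_map /vcond big_seq [RHS]big_seq; apply: eq_bigr => y.
by rewrite mem_nb /cond => ->.
Qed.

Lemma trans_probE c x y : trans_prob G c x y = step G nb c x y.
Proof.
rewrite /trans_prob /step vertex_conductanceE /cond.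
by case: ifP => //; rewrite mul0r.
Qed.

Section Realization.
Variables (c : set V -> R) (x : V).
Hypothesis c0 : positive G c.
Variables (d : measure_display) (Omega : measurableType d).
Variables (P : probability Omega R) (X : nat -> Omega -> V).
Hypothesis HX : random_walk G c x P X.

Let pre N (v : nat -> V) := [set w | forall k, (k <= N)%N -> X k w = v k].
Let meet N n := [set w | exists k, [/\ (N <= k)%N, (k <= n)%N & X k w = x]].
Let upd (v : nat -> V) N z := fun k => if (k <= N)%N then v k else z.

Lemma measurable_at n v : measurable [set w | X n w = v].
Proof. exact: HX.1. Qed.

Lemma measurable_pre N v : measurable (pre N v).
Proof.
have -> : pre N v = \bigcap_(k in `I_N.+1) [set w | X k w = v k].
  by apply/seteqP; split=> w H k /= Hk; exact: H.
by apply: bigcap_measurable; [exists 0%N|move=> k _; exact: measurable_at].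
Qed.

Lemma measurable_meet N n : measurable (meet N n).
Proof.
have -> : meet N n = \bigcup_(k in [set k | (N <= k <= n)%N]) [set w | X k w = x].
  apply/seteqP; split=> w.
    by move=> [k [a b e]]; exists k => //=; rewrite a b.
  by move=> [k /= /andP[a b] e]; exists k.
by apply: bigcup_measurable => k _; exact: measurable_at.
Qed.

Lemma pr_pre N v : v 0%N = x ->
  pr P (pre N v) = \prod_(k < N) step G nb c (v k) (v k.+1).
Proof.
move=> v0; rewrite /pr HX.2 asboolT //=.
by apply: eq_bigr => k _; rewrite trans_probE.
Qed.

Lemma measurable_notin n (t : seq V) : measurable [set w | X n w \notin t].
Proof.
have -> : [set w | X n w \notin t] =
    ~` \bigcup_(z in [set` t]) [set w | X n w = z].
  apply/seteqP; split=> w /=.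
    by move=> /negP H [z /= zt Xz]; apply: H; rewrite Xz.
  by move=> H; apply/negP => Xt; apply: H; exists (X n w).
apply: measurableC; apply: fin_bigcup_measurable => [|z _].
  exact: finite_seq.
exact: measurable_at.
Qed.

Lemma pr_partition A n (s : seq V) : measurable A -> uniq s ->
  pr P A = \sum_(z <- s) pr P (A `&` [set w | X n w = z]) +
           pr P (A `&` [set w | X n w \notin s]).
Proof.
move=> mA; elim: s => [|a s IH] /=.
  rewrite big_nil add0r => _; congr (pr P _); apply/seteqP; split=> w //.
  by case.
move=> /andP[nas us]; rewrite IH // big_cons addrC [X in _ = X + _]addrC -addrA addrC.
congr (_ + _); rewrite -prU.
- congr (pr P _); apply/seteqP; split=> w /=.
    move=> [Aw Xs]; have [Xa|Xa] := eqVneq (X n w) a; [left|right] => //.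
    by split=> //; rewrite inE negb_or Xa.
  move=> [[Aw ->]|[Aw]] //; rewrite inE negb_or => /andP[_]; by split.
- by apply: measurableI => //; exact: measurable_at.
- by apply: measurableI => //; exact: measurable_notin.
- apply/seteqP; split=> w //= [[_ ->] [_]]; by rewrite mem_head.
Qed.

Lemma pr_pre_step N v z : v 0%N = x ->
  pr P (pre N.+1 (upd v N z)) = pr P (pre N v) * step G nb c (v N) z.
Proof.
move=> v0; rewrite !pr_pre // big_ord_recr /=.
have -> : upd v N z N = v N by rewrite /upd leqnn.
have -> : upd v N z N.+1 = z by rewrite /upd ltnn.
congr (_ * _); apply: eq_bigr => k _.
by rewrite /upd ltn_ord (ltnW (ltn_ord k)).
Qed.

Lemma pr_pre_split N v B : v 0%N = x -> measurable B ->
  pr P (pre N v `&` B) = \sum_(z <- nb (v N)) pr P (pre N.+1 (upd v N z) `&` B).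
Proof.
move=> v0 mB.
have E z A : pre N v `&` A `&` [set w | X N.+1 w = z] = pre N.+1 (upd v N z) `&` A.
  apply/seteqP; split=> w /=.
    move=> [[H Aw] Xz]; split=> // k; rewrite /upd leq_eqVlt ltnS.
    case: (leqP k N) => [kN _|kN]; first exact: H.
    by rewrite orbF => /eqP ->.
  move=> [H Aw]; split; last by rewrite H // /upd ltnn.
  by split=> // k kN; rewrite H ?(leqW kN) // /upd kN.
have mpB : measurable (pre N v `&` B).
  by apply: measurableI => //; exact: measurable_pre.
(* The transition probabilities from v N add up to 1, so leaving the
   neighbourhood is a null event. *)
have pr_last : pr P (pre N v `&` [set w | X N.+1 w \notin nb (v N)]) = 0.
  have := pr_partition N.+1 (measurable_pre N v) (nb_uniq (v N)).
  have -> : \sum_(z <- nb (v N)) pr P (pre N v `&` [set w | X N.+1 w = z]) =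
      pr P (pre N v).
    transitivity (\sum_(z <- nb (v N)) pr P (pre N v) * step G nb c (v N) z).
      apply: eq_bigr => z _.
      by rewrite -{1}(setIT (pre N v)) E setIT pr_pre_step.
    by rewrite -mulr_sumr sum_step ?mulr1.
  lra.
rewrite (pr_partition N.+1 mpB (nb_uniq (v N))).
set r := pr P (_ `&` _ `&` _).
have -> : r = 0.
  apply/eqP; rewrite eq_le pr_ge0 andbT -pr_last; apply: pr_le.
  - by apply: measurableI => //; exact: measurable_notin.
  - by apply: measurableI; [exact: measurable_pre|exact: measurable_notin].
  - by move=> w [[]].
by rewrite addr0; apply: eq_bigr => z _; rewrite E.
Qed.

(** The Markov property for the hitting time of x, read off from the finite-
    dimensional laws: split on the value at time N + 1. *)
Lemma pr_pre_meet n N v : v 0%N = x ->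
  pr P (pre N v `&` meet N (N + n)) = pr P (pre N v) * hit G nb c x n (v N).
Proof.
elim: n N v => [|n IH] N v v0 /=.
  rewrite addn0; have [vx|vx] := eqVneq (v N) x.
    rewrite mulr1; congr (pr P _); apply/seteqP; split=> w; first by case.
    by move=> H; split=> //; exists N; split=> //; rewrite H.
  rewrite mulr0 -(pr0 P); congr (pr P _).
  apply/seteqP; split=> w // [H [k [a b]]].
  have -> : k = N by apply/eqP; rewrite eqn_leq a b.
  by rewrite H // => /eqP; rewrite (negPf vx).
have [vx|vx] := eqVneq (v N) x.
  rewrite mulr1; congr (pr P _); apply/seteqP; split=> w; first by case.
  by move=> H; split=> //; exists N; split=> //; rewrite ?leq_addr // H.
rewrite pr_pre_split //; last exact: measurable_meet.
rewrite /avg mulr_sumr; apply: eq_bigr => z _.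
have -> : pre N.+1 (upd v N z) `&` meet N (N + n.+1) =
          pre N.+1 (upd v N z) `&` meet N.+1 (N.+1 + n).
  apply/seteqP; split=> w [H [k [a b e]]]; split=> //; exists k; split=> //.
  - rewrite ltn_neqAle a andbT; apply: contraNneq vx => kN.
    by rewrite -e -kN H // /upd leqnn.
  - by rewrite addSnnS.
  - exact: ltnW.
  - by rewrite -addSnnS.
by rewrite IH // pr_pre_step // mulrA /upd ltnn.
Qed.

Lemma pr_return n : pr P (meet 1 n.+1) = ret G nb c x n.
Proof.
pose v (k : nat) := x.
have p0 : pr P (pre 0 v) = 1 by rewrite pr_pre // big_ord0.
have m0 := measurable_pre 0 v.
have mm := measurable_meet 1 n.+1.
have -> : pr P (meet 1 n.+1) = pr P (pre 0 v `&` meet 1 n.+1).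
  rewrite (pr_splitI P mm m0) [X in _ + X](_ : _ = 0) ?addr0 1?setIC //.
  apply/eqP; rewrite eq_le pr_ge0 andbT.
  have : pr P (pre 0 v) + pr P (~` pre 0 v) = 1.
    by rewrite -prU ?setUv ?prT ?setICr //; exact: measurableC.
  rewrite p0 => H; have -> : 0 = pr P (~` pre 0 v) by lra.
  apply: pr_le => //; [|exact: measurableC]; apply: measurableI => //.
  exact: measurableC.
rewrite pr_pre_split // /ret /avg; apply: eq_bigr => z _.
rewrite -(add1n n) pr_pre_meet // /upd /=; congr (_ * _).
by rewrite pr_pre // big_ord1.
Qed.

(** Almost sure return depends on the walk only through the return
    probabilities within n steps, and these increase to the probability of
    ever returning. *)
Lemma return_aeP :
  {ae P, forall w, exists2 n, (0 < n)%N & X n w = x} <->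
  (forall eps, 0 < eps -> exists n, 1 - eps <= ret G nb c x n).
Proof.
have E : [set w | exists2 n, (0 < n)%N & X n w = x] = \bigcup_n meet 1 n.+1.
  apply/seteqP; split=> w /=.
    by move=> [[//|n] n0 e]; exists n => //; exists n.+1.
  by move=> [n _ [k [a _ e]]]; exists k.
have mU : measurable (\bigcup_n meet 1 n.+1).
  by apply: bigcup_measurable => n _; exact: measurable_meet.
have cv := @pr_bigcup_nd _ _ _ P (fun n => meet 1 n.+1).
have {}cv : ret G nb c x n @[n --> \oo] --> pr P (\bigcup_n meet 1 n.+1).
  under eq_fun do rewrite -pr_return; apply: cv => [n|].
    exact: measurable_meet.
  apply/nondecreasing_seqP => n; apply/subsetPset => w [k [a b e]].
  by exists k; split=> //; exact: leqW.
rewrite -E in mU cv.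
apply: iff_trans (pr_ae P mU) _; split=> [H1 eps e0|H].
  move: cv; rewrite H1 => /cvgrPdist_le/(_ _ e0)[N _ /(_ N (leqnn N)) /=].
  by move=> /(le_trans (ler_norm _)) ?; exists N; lra.
apply/eqP; rewrite eq_le pr_le1 //=; apply/ler_addgt0Pr => eps e0.
have [n Hn] := H _ e0.
have H' : ret G nb c x n <= pr P [set w | exists2 n, (0 < n)%N & X n w = x].
  rewrite -pr_return E; apply: pr_le; first exact: measurable_meet.
    by rewrite -E.
  by move=> w Hw; exists n.
lra.
Qed.

End Realization.
End Walks.

(** * Existence of the random walk *)

Section Uniform.
Variable R : realType.

Lemma uniform_prob01E (A : set R) : measurable A ->
  uniform_prob (@ltr01 R) A = lebesgue_measure (A `&` `[0, 1]).
Proof.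
move=> mA; rewrite /uniform_prob integral_uniform_pdf.
rewrite (eq_integral (fun=> 1%E)); last first.
  move=> u; rewrite inE /= in_itv /= => -[_ u01].
  by rewrite /uniform_pdf u01 subr0 invr1.
by rewrite integral_cst ?mul1e //; exact: measurableI.
Qed.

Lemma uniform_prob01_itv (a b : R) : 0 <= a -> a <= b -> b <= 1 ->
  uniform_prob (@ltr01 R) `[a, b[ = (b - a)%:E.
Proof.
move=> a0 ab b1; rewrite uniform_prob01E // setIidl; last first.
  move=> u /=; rewrite !in_itv /= => /andP[au ub].
  by rewrite (le_trans a0 au) (le_trans (ltW ub) b1).
rewrite lebesgue_measure_itv /= lte_fin; case: ltgtP ab => // -> _.
by rewrite subrr.
Qed.

Lemma uniform_prob01_le (p : R) : 0 <= p <= 1 ->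
  uniform_prob (@ltr01 R) [set u | u <= p] = p%:E.
Proof.
move=> /andP[p0 p1].
have -> : [set u | u <= p] = `]-oo, p]%classic by apply/seteqP; split=> u /=; rewrite in_itv.
rewrite uniform_prob01E //.
have -> : `]-oo, p]%classic `&` `[0, 1]%classic = `[0, p]%classic.
  apply/seteqP; split=> u /=; rewrite !in_itv /=; first by move=> [-> /andP[->]].
  by move=> /andP[-> up]; rewrite up (le_trans up p1).
rewrite lebesgue_measure_itv /= lte_fin; case: ltgtP p0 => // [_ _|<- //].
by rewrite sube0.
Qed.

End Uniform.

Section Existence.
Variables (R : realType) (V : choiceType) (G : graph V) (nb : V -> seq V).
Hypotheses (nb_uniq : forall x, uniq (nb x)).
Hypotheses (mem_nb : forall x y, (y \in nb x) = adj G x y).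
Hypothesis noiso : no_isolated nb.
Variables (c : set V -> R) (x : V).
Hypothesis c0 : positive G c.

Section Pick.
Variables (q : V -> R).

(** One step of the walk driven by r in [0, 1): the unit interval is cut into
    pieces of lengths q y, the piece containing r gives the new vertex, and
    the relative position in that piece is the number that drives the next
    step. *)
Fixpoint pick (l : seq V) (r : R) : V * R :=
  if l is y :: l' then if r < q y then (y, r / q y) else pick l' (r - q y)
  else (x, r).

Fixpoint cum (l : seq V) (z : V) : R :=
  if l is y :: l' then if y == z then 0 else q y + cum l' z else 0.

Lemma cum_bounds l z : (forall y, 0 <= q y) -> z \in l ->
  0 <= cum l z /\ cum l z + q z <= \sum_(y <- l) q y.
Proof.
move=> q0; elim: l => // y l IH; rewrite inE big_cons /= eq_sym.
case: eqVneq => [->|_] /=; first by rewrite add0r lerDl sumr_ge0.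
by move=> /IH [a b]; rewrite addr_ge0 // -addrA lerD2l.
Qed.

Lemma pick_spec l r : (forall y, y \in l -> 0 < q y) -> uniq l ->
  0 <= r < \sum_(y <- l) q y ->
  let z := (pick l r).1 in
  [/\ z \in l, cum l z <= r < cum l z + q z & (pick l r).2 = (r - cum l z) / q z].
Proof.
elim: l r => [|y l IH] r q0 /=; first by rewrite big_nil => _ /andP[a b]; lra.
rewrite big_cons => /andP[nyl ul] /andP[r0 r1]; case: ltP => ry /=.
  by rewrite eqxx subr0 add0r r0 ry mem_head.
have rr : 0 <= r - q y < \sum_(y <- l) q y.
  by rewrite subr_ge0 ry ltrBlDl.
have q0' t : t \in l -> 0 < q t by move=> tl; apply: q0; rewrite inE tl orbT.
have [zl /andP[b1 b2] e] := IH _ q0' ul rr.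
rewrite e; move: zl b1 b2; set z := (pick _ _).1 => zl b1 b2.
rewrite inE zl orbT; case: eqVneq => [yz|_]; first by rewrite yz zl in nyl.
by split=> //; [apply/andP; split; lra|congr (_ / _); ring].
Qed.

Lemma pick_unique l r z : (forall y, y \in l -> 0 < q y) -> (forall y, 0 <= q y) ->
  uniq l -> z \in l -> cum l z <= r < cum l z + q z -> (pick l r).1 = z.
Proof.
move=> q0 qge0; elim: l r q0 => //= y l IH r q0 /andP[nyl ul].
rewrite inE eq_sym; case: eqVneq => [->|_] /=; first by rewrite add0r => _ /andP[_ ->].
move=> zl; have [b _] := cum_bounds qge0 zl.
move=> /andP[b1 b2]; rewrite ltNge (le_trans _ b1) ?lerDl //=.
apply: IH => //; first by move=> t tl; apply: q0; rewrite inE tl orbT.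
by apply/andP; split; lra.
Qed.

End Pick.

Let q y z := step G nb c y z.

Lemma q_gt0 y z : z \in nb y -> 0 < q y z.
Proof.
rewrite mem_nb => yz; apply: divr_gt0; last exact: vcond_gt0.
by rewrite /cond yz; exact/c0/edge_adj.
Qed.

Lemma q_ge0 y z : 0 <= q y z.
Proof. exact: step_ge0. Qed.

Let next (s : V * R) : V * R := pick (q s.1) (nb s.1) s.2.

Let state n (w : R) := iter n next (x, w).

Lemma next_spec y r : 0 <= r < 1 ->
  let z := (next (y, r)).1 in
  [/\ z \in nb y, cum (q y) (nb y) z <= r < cum (q y) (nb y) z + q y z,
     (next (y, r)).2 = (r - cum (q y) (nb y) z) / q y z
     & 0 <= (next (y, r)).2 < 1].
Proof.
move=> r01; have := @pick_spec (q y) (nb y) r (fun z => @q_gt0 y z) (nb_uniq y).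
rewrite sum_step // => /(_ r01); rewrite -/(next (y, r)) /=.
set z := (next _).1 => -[zy b e]; split=> //; rewrite e.
have qz := q_gt0 zy; case/andP: b => b1 b2.
apply/andP; split; last by rewrite ltr_pdivrMr // mul1r ltrBlDl.
by rewrite divr_ge0 ?subr_ge0 // ltW.
Qed.

Lemma next_unique y z r : z \in nb y ->
  cum (q y) (nb y) z <= r < cum (q y) (nb y) z + q y z -> (next (y, r)).1 = z.
Proof.
move=> zy b; apply: pick_unique => //; first by move=> t; exact: q_gt0.
exact: q_ge0.
Qed.

Lemma state_res n w : 0 <= w < 1 -> 0 <= (state n w).2 < 1.
Proof.
move=> w01; elim: n => //= n; rewrite -/(state n w).
case: (state n w) => y r /= r01; by have [] := next_spec y r01.
Qed.

Lemma measurable_state n z (B : set R) : measurable B ->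
  measurable [set w | [/\ 0 <= w < 1, (state n w).1 = z & B (state n w).2]].
Proof.
elim: n z B => [|n IH] z B mB.
  rewrite /state /=; have [->|xz] := eqVneq x z.
    have -> : [set w : R | [/\ 0 <= w < 1, z = z & B w]] = `[0, 1[%classic `&` B.
      by apply/seteqP; split=> w /=; rewrite in_itv /=; [case|case; split].
    exact: measurableI.
  rewrite (_ : [set w | _] = set0) //; apply/seteqP; split=> w //= [_ e].
  by rewrite e eqxx in xz.
pose f y (r : R) := (r - cum (q y) (nb y) z) / q y z.
have -> : [set w | [/\ 0 <= w < 1, (state n.+1 w).1 = z & B (state n.+1 w).2]] =
  \bigcup_(y in [set` nb z]) [set w | [/\ 0 <= w < 1, (state n w).1 = y
     & (`[cum (q y) (nb y) z, cum (q y) (nb y) z + q y z[%classic `&` f y @^-1` B)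
       (state n w).2]].
  apply/seteqP; split=> w /=.
    move=> [w01]; have := state_res n w01.
    rewrite -/(state n w); case est: (state n w) => [y r] /= r01.
    have [zy b e _] := next_spec y r01; move=> ez; rewrite e ez => Bz.
    exists y => /=; first by move: zy; rewrite ez !mem_nb adj_sym.
    by rewrite est /=; split=> //; split=> //; rewrite in_itv /= -ez.
  move=> [y /= yz [w01 ey [ir Br]]]; have := state_res n w01.
  rewrite -/(state n w); move: ey ir Br; case: (state n w) => y' r /= -> ir Br r01.
  have zy : z \in nb y by rewrite mem_nb adj_sym -mem_nb.
  have ez : (next (y, r)).1 = z.
    by apply: next_unique => //; move: ir; rewrite in_itv.
  have [_ _ e _] := next_spec y r01.
  by split=> //; rewrite e ez.
apply: fin_bigcup_measurable => [|y _]; first exact: finite_seq.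
apply: IH; apply: measurableI => //.
have mf : measurable_fun setT (f y).
  by apply: measurable_funM => //; apply: measurable_funB.
by rewrite -[X in measurable X]setTI; exact: mf.
Qed.

(** The numbers in [0, 1) that make the walk follow a given path form an
    interval whose length is the product of the transition probabilities. *)
Lemma state_cylinder (v : nat -> V) n :
  v 0%N = x -> (forall k, (k < n)%N -> v k.+1 \in nb (v k)) ->
  let L := \prod_(k < n) q (v k) (v k.+1) in
  0 < L /\ exists a, [/\ 0 <= a, a + L <= 1, forall w, 0 <= w < 1 ->
    (forall k, (k <= n)%N -> (state k w).1 = v k) <-> a <= w < a + L
    & forall w, a <= w < a + L -> state n w = (v n, (w - a) / L)].
Proof.
move=> v0; elim: n => [|n IH] hv /=.
  rewrite big_ord0; split=> //; exists 0; split=> //.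
  - move=> w w01; split=> [_|_ k]; first by rewrite add0r.
    by rewrite leqn0 => /eqP ->; rewrite v0.
  - by move=> w _; rewrite subr0 divr1 v0.
have [|L0 [a [a0 a1 Hw Hs]]] := IH; first by move=> k kn; apply: hv; exact: leqW.
rewrite big_ord_recr /=; set L := \prod_(k < n) _ in L0 a1 Hw Hs *.
have vn := hv n (leqnn _); have qv := q_gt0 vn.
have [cu0 cu1] := cum_bounds (@q_ge0 (v n)) vn; rewrite sum_step // in cu1.
set u := cum _ _ _ in cu0 cu1; set t := q _ _ in qv cu1 *.
have Lt : 0 < L * t by exact: mulr_gt0.
have sub w : a + L * u <= w < a + L * u + L * t -> a <= w < a + L.
  move=> /andP[h1 h2]; apply/andP; split.
    by apply: le_trans h1; rewrite lerDl mulr_ge0 // ltW.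
  apply: (lt_le_trans h2); rewrite -addrA lerD2l -mulrDr.
  by rewrite -[leRHS]mulr1 ler_pM2l.
have cl w : a <= w < a + L ->
    (u <= (w - a) / L < u + t) = (a + L * u <= w < a + L * u + L * t).
  move=> _; rewrite ler_pdivlMr // ltr_pdivrMr //.
  by congr (_ && _); apply/idP/idP; lra.
split=> //; exists (a + L * u); split.
- by rewrite addr_ge0 // mulr_ge0 // ltW.
- apply: le_trans a1; rewrite -addrA lerD2l -mulrDr.
  by rewrite -[leRHS]mulr1 ler_pM2l.
- move=> w w01; split=> H.
    have Hw' : a <= w < a + L.
      by apply/Hw => // k kn; apply: H; exact: leqW.
    rewrite -cl //; have := H n.+1 (leqnn _); rewrite /= -/(state n w) Hs //.
    have r01 : 0 <= (w - a) / L < 1 by have := state_res n w01; rewrite Hs.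
    by have [_ b _ _] := next_spec (v n) r01; move=> e; rewrite e in b.
  have Hw' := sub w H; move=> k; rewrite leq_eqVlt ltnS => /orP[/eqP ->|].
    rewrite /= -/(state n w) Hs //.
    by apply: next_unique => //; rewrite -/t -/u cl.
  by move: k; apply/Hw.
- move=> w H; have Hw' := sub w H; rewrite /= -/(state n w) Hs //.
  have w01 : 0 <= w < 1 by case/andP: Hw' => h1 h2; apply/andP; split; lra.
  have r01 : 0 <= (w - a) / L < 1 by have := state_res n w01; rewrite Hs.
  have e1 : (next (v n, (w - a) / L)).1 = v n.+1.
    by apply: next_unique => //; rewrite -/t -/u cl.
  have [_ _ e2 _] := next_spec (v n) r01.
  rewrite [LHS]surjective_pairing e2 e1 -/t -/u; congr (_, _); field.
  by rewrite !gt_eqF.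
Qed.

Definition walk n (w : R) : V := if 0 <= w < 1 then (state n w).1 else x.

(** The walk is realized on the unit interval with the uniform law. Without a
    realization the definition of recurrence would hold vacuously, so this is
    what allows hypotheses of recurrence to be used. *)
Lemma random_walk_exists : random_walk G c x (uniform_prob (@ltr01 R)) walk.
Proof.
have outE : [set w : R | ~ (0 <= w < 1)] = ~` `[0, 1[%classic.
  by apply/seteqP; split=> w /=; rewrite in_itv.
have mout : measurable [set w : R | ~ (0 <= w < 1)].
  by rewrite outE; exact: measurableC.
split=> [n z|n v].
  have -> : [set w | walk n w = z] =
     [set w | [/\ 0 <= w < 1, (state n w).1 = z & [set: R] (state n w).2]] `|`
     ([set w | ~ (0 <= w < 1)] `&` [set w | x = z]).
    apply/seteqP; split=> w /=; rewrite /walk.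
      by case: ifP => [w01 e|/negP w01 e]; [left|right].
    by case: ifP => [w01 [[]|[]]//|w01 [[]|[]]].
  apply: measurableU; first exact: measurable_state.
  apply: measurableI => //; have [->|xz] := eqVneq x z.
    by rewrite (_ : [set w | _] = setT) //; apply/seteqP; split.
  rewrite (_ : [set w | _] = set0) //; apply/seteqP; split=> w //= e.
  by rewrite e eqxx in xz.
set E := [set w | _].
have Pout : uniform_prob (@ltr01 R) [set w : R | ~ (0 <= w < 1)] = 0%E.
  transitivity (1 - uniform_prob (@ltr01 R) `[0%R, 1%R[)%E.
    by rewrite outE; exact: probability_setC.
  by rewrite uniform_prob01_itv // subr0 -EFinB subrr.
have [v0|v0] := pselect (v 0%N = x); last first.
  rewrite asboolF //; suff -> : E = set0 by rewrite measure0.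
  apply/seteqP; split=> w //= H; apply: v0; rewrite -H // /walk.
  by case: ifP.
rewrite asboolT //.
(* Outside [0, 1) the walk is frozen at x, so a cylinder contains all of
   this null set or none of it. *)
have outcase : [set w : R | ~ (0 <= w < 1)] `&` E = set0 \/
    [set w : R | ~ (0 <= w < 1)] `&` E = [set w : R | ~ (0 <= w < 1)].
  have [H|H] := pselect (forall k, (k <= n)%N -> v k = x); [right|left].
    apply/seteqP; split=> w; first by case.
    by move=> /= w01; split=> // k kn; rewrite /walk (negbTE (introN idP w01)) H.
  apply/seteqP; split=> w //= -[/negP w01 He]; apply: H => k kn.
  by rewrite -He // /walk (negPf w01).
have Pout0 : uniform_prob (@ltr01 R) ([set w : R | ~ (0 <= w < 1)] `&` E) = 0%E.
  by case: outcase => ->; rewrite ?measure0.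
have mo : measurable ([set w : R | ~ (0 <= w < 1)] `&` E).
  by case: outcase => ->.
have EE : E = (E `&` [set w : R | 0 <= w < 1]) `|`
              ([set w : R | ~ (0 <= w < 1)] `&` E).
  apply/seteqP; split=> w /=; last by move=> [[]|[]].
  by move=> Ew; have [?|?] := boolP (0 <= w < 1); [left|right; split=> //; apply/negP].
have [hv|hv] := pselect (forall k, (k < n)%N -> v k.+1 \in nb (v k)).
  have [L0 [a [a0 a1 Hw _]]] := state_cylinder v0 hv.
  set L := \prod_(k < n) _ in L0 a1 Hw.
  have Ein : E `&` [set w : R | 0 <= w < 1] = `[a, a + L[%classic.
    apply/seteqP; split=> w /=; rewrite in_itv /=.
      move=> [Ew w01]; apply/Hw => // k kn; have := Ew k kn.
      by rewrite /walk w01.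
    move=> H; have w01 : 0 <= w < 1.
      by case/andP: H => h1 h2; apply/andP; split; lra.
    by split=> // k kn; rewrite /walk w01; move: k kn; apply/Hw.
  transitivity (uniform_prob (@ltr01 R) (E `&` [set w : R | (0 <= w < 1)%R]) +
      uniform_prob (@ltr01 R) ([set w : R | ~ (0 <= w < 1)%R] `&` E))%E.
    rewrite {1}EE; apply: measureU => //; first by rewrite Ein.
    by apply/seteqP; split=> w //= [[_ H] [H' _]].
  rewrite Pout0 adde0 Ein (uniform_prob01_itv a0 _ a1); last by rewrite lerDl ltW.
  rewrite addrAC subrr add0r; congr EFin; apply: eq_bigr => k _.
  by rewrite (trans_probE nb_uniq mem_nb).
have Ein : E `&` [set w : R | 0 <= w < 1] = set0.
  apply/seteqP; split=> w //= [Ew w01]; apply: hv => k kn.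
  have ek : (state k w).1 = v k.
    by have := Ew k (ltnW kn); rewrite /walk w01.
  have := Ew k.+1 kn; rewrite /walk w01 /= -/(state k w).
  have := state_res k w01; rewrite (surjective_pairing (state k w)) ek => r01 <-.
  by have [] := next_spec (v k) r01.
rewrite EE Ein set0U; transitivity (0%:E : \bar R); first exact: Pout0.
have [k /not_implyP[kn /negP nk]] : exists k, ~ ((k < n)%N -> v k.+1 \in nb (v k)).
  by apply/existsNP.
rewrite (bigD1 (Ordinal kn)) //= (trans_probE nb_uniq mem_nb) /step /cond -mem_nb.
by rewrite (negPf nk) !mul0r.
Qed.

End Existence.

Section Criterion.
Variables (R : realType) (V : choiceType) (G : graph V) (nb : V -> seq V).
Hypotheses (nb_uniq : forall x, uniq (nb x)).
Hypotheses (mem_nb : forall x y, (y \in nb x) = adj G x y).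
Hypothesis noiso : no_isolated nb.

(** Rayleigh monotonicity, finite modifications and all estimates below use
    recurrence in this form. *)
Lemma recurrentP (c : set V -> R) : positive G c ->
  recurrent G c <-> forall x, null_energy G nb c x.
Proof.
move=> c0; split=> H x.
  apply/(null_energyP nb_uniq mem_nb noiso) => //.
  apply/(return_aeP nb_uniq mem_nb noiso c0 (random_walk_exists nb_uniq mem_nb noiso x c0)).
  exact: H (random_walk_exists nb_uniq mem_nb noiso x c0).
move=> d Omega P X HX.
apply/(return_aeP nb_uniq mem_nb noiso c0 HX).
exact/(null_energyP nb_uniq mem_nb noiso).
Qed.

End Criterion.

(** * Graph distance and the breadth-first tree *)

Section Distance.
Variables (V : choiceType) (G : graph V).
Hypothesis Gconn : connected_graph G.

(** The minimum exists by well-foundedness, so the default value of the choice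
    is never taken on a nonempty set. *)
Lemma least_spec (A : set nat) n : A n ->
  A (least A) /\ forall m, A m -> (least A <= m)%N.
Proof.
move=> An; rewrite /least; apply: (@xgetPex _ 0%N
  [set n | A n /\ forall m, A m -> (n <= m)%N]).
have [m /asboolP Am mmin] := ex_minnP (ex_intro (fun n => `[< A n >]) n (asboolT An)).
by exists m; split=> // k Ak; apply: mmin; exact: asboolT.
Qed.

Lemma least_eq (A : set nat) n : A n -> (forall m, A m -> (n <= m)%N) -> least A = n.
Proof.
move=> An mn; have [lA lm] := least_spec An.
by apply/eqP; rewrite eqn_leq lm // mn.
Qed.

Let walks x y := [set n | exists p : seq V,
  [/\ path (adj G) x p, last x p = y & size p = n]].

Lemma dist_path x y : exists p : seq V,
  [/\ path (adj G) x p, last x p = y & size p = dist G x y].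
Proof.
have [p [px py]] := Gconn x y.
have w : walks x y (size p) by exists p.
by have [] := least_spec w.
Qed.

Lemma dist_le x y p : path (adj G) x p -> last x p = y -> (dist G x y <= size p)%N.
Proof.
move=> px py; have w : walks x y (size p) by exists p.
by have [_] := least_spec w; apply.
Qed.

Lemma dist_xx x : dist G x x = 0%N.
Proof. by apply/eqP; rewrite -leqn0 -[0%N]/(size (@nil V)); exact: dist_le. Qed.

Lemma dist_eq0 x y : (dist G x y == 0%N) = (x == y).
Proof.
apply/eqP/eqP => [d0|->]; last exact: dist_xx.
have [p [_ py sp]] := dist_path x y; move: sp py.
by rewrite d0 => /size0nil ->.
Qed.

Lemma path_revG x p : path (adj G) x p ->
  path (adj G) (last x p) (rev (belast x p)).
Proof.
by move=> px; rewrite rev_path; rewrite (eq_path (e' := adj G)) // => u v; rewrite adj_sym.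
Qed.

Lemma last_rev_belast (x : V) p : last (last x p) (rev (belast x p)) = x.
Proof. by case: p => //= y p; rewrite rev_cons last_rcons. Qed.

Lemma dist_tri y x z : (dist G x z <= dist G x y + dist G y z)%N.
Proof.
have [p [px py <-]] := dist_path x y; have [q [qy qz <-]] := dist_path y z.
rewrite -size_cat; apply: dist_le; first by rewrite cat_path px py.
by rewrite last_cat py.
Qed.

Lemma dist_adj x y : adj G x y -> (dist G x y <= 1)%N.
Proof.
by move=> xy; rewrite -[1%N]/(size [:: y]); apply: dist_le => //=; rewrite xy.
Qed.

Lemma dist_adj_le o x y : adj G x y -> (dist G x o <= (dist G y o).+1)%N.
Proof.
move=> xy; rewrite (leq_trans (dist_tri y x o)) // -add1n leq_add2r.
exact: dist_adj.
Qed.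

Lemma edge_height2 o x y :
  edge_height G o [set x; y] = minn (dist G x o) (dist G y o).
Proof.
apply: least_eq.
  have [h|h] := leqP (dist G x o) (dist G y o).
    by exists x; [left|].
  by exists y; [right|].
by move=> m [z [->|->] ->]; rewrite geq_min leqnn ?orbT.
Qed.

Lemma automorphism_dist f x y : graph_automorphism G f ->
  (dist G (f x) (f y) <= dist G x y)%N.
Proof.
move=> [_ fa]; have [p [px py <-]] := dist_path x y.
rewrite -(size_map f); apply: dist_le; last by rewrite last_map py.
rewrite path_map (eq_path (e' := adj G)) // => u v; exact: fa.
Qed.

Lemma automorphism_inv f : graph_automorphism G f ->
  exists g, graph_automorphism G g /\ cancel f g /\ cancel g f.
Proof.
move=> [[_ fi fs] fa].
have [g gK] : {g : V -> V & cancel g f}.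
  apply: (@cid _ (fun g => cancel g f)).
  have /choice[g gK] : forall y, exists x, f x = y.
    by move=> y; have [x _ <-] := fs y Logic.I; exists x.
  by exists g.
have fK : cancel f g by move=> x; apply: fi; rewrite ?inE ?gK.
exists g; split=> //; split.
  split=> //; first by move=> x y _ _ /(congr1 f); rewrite !gK.
  by move=> y _; exists (f y).
by move=> x y; rewrite -{2}(gK x) -{2}(gK y) fa.
Qed.

(** Every vertex is moved within distance D of o by an automorphism; D is the
    largest distance from o to a chosen representative of each orbit. *)
Lemma quasi_transitive_dist o : quasi_transitive G ->
  exists D, forall v, exists f, [/\ graph_automorphism G f, injective f,
    (dist G (f v) o <= D)%N & forall x y, dist G (f x) (f y) = dist G x y].
Proof.
move=> /finite_seqP[s Hs].
have [D HD] : exists D, forall O, O \in s -> forall x,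
    O = vertex_orbit G x -> exists f,
    graph_automorphism G f /\ (dist G (f x) o <= D)%N.
  have {Hs} : forall O, O \in s -> exists x, O = vertex_orbit G x.
    move=> O Os; have : [set` s] O by [].
    by rewrite -Hs => -[x _ <-]; exists x.
  elim: s => [|O s IH] Hs; first by exists 0%N.
  have [|D HD] := IH; first by move=> O' Os; apply: Hs; rewrite inE Os orbT.
  have [x0 e0] := Hs O (mem_head _ _).
  exists (maxn D (dist G x0 o)) => O'; rewrite inE => /orP[/eqP ->|Os] x e.
    have : vertex_orbit G x x0.
      rewrite -e e0; exists id => //; split=> //; split=> // y _; by exists y.
    move=> [f fa ->]; exists f; split=> //; exact: leq_maxr.
  have [f [fa fd]] := HD O' Os x e; exists f; split=> //.
  exact: leq_trans fd (leq_maxl _ _).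
exists D => v; have vs : vertex_orbit G v \in s.
  have : [set` s] (vertex_orbit G v) by rewrite -Hs; exists v.
  by [].
have [f [fa fd]] := HD _ vs v erefl; have [g [ga [fK gK]]] := automorphism_inv fa.
exists f; split=> //; first exact: can_inj fK.
move=> x y; apply/eqP; rewrite eqn_leq automorphism_dist //=.
by rewrite -{1}(fK x) -{1}(fK y) automorphism_dist.
Qed.

End Distance.

Section Tree.
Variables (V : choiceType) (G : graph V) (nb : V -> seq V) (o : V).
Hypothesis Gconn : connected_graph G.
Hypotheses (nb_uniq : forall x, uniq (nb x)).
Hypotheses (mem_nb : forall x y, (y \in nb x) = adj G x y).

Definition height x := dist G x o.

Lemma height_eq0 x : (height x == 0%N) = (x == o).
Proof. exact: dist_eq0. Qed.

Lemma height_o : height o = 0%N.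
Proof. exact: dist_xx. Qed.

(** Any neighbour one step closer to o will do, as the argument does not
    depend on the choice of the breadth-first tree. *)
Definition parent x := xget o [set y | adj G x y /\ (height y).+1 = height x].

Lemma parentP x : x != o -> adj G x (parent x) /\ (height (parent x)).+1 = height x.
Proof.
move=> xo; apply: (@xgetPex _ o [set y | adj G x y /\ (height y).+1 = height x]).
have [p [xp po sp]] := dist_path Gconn x o.
case: p => [|y p] in xp po sp *; first by move: xo; rewrite -po eqxx.
move: xp => /= /andP[xy yp]; exists y => /=; split=> //; apply/eqP.
rewrite eqn_leq (dist_adj_le Gconn) // andbT.
by rewrite /height -sp /= ltnS; exact: dist_le.
Qed.

Definition children x := [seq y <- nb x | (y != o) && (parent y == x)].

Lemma mem_children x y : (y \in children x) = (y != o) && (parent y == x).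
Proof.
rewrite mem_filter mem_nb; case: eqVneq => //= yo.
by case: eqVneq => //= <-; rewrite adj_sym; have [] := parentP yo.
Qed.

Lemma children_uniq x : uniq (children x).
Proof. exact: filter_uniq. Qed.

Lemma children_height x y : y \in children x -> height y = (height x).+1.
Proof. by rewrite mem_children => /andP[yo /eqP <-]; have [_ ->] := parentP yo. Qed.

Lemma uniq_flatten_map (T T' : eqType) (s : seq T) (F : T -> seq T') :
  uniq s -> (forall x, x \in s -> uniq (F x)) ->
  (forall x x' y, x \in s -> x' \in s -> y \in F x -> y \in F x' -> x = x') ->
  uniq (flatten [seq F x | x <- s]).
Proof.
elim: s => //= a s IH /andP[nas us] uF dF; rewrite cat_uniq uF ?mem_head //=.
rewrite IH // ?andbT; last 2 first.
- by move=> x xs; apply: uF; rewrite inE xs orbT.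
- by move=> x x' y xs xs'; apply: dF; rewrite inE ?xs ?xs' orbT.
apply/hasPn => y /flatten_mapP[x xs yx]; apply/negP => ya.
have := dF a x y (mem_head _ _) _ ya yx; rewrite inE xs orbT => /(_ erefl) ax.
by rewrite ax xs in nas.
Qed.

Fixpoint level n : seq V :=
  if n is m.+1 then flatten [seq children x | x <- level m] else [:: o].

Lemma mem_level n x : (x \in level n) = (height x == n).
Proof.
elim: n x => [|n IH] x /=; first by rewrite inE height_eq0.
apply/flatten_mapP/eqP => [[y yn xy]|hx].
  by rewrite (children_height xy); move: yn; rewrite IH => /eqP ->.
have xo : x != o by rewrite -height_eq0 hx.
have [_ hp] := parentP xo; exists (parent x); last by rewrite mem_children xo eqxx.
by rewrite IH -eqSS hp hx.
Qed.

Lemma level_uniq n : uniq (level n).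
Proof.
elim: n => //= n IH; apply: uniq_flatten_map => // [x _|x x' y _ _].
  exact: children_uniq.
by rewrite !mem_children => /andP[_ /eqP ->] /andP[_ /eqP].
Qed.

(** The enumeration starts at x and goes down, which makes the recursion on n
    match the one for cuts. *)
Fixpoint desc n x : seq V :=
  x :: (if n is m.+1 then flatten [seq desc m y | y <- children x] else [::]).

Lemma desc_anc n x y : y \in desc n x ->
  exists i, [/\ (i <= n)%N, iter i parent y = x & height y = (height x + i)%N].
Proof.
elim: n x y => [|n IH] x y /=.
  by rewrite inE => /eqP ->; exists 0%N; rewrite addn0.
rewrite inE => /orP[/eqP ->|/flatten_mapP[z zx yz]].
  by exists 0%N; rewrite addn0.
have [i [i_n e h]] := IH _ _ yz; exists i.+1; split=> //.
  by rewrite iterS e; move: zx; rewrite mem_children => /andP[_ /eqP].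
by rewrite h (children_height zx) addSnnS.
Qed.

Lemma desc_uniq n x : uniq (desc n x).
Proof.
elim: n x => // n IH x; rewrite /= uniq_flatten_map ?children_uniq //; last first.
  move=> y y' z yx yx' /desc_anc[i [_ ei hi]] /desc_anc[j [_ ej hj]].
  move: hj; rewrite hi (children_height yx) (children_height yx') => /addnI ij.
  by rewrite -ei ij.
rewrite andbT; apply/flatten_mapP => -[y yx /desc_anc[i [_ _ h]]].
by move: h; rewrite (children_height yx); lia.
Qed.

Lemma dist_desc n x y : y \in desc n x -> (dist G y x <= n)%N.
Proof.
elim: n x y => [|n IH] x y /=; first by rewrite inE => /eqP ->; rewrite dist_xx.
rewrite inE => /orP[/eqP ->|/flatten_mapP[z zx /IH yz]]; first by rewrite dist_xx.
have /dist_adj zx1 : adj G z x.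
  move: zx; rewrite mem_children => /andP[zo /eqP <-].
  by have [] := parentP zo.
by rewrite (leq_trans (dist_tri Gconn z y x)) // -addn1 leq_add // zx1.
Qed.

Lemma mem_descS n x y :
  y \in desc n.+1 x <-> y = x \/ exists2 z, z \in children x & y \in desc n z.
Proof.
rewrite /= inE; split.
  by move=> /orP[/eqP ->|/flatten_mapP[z zx yz]]; [left|right; exists z].
by move=> [->|[z zx yz]]; rewrite ?eqxx //; apply/orP; right; apply/flatten_mapP; exists z.
Qed.

Lemma desc_refl n x : x \in desc n x.
Proof. by case: n => *; rewrite /= mem_head. Qed.

Lemma desc_step n x y z : y \in desc n x -> z \in children y -> z \in desc n.+1 x.
Proof.
elim: n x => [|n IH] x.
  by rewrite inE => /eqP -> zx; apply/mem_descS; right; exists z => //; exact: desc_refl.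
move=> /mem_descS[->|[t tx yt]] zy; apply/mem_descS; right.
  by exists z => //; exact: desc_refl.
by exists t => //; exact: IH.
Qed.

Definition ball n := desc n o.

Lemma mem_ball n x : (x \in ball n) = (height x <= n)%N.
Proof.
apply/idP/idP; first exact: dist_desc.
elim: n x => [|n IH] x; first by rewrite leqn0 height_eq0 => /eqP ->; exact: desc_refl.
have [-> _|xo hx] := eqVneq x o; first exact: desc_refl.
have [_ hp] := parentP xo.
apply: (@desc_step n o (parent x)); first by apply: IH; rewrite -ltnS hp.
by rewrite mem_children xo eqxx.
Qed.

Lemma ball_uniq n : uniq (ball n).
Proof. exact: desc_uniq. Qed.

(** The only consequence of quasi-transitivity used for growth estimates. *)
Definition homogeneous D := forall v n (s : seq V), uniq s ->
  (forall y, y \in s -> (dist G y v <= n)%N) -> (size s <= size (ball (n + D)))%N.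

Lemma quasi_transitive_homogeneous : quasi_transitive G -> exists D, homogeneous D.
Proof.
move=> /(quasi_transitive_dist Gconn o)[D HD]; exists D => v n s us sn.
have [f [_ fi fd fiso]] := HD v.
rewrite -(size_map f); apply: uniq_leq_size; first by rewrite map_inj_uniq.
move=> _ /mapP[y ys ->]; rewrite mem_ball.
rewrite (leq_trans (dist_tri Gconn (f v) _ _)) // leq_add // fiso; exact: sn.
Qed.

End Tree.

(** * Cuts and flows on the breadth-first tree *)

Section Flows.
Variables (R : realType) (V : choiceType) (G : graph V) (nb : V -> seq V) (o : V).
Hypothesis Gconn : connected_graph G.
Hypotheses (nb_uniq : forall x, uniq (nb x)).
Hypotheses (mem_nb : forall x y, (y \in nb x) = adj G x y).

Local Notation height := (height G o).
Local Notation parent := (parent G o).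
Local Notation children := (children G nb o).
Local Notation level := (level G nb o).
Local Notation desc := (desc G nb o).
Local Notation ball := (ball G nb o).

Definition growth (l : R) :=
  exists K, 0 <= K /\ forall n, (size (ball n))%:R <= K * l ^+ n.

Section Capacity.
Variable l : R.
Hypothesis l1 : 1 <= l.

(** The least weight, for the weight l^-|v|, of a set of vertices that cuts x
    off from its descendants n generations below; equivalently the largest
    flow with capacities l^-|v|. *)
Fixpoint cap n x : R :=
  if n is m.+1 then Num.min (l ^- height x) (\sum_(y <- children x) cap m y)
  else l ^- height x.

Let l0 : 0 < l. Proof. exact: lt_le_trans l1. Qed.

Lemma cap_ge0 n x : 0 <= cap n x.
Proof.
have lX k : 0 <= l ^- k by rewrite invr_ge0 exprn_ge0 // ltW.
by elim: n x => [|n IH] x //=; rewrite le_min lX sumr_ge0.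
Qed.

Lemma cap_le n x : cap n x <= l ^- height x.
Proof. by case: n => //= n; rewrite ge_min lexx. Qed.

Lemma cap_le_sum n x : cap n.+1 x <= \sum_(y <- children x) cap n y.
Proof. by rewrite /= ge_min lexx orbT. Qed.

Let cnt n x : R := (size (desc n x))%:R.

Let cntS n x : cnt n.+1 x = 1 + \sum_(y <- children x) cnt n y.
Proof.
rewrite /cnt /= -nat1r; congr (_ + _).
by rewrite size_flatten /shape -map_comp sumnE big_map natr_sum.
Qed.

(** Follow the tree down to a minimal cut: the descendants above the cut lie
    within j generations, and beyond a cut vertex v the tree is contained in a
    ball around v, which the growth hypothesis bounds by a multiple of l^-|v|.
    The condition cap < l^-D forces all cut vertices to height greater than D,
    so that only balls of radius less than N are used. *)
Lemma desc_le_cap D (K : R) N : homogeneous G nb o D -> 0 <= K ->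
  (forall m, (m < N)%N -> (size (ball m))%:R <= K * l ^+ m) ->
  forall j i x, cap j x < l ^- D -> (height x + j + i = N)%N ->
  cnt (j + i) x <= cnt j x + K * l ^+ (N + D) * cap j x.
Proof.
move=> hom K0 HK.
have main j i x : l ^- height x < l ^- D -> (height x + j + i = N)%N ->
    cnt (j + i) x <= cnt j x + K * l ^+ (N + D) * l ^- height x.
  move=> hx hN; have Dh : (D < height x)%N.
    rewrite ltnNge; apply/negP => hD; move: hx; rewrite ltf_pV2 ?posrE ?exprn_gt0 //.
    by rewrite ltNge ler_weXn2l.
  apply: ler_wpDl; first exact: ler0n.
  apply: (@le_trans _ _ (size (ball (j + i + D)))%:R).
    rewrite ler_nat; apply: (hom x); first exact: desc_uniq.
    by move=> y; exact: dist_desc.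
  apply: (le_trans (HK _ _)); first lia.
  rewrite -mulrA ler_wpM2l //.
  have -> : (N + D = (j + i + D) + height x)%N by lia.
  by rewrite [X in _ <= X / _]exprD mulfK // gt_eqF // exprn_gt0.
elim=> [|j IH] i x; first by move=> /= hx hN; exact: main.
have [hc|hc] := leP (l ^- height x) (\sum_(y <- children x) cap j y).
  have -> : cap j.+1 x = l ^- height x by apply/min_idPl.
  exact: main.
have ec : cap j.+1 x = \sum_(y <- children x) cap j y by apply/min_idPr/ltW.
rewrite ec => hx hN; rewrite addSn !cntS -addrA lerD2l mulr_sumr -big_split /=.
rewrite big_seq [leRHS]big_seq; apply: ler_sum => y yx; apply: IH; last first.
  by rewrite (children_height Gconn mem_nb yx); lia.
apply: le_lt_trans hx; rewrite (bigD1_seq y) //=; last exact: children_uniq.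
by rewrite lerDl sumr_ge0 // => z _; exact: cap_ge0.
Qed.

(** A small cut can be iterated. In the induction on N the part above the cut
    costs a constant and the part beyond costs at most half of the bound to be
    proved. *)
Lemma cap_growth D j : homogeneous G nb o D -> cap j o <= l ^- D / 2 -> growth l.
Proof.
move=> hom hc; pose K : R := 2 * (size (ball j))%:R.
have K0 : 0 <= K by rewrite mulr_ge0 ?ler0n.
have lX n : 1 <= l ^+ n by exact: exprn_ege1.
exists K; split=> //; elim/ltn_ind => N IH.
have [Nj|jN] := leqP N j.
  apply: (@le_trans _ _ K); last by rewrite ler_peMr.
  rewrite /K; apply: (@le_trans _ _ (size (ball j))%:R).
    rewrite ler_nat; apply: uniq_leq_size; first exact: ball_uniq.
    by move=> x; rewrite !mem_ball // => /leq_trans; exact.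
  by rewrite ler_peMl ?ler0n // ler1n.
have [i iN] : exists i, (j + i = N)%N by exists (N - j)%N; rewrite subnKC // ltnW.
have lD : 0 < l ^- D by rewrite invr_gt0 exprn_gt0.
have := @desc_le_cap D K N hom K0 IH j i o.
rewrite height_o // add0n iN => /(_ _ erefl) H.
apply: (le_trans (H _)); first by apply: (le_lt_trans hc); lra.
have -> : cnt j o = K / 2 by rewrite /cnt /K -/(ball j); field.
have : K * l ^+ (N + D) * cap j o <= K * l ^+ N / 2.
  apply: (@le_trans _ _ (K * l ^+ (N + D) * (l ^- D / 2))).
    by rewrite ler_wpM2l // mulr_ge0 // exprn_ge0 // ltW.
  have lD0 : l ^+ D != 0 by rewrite gt_eqF // exprn_gt0.
  rewrite exprD; rewrite le_eqVlt; apply/orP; left; apply/eqP; field; exact: lD0.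
have : K <= K * l ^+ N by rewrite ler_peMr.
lra.
Qed.

Variable n : nat.

(** A vertex passes its flow on to its children in proportion to the
    capacities of their subtrees, so that the constraint flow <= cap is
    inherited. *)
Fixpoint flow_at k x : R :=
  if k is m.+1 then flow_at m (parent x) * cap (n - k) x /
    \sum_(y <- children (parent x)) cap (n - k) y
  else cap n o.

Definition flow x := flow_at (height x) x.

Lemma flow_ge0 x : 0 <= flow x.
Proof.
rewrite /flow; move: (height x) => k; elim: k x => [|k IH] y /=; first exact: cap_ge0.
rewrite divr_ge0 ?mulr_ge0 ?cap_ge0 // sumr_ge0 // => z _; exact: cap_ge0.
Qed.

Lemma flow_child x y : y \in children x ->
  flow y = flow x * cap (n - (height x).+1) y /
    \sum_(y <- children x) cap (n - (height x).+1) y.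
Proof.
move=> yx; rewrite /flow (children_height Gconn mem_nb yx) /=.
by move: yx; rewrite mem_children // => /andP[_ /eqP ->].
Qed.

Lemma flow_o : flow o = cap n o.
Proof. by rewrite /flow height_o. Qed.

Lemma flow_cap x : (height x <= n)%N -> flow x <= cap (n - height x) x.
Proof.
move: {2}(height x) (erefl (height x)) => k; elim: k x => [|k IH] x hx hn.
  by rewrite hx subn0; move/eqP: hx; rewrite height_eq0 // => /eqP ->; rewrite flow_o.
have xo : x != o by rewrite -(height_eq0 o Gconn) hx.
have [_ hp] := parentP Gconn xo.
have xp : x \in children (parent x) by rewrite mem_children // xo eqxx.
have hpk : height (parent x) = k by apply/eqP; rewrite -eqSS hp hx.
rewrite (flow_child xp) hp; set S := \sum_(y <- _) _.
have S0 : 0 <= S by rewrite sumr_ge0 // => z _; exact: cap_ge0.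
move: S0; rewrite le_eqVlt => /orP[/eqP <-|S0].
  by rewrite invr0 mulr0 cap_ge0.
rewrite ler_pdivrMr // mulrC ler_wpM2l ?cap_ge0 //.
have kn : (height (parent x) <= n)%N by lia.
apply: (le_trans (IH _ hpk kn)); rewrite hpk.
have -> : (n - k = (n - height x).+1)%N by lia.
exact: cap_le_sum.
Qed.

Lemma flow_le x : (height x <= n)%N -> flow x <= l ^- height x.
Proof. by move=> hx; apply: le_trans (cap_le _ _); exact: flow_cap. Qed.

(** If the children have no capacity at all, the division by zero gives them
    flow 0; this is right because then the capacity, hence the flow, of their
    parent also vanishes. *)
Lemma flow_conserved x : (height x < n)%N -> \sum_(y <- children x) flow y = flow x.
Proof.
move=> hx; set S := \sum_(y <- children x) cap (n - (height x).+1) y.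
have -> : \sum_(y <- children x) flow y = \sum_(y <- children x)
    flow x * (cap (n - (height x).+1) y / S).
  rewrite big_seq [RHS]big_seq; apply: eq_bigr => y yx.
  by rewrite (flow_child yx) mulrA.
rewrite -mulr_sumr -mulr_suml -/S.
have [S0|S0] := eqVneq S 0; last by rewrite divff // mulr1.
suff -> : flow x = 0 by rewrite mul0r.
apply/eqP; rewrite eq_le flow_ge0 andbT -S0.
apply: (le_trans (flow_cap (ltnW hx))).
by rewrite -(subnSK hx); exact: cap_le_sum.
Qed.

Lemma flow_level k : (k <= n)%N -> \sum_(x <- level k) flow x = cap n o.
Proof.
elim: k => [|k IH] kn /=; first by rewrite big_seq1 flow_o.
rewrite big_flatten big_map -(IH (ltnW kn)) /= big_seq [RHS]big_seq.
apply: eq_bigr => x; rewrite mem_level // => /eqP hx.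
by rewrite flow_conserved // hx.
Qed.

End Capacity.

(** The ancestor of x at height k. *)
Definition anc k x := iter (height x - k) parent x.

Lemma height_iter i x : (i <= height x)%N -> height (iter i parent x) = (height x - i)%N.
Proof.
elim: i => [|i IH] hi; first by rewrite subn0.
have e := IH (ltnW hi).
have xo : iter i parent x != o by rewrite -(height_eq0 o Gconn) e; lia.
by have [_] := parentP Gconn xo; rewrite e /=; lia.
Qed.

Lemma height_anc k x : (k <= height x)%N -> height (anc k x) = k.
Proof. by move=> kx; rewrite height_iter ?leq_subr // subKn. Qed.

Lemma anc_height x : anc (height x) x = x.
Proof. by rewrite /anc subnn. Qed.

Lemma anc_parent k x : (k < height x)%N -> parent (anc k.+1 x) = anc k x.
Proof. by move=> kx; rewrite /anc -iterS subnSK. Qed.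

Lemma anc_child k x y : y \in children x -> (k <= height x)%N -> anc k y = anc k x.
Proof.
move=> yx kx; rewrite /anc (children_height Gconn mem_nb yx) subSn // iterSr.
by move: yx; rewrite mem_children // => /andP[_ /eqP ->].
Qed.

Lemma anc_anc i k x : (i <= k)%N -> (k <= height x)%N -> anc i (anc k x) = anc i x.
Proof.
move=> ik kx; rewrite {1}/anc height_anc // /anc -iterD; congr iter; lia.
Qed.

Lemma anc0 x : anc 0 x = o.
Proof. by apply/eqP; rewrite -(height_eq0 o Gconn) height_anc. Qed.

Lemma sum_pred_eq (s : seq V) a (F : V -> R) : uniq s -> a \in s ->
  \sum_(v <- s | a == v) F v = F a.
Proof.
move=> us as_; rewrite -big_filter.
have -> : [seq v <- s | a == v] = [:: a].
  apply: perm_small_eq => //; apply: uniq_perm => //; first exact: filter_uniq.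
  by move=> z; rewrite mem_filter inE eq_sym; case: eqVneq => // ->.
by rewrite big_seq1.
Qed.

(** The part of a mass w on generation n that passes through v. *)
Definition through n (w : V -> R) v :=
  \sum_(u <- level n | anc (height v) u == v) w u.

(** All sums over pairs of branches below are reorganized by the vertex at
    which both pass. *)
Lemma sum_by_anc n k (w F : V -> R) : (k <= n)%N ->
  \sum_(u <- level n) w u * F (anc k u) = \sum_(v <- level k) F v * through n w v.
Proof.
move=> kn.
transitivity (\sum_(v <- level k) \sum_(u <- level n | anc k u == v) w u * F v).
  rewrite (exchange_big_dep xpredT) //=.
  rewrite big_seq [RHS]big_seq; apply: eq_bigr => u; rewrite mem_level // => /eqP hu.
  rewrite (sum_pred_eq (fun v => w u * F v)) ?level_uniq // mem_level //.
  by rewrite height_anc ?hu.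
rewrite big_seq [RHS]big_seq; apply: eq_bigr => v; rewrite mem_level // => /eqP hv.
by rewrite /through hv mulr_sumr; apply: eq_bigr => u _; rewrite mulrC.
Qed.

Lemma through_flow l n m v : 1 <= l -> (height v <= m)%N -> (m <= n)%N ->
  through m (flow l n) v = flow l n v.
Proof.
move=> l1; elim: m => [|m IH] hv mn.
  have vo : v = o by apply/eqP; rewrite -(height_eq0 o Gconn) -leqn0.
  by rewrite vo /through /= big_cons big_nil height_o // anc0 eqxx addr0.
move: hv; rewrite leq_eqVlt => /orP[/eqP hv|hv].
  rewrite /through -[RHS](@sum_pred_eq (level m.+1) v (flow l n)) ?level_uniq //; last first.
    by rewrite mem_level // hv.
  rewrite big_seq_cond [RHS]big_seq_cond; apply: eq_bigl => u.
  rewrite mem_level //; case: (eqVneq (height u) m.+1) => //= hu.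
  by rewrite hv -hu anc_height eq_sym.
rewrite -(IH hv (ltnW mn)) /through /= big_flatten big_map big_mkcond [RHS]big_mkcond /=.
rewrite big_seq [RHS]big_seq; apply: eq_bigr => x; rewrite mem_level // => /eqP hx.
transitivity (\sum_(y <- children x) if anc (height v) x == v then flow l n y else 0).
  rewrite big_mkcond /= big_seq [RHS]big_seq; apply: eq_bigr => y yx.
  by rewrite (anc_child yx) // hx.
case: ifP => _; last by rewrite big1.
by rewrite flow_conserved // hx.
Qed.

(** The resistance r only has to dominate 1 / c where the flow a does not
    vanish. *)
Lemma Cauchy_Schwarz_weighted (I : Type) (s : seq I) (a b r c : I -> R) :
  (forall i, 0 <= r i) -> (forall i, 0 <= c i) ->
  (forall i, a i != 0 -> 1 <= r i * c i) ->
  (\sum_(i <- s) a i * b i) ^+ 2 <=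
  (\sum_(i <- s) r i * a i ^+ 2) * (\sum_(i <- s) c i * b i ^+ 2).
Proof.
move=> r0 c0 rc; set S := \sum_(i <- s) a i * b i.
set A := \sum_(i <- s) r i * _; set B := \sum_(i <- s) c i * _.
have B0 : 0 <= B by rewrite sumr_ge0 // => i _; rewrite mulr_ge0 ?sqr_ge0.
have A0 : 0 <= A by rewrite sumr_ge0 // => i _; rewrite mulr_ge0 ?sqr_ge0.
have H t : 2 * t * S <= t ^+ 2 * A + B.
  rewrite /S /A /B !mulr_sumr -big_split /=; apply: ler_sum => i _.
  have [->|ai] := eqVneq (a i) 0.
    by rewrite mul0r !mulr0 expr0n /= !mulr0 add0r mulr_ge0 ?sqr_ge0.
  have ri : 0 < r i.
    rewrite lt_neqAle r0 andbT; apply/eqP => ri.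
    by have := rc i ai; rewrite -ri mul0r ler10.
  rewrite -subr_ge0 -(pmulr_rge0 _ ri).
  have -> : r i * (t ^+ 2 * (r i * a i ^+ 2) + c i * b i ^+ 2 - 2 * t * (a i * b i)) =
    (t * r i * a i - b i) ^+ 2 + (r i * c i - 1) * b i ^+ 2 by ring.
  by rewrite addr_ge0 ?sqr_ge0 // mulr_ge0 ?sqr_ge0 // subr_ge0 rc.
move: A0; rewrite le_eqVlt => /orP[/eqP A0|A0].
  have [->|S0] := eqVneq S 0; first by rewrite expr0n /= -A0 mul0r.
  (* If A = 0, large t contradict 2 t S <= B unless S = 0. *)
  have := H ((B + 1) / S); rewrite -A0 mulr0 add0r -!mulrA mulVf // mulr1; lra.
have := H (S / A).
have -> : 2 * (S / A) * S = 2 * (S ^+ 2 / A) by field; rewrite gt_eqF.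
have -> : (S / A) ^+ 2 * A = S ^+ 2 / A by field; rewrite gt_eqF.
move=> K; have {}K : S ^+ 2 / A <= B by lra.
by rewrite mulrC -ler_pdivrMr.
Qed.

Definition tree_vertices n := flatten [seq level k.+1 | k <- iota 0 n].

Lemma mem_tree_vertices n v : (v \in tree_vertices n) = (0 < height v <= n)%N.
Proof.
apply/flatten_mapP/andP => [[k]|[h0 hn]].
  by rewrite mem_iota mem_level // => /andP[_ kn] /eqP ->.
by exists (height v).-1; rewrite ?mem_iota ?mem_level ?prednK //; lia.
Qed.

Lemma tree_vertices_uniq n : uniq (tree_vertices n).
Proof.
apply: uniq_flatten_map; first exact: iota_uniq.
  by move=> k _; exact: level_uniq.
by move=> k k' y _ _; rewrite !mem_level // => /eqP -> /eqP[].
Qed.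

(** A potential drop of 1 along all branches, weighted by the flow, equals the
    strength of the flow; Cauchy-Schwarz separates the energy of the flow from
    that of f. This is the easy half of Thomson's principle. *)
Lemma flow_energy (c : set V -> R) s f n w (r : V -> R) : positive G c ->
  covers nb s f -> f o = 1 -> (forall u, u \in level n -> f u = 0) ->
  (forall v, 0 <= r v) ->
  (forall v, v \in tree_vertices n -> through n w v != 0 ->
     1 <= r v * c [set v; parent v]) ->
  (\sum_(u <- level n) w u) ^+ 2 <=
  (\sum_(v <- tree_vertices n) r v * through n w v ^+ 2) * energy G c s f.
Proof.
move=> c0 [us cov] fo fn r0 rc.
pose b v := f (parent v) - f v.
pose cc v := if v \in tree_vertices n then cond G c v (parent v) else 0.
pose a v := if v \in tree_vertices n then through n w v else 0.
have -> : \sum_(u <- level n) w u = \sum_(v <- tree_vertices n) a v * b v.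
  transitivity (\sum_(v <- tree_vertices n) b v * through n w v); last first.
    rewrite big_seq [RHS]big_seq; apply: eq_bigr => v vt.
    by rewrite /a vt mulrC.
  rewrite big_flatten big_map.
  transitivity (\sum_(k <- iota 0 n) \sum_(u <- level n) w u * b (anc k.+1 u)).
    rewrite exchange_big /= big_seq [RHS]big_seq; apply: eq_bigr => u ul.
    have hu : height u = n by apply/eqP; move: ul; rewrite mem_level.
    have := @telescope_sumr _ 0 n (fun k => - f (anc k u)) (leq0n n).
    rewrite anc0 fo -[X in anc X u]hu anc_height fn // oppr0 sub0r opprK => T.
    rewrite -mulr_sumr -[LHS]mulr1 -T /index_iota subn0; congr (_ * _).
    rewrite big_seq [RHS]big_seq; apply: eq_bigr => k.
    rewrite mem_iota /= add0n => kn; rewrite /b anc_parent ?hu //; ring.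
  rewrite big_seq [RHS]big_seq; apply: eq_bigr => k.
  rewrite mem_iota /= add0n => kn; exact: sum_by_anc.
have cc0 v : 0 <= cc v by rewrite /cc; case: ifP => // _; exact: cond_ge0.
apply: le_trans (Cauchy_Schwarz_weighted (tree_vertices n) b r0 cc0 _) _.
  move=> v; rewrite /a /cc; case: ifP => [vt tv|_]; last by rewrite eqxx.
  have vo : v != o by rewrite -(height_eq0 o Gconn); move: vt; rewrite mem_tree_vertices; lia.
  have [vp _] := parentP Gconn vo.
  by rewrite /cond vp rc.
have -> : \sum_(v <- tree_vertices n) r v * a v ^+ 2 =
    \sum_(v <- tree_vertices n) r v * through n w v ^+ 2.
  by rewrite big_seq [RHS]big_seq; apply: eq_bigr => v vt; rewrite /a vt.
apply: ler_wpM2l.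
  by rewrite sumr_ge0 // => v _; rewrite mulr_ge0 ?sqr_ge0.
pose T v := if v \in tree_vertices n then cond G c v (parent v) * b v ^+ 2 else 0.
have T0 v : 0 <= T v.
  by rewrite /T; case: ifP => // _; rewrite mulr_ge0 ?sqr_ge0 ?cond_ge0.
have supp v : v \in tree_vertices n -> T v != 0 -> v \in s /\ parent v \in s.
  move=> vt; rewrite /T vt /b => Tv.
  have vo : v != o by rewrite -(height_eq0 o Gconn); move: vt; rewrite mem_tree_vertices; lia.
  have [vp _] := parentP Gconn vo.
  have [fv|/cov[vs nbs]] := eqVneq (f v) 0; last first.
    by split=> //; apply: nbs; rewrite mem_nb.
  have [fp|/cov[vs nbs]] := eqVneq (f (parent v)) 0.
    by rewrite fv fp subrr expr0n /= mulr0 eqxx in Tv.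
  by split=> //; apply: nbs; rewrite mem_nb adj_sym.
apply: (@le_trans _ _ (\sum_(v <- s) T v)).
  have -> : \sum_(i <- tree_vertices n) cc i * b i ^+ 2 = \sum_(v <- tree_vertices n) T v.
    by apply: eq_bigr => v _; rewrite /cc /T; case: ifP => // _; rewrite mul0r.
  apply: ler_sum_subset => //; first exact: tree_vertices_uniq.
  by move=> v vt Tv; have [] := supp v vt Tv.
rewrite /energy; apply: ler_sum => v _.
have E0 y : 0 <= cond G c v y * (f v - f y) ^+ 2.
  by rewrite mulr_ge0 ?sqr_ge0 ?cond_ge0.
have [Tv|Tv] := eqVneq (T v) 0; first by rewrite Tv sumr_ge0.
have vt : v \in tree_vertices n by apply: contraNT Tv => vt; rewrite /T (negPf vt).
have [vs ps] := supp v vt Tv.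
rewrite (bigD1_seq (parent v)) //= ler_wpDr ?sumr_ge0 //.
by rewrite /T vt /b -sqrrN opprB.
Qed.

End Flows.

(** * Energy bounds from cuts and paths *)

Section Estimates.
Variables (R : realType).

Lemma geometric_sum_le (r : R) m : 0 <= r < 1 ->
  \sum_(k <- iota 0 m) r ^+ k <= (1 - r)^-1.
Proof.
move=> /andP[r0 r1]; have d0 : 0 < 1 - r by rewrite subr_gt0.
have -> : \sum_(k <- iota 0 m) r ^+ k = (1 - r ^+ m) / (1 - r).
  elim: m => [|m IH]; first by rewrite big_nil expr0 subrr mul0r.
  rewrite -addn1 iotaD big_cat /= big_seq1 IH add0n addn1 exprS; field.
  by rewrite gt_eqF.
by rewrite ler_pdivrMr // mulVf ?gt_eqF // gerBl exprn_ge0.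
Qed.

Lemma expr_small (r e : R) : 0 <= r < 1 -> 0 < e -> exists n, r ^+ n <= e.
Proof.
move=> /andP[r0 r1] e0.
have : (r ^+ n) @[n --> \oo] --> (0 : R) by apply: cvg_expr; rewrite ger0_norm.
move=> /cvgrPdist_le/(_ _ e0)[N _ /(_ N (leqnn N)) /=].
by rewrite sub0r normrN ger0_norm ?exprn_ge0 // => ?; exists N.
Qed.

End Estimates.

Section Criteria.
Variables (R : realType) (V : choiceType) (G : graph V) (nb : V -> seq V) (o : V).
Hypothesis Gconn : connected_graph G.
Hypotheses (nb_uniq : forall x, uniq (nb x)).
Hypotheses (mem_nb : forall x y, (y \in nb x) = adj G x y).

Local Notation height := (height G o).
Local Notation parent := (parent G o).
Local Notation level := (level G nb o).
Local Notation ball := (ball G nb o).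
Local Notation anc := (anc G o).
Local Notation tree_vertices := (tree_vertices G nb o).
Local Notation through := (through G nb o).
Local Notation growth := (growth G nb o).

(** Summation over the levels at height n and above is dominated by a
    geometric series of ratio l'/l. *)
Lemma growth_tail (l l' : R) : growth l' -> 0 < l -> 0 <= l' < l ->
  exists C r, [/\ 0 <= C, 0 <= r < 1 & forall n (s : seq V), uniq s ->
    (forall v, v \in s -> (n <= height v)%N) ->
    \sum_(v <- s) l ^- height v <= C * r ^+ n].
Proof.
move=> [K [K0 HK]] l0 /andP[l'0 l'l]; pose r := l' / l.
have r01 : 0 <= r < 1 by rewrite divr_ge0 ?(ltW l0) //= ltr_pdivrMr // mul1r.
have /andP[r0 r1] := r01.
exists (K / (1 - r)), r; split=> //; first by rewrite divr_ge0 // subr_ge0 ltW.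
move=> n s us hs; pose m := (\max_(v <- s) height v).+1.
have hm v : v \in s -> (height v < m)%N.
  by move=> vs; rewrite ltnS /m (big_rem v) //= leq_maxl.
apply: (@le_trans _ _ (\sum_(v <- flatten [seq level (n + k) | k <- iota 0 m])
    l ^- height v)).
  apply: ler_sum_subset => //; last by move=> v; rewrite invr_ge0 exprn_ge0 // ltW.
  move=> v vs _; apply/flatten_mapP; exists (height v - n)%N.
    by rewrite mem_iota /= add0n (leq_ltn_trans (leq_subr _ _)) ?hm.
  by rewrite subnKC ?hs // mem_level.
rewrite big_flatten big_map.
apply: (@le_trans _ _ (\sum_(k <- iota 0 m) K * r ^+ n * r ^+ k)).
  apply: ler_sum => k _.
  have -> : \sum_(v <- level (n + k)) l ^- height v =
      (size (level (n + k)))%:R * l ^- (n + k).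
    rewrite -sum1_size natr_sum mulr_suml big_seq [RHS]big_seq.
    by apply: eq_bigr => v; rewrite mem_level // mul1r => /eqP ->.
  rewrite -mulrA -exprD /r expr_div_n mulrA ler_wpM2r ?invr_ge0 ?exprn_ge0 //.
    exact: ltW.
  apply: le_trans (HK _); rewrite ler_nat; apply: uniq_leq_size.
    exact: level_uniq.
  by move=> v; rewrite mem_level // mem_ball // => /eqP ->.
rewrite -mulr_sumr -!mulrA [X in _ <= K * X]mulrC ler_wpM2l // ler_wpM2l ?exprn_ge0 //.
exact: geometric_sum_le.
Qed.

(** The indicator of A is a test function whose energy is the conductance of
    the boundary of A. A boundary edge has an endpoint outside A, of height
    greater than n, and bounded degrees reduce the sum to a tail of the sum of
    l^-|v|. *)
Lemma null_energy_cut (c : set V -> R) (l l' : R) D x : positive G c ->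
  homogeneous G nb o D -> growth l' -> 1 < l -> 0 <= l' < l ->
  (forall n, exists A : seq V, {subset ball n <= A} /\
     forall u v, u \in A -> v \notin A -> adj G u v ->
       c [set u; v] <= l ^- edge_height G o [set u; v]) ->
  null_energy G nb c x.
Proof.
move=> c0 hom gl l1 ll HA eps eps0.
have l0 : 0 < l by exact: lt_trans l1.
have [C [r [C0 r01 tail]]] := growth_tail gl l0 ll.
pose dg : R := (size (ball (1 + D)))%:R.
have dg0 : 0 <= dg by rewrite ler0n.
pose M := 2 * dg * l * C + 1.
have M0 : 0 < M by rewrite ltr_wpDl // !mulr_ge0 // ltW.
have [n0 Hn0] := expr_small r01 (divr_gt0 eps0 M0).
pose n := (n0 + height x)%N; have [A [bA cA]] := HA n.
pose f v : R := (v \in A)%:R.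
pose s := undup (A ++ flatten [seq nb y | y <- A]).
exists s, f; split.
- split; first exact: undup_uniq.
  move=> v; rewrite /f; case: (boolP (v \in A)); last by rewrite eqxx.
  move=> vA _; split=> [|y yv]; rewrite mem_undup mem_cat ?vA //.
  by apply/orP; right; apply/flatten_mapP; exists v.
- by rewrite /f bA // mem_ball // leq_addl.
pose B v := \sum_(u <- s | u \in A) cond G c v u.
have EE : energy G c s f = 2 * \sum_(v <- s | v \notin A) B v.
  have -> : energy G c s f = \sum_(v <- s) ((v \notin A)%:R * B v +
      (v \in A)%:R * \sum_(u <- s | u \notin A) cond G c v u).
    apply: eq_bigr => v _; rewrite /f /B; case: (v \in A) => /=.
      rewrite mul0r add0r mul1r [RHS]big_mkcond /=; apply: eq_bigr => u _.
      by case: (u \in A); rewrite /= ?subrr ?subr0 ?expr0n ?expr1n /= ?mulr0 ?mulr1.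
    rewrite mul0r addr0 mul1r [RHS]big_mkcond /=; apply: eq_bigr => u _.
    by case: (u \in A); rewrite /= ?subrr ?sub0r ?sqrrN ?expr0n ?expr1n /= ?mulr0 ?mulr1.
  rewrite big_split /= mulr2n mulrDl mul1r; congr (_ + _).
    rewrite [RHS]big_mkcond; apply: eq_bigr => v _.
    by case: (v \in A); rewrite /= ?mul0r ?mul1r.
  rewrite /B [RHS](exchange_big_dep (mem A)) //= [RHS]big_mkcond /=.
  apply: eq_bigr => v _; case: (v \in A); rewrite /= ?mul0r // mul1r.
  by apply: eq_big => u; rewrite ?andbT // cond_sym.
have HB v : v \notin A -> B v <= dg * l * l ^- height v.
  move=> vA.
  have -> : B v = \sum_(u <- s | (u \in A) && adj G v u) cond G c v u.
    rewrite /B [LHS]big_mkcond [RHS]big_mkcond; apply: eq_bigr => u _ /=.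
    by rewrite /cond; case: (u \in A); case: (adj G v u).
  apply: (@le_trans _ _ (\sum_(u <- s | (u \in A) && adj G v u) l * l ^- height v)).
    apply: ler_sum => u /andP[uA vu]; rewrite /cond vu setUC.
    apply: (le_trans (cA u v uA vA _)); first by rewrite adj_sym.
    rewrite edge_height2 // -/(height u) -/(height v) -[X in X * _]invrK -invfM.
    rewrite lef_pV2 ?posrE ?mulr_gt0 ?invr_gt0 ?exprn_gt0 // ler_pdivrMl //.
    rewrite -exprS ler_weXn2l ?(ltW l1) // -ltnS.
    have : (height v <= (height u).+1)%N by exact: dist_adj_le.
    by move: (height u) (height v) => a b; clear; lia.
  rewrite big_const_seq iter_addr_0 -[X in X <= _]mulr_natl -mulrA ler_wpM2r //.
    by rewrite mulr_ge0 ?invr_ge0 ?exprn_ge0 // ltW.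
  rewrite /dg ler_nat -size_filter; apply: (hom v).
    by rewrite filter_uniq // undup_uniq.
  move=> y; rewrite mem_filter => /andP[/andP[_ vy] _].
  by apply: dist_adj; rewrite adj_sym.
rewrite EE.
apply: (@le_trans _ _ (2 * \sum_(v <- s | v \notin A) dg * l * l ^- height v)).
  by rewrite ler_wpM2l ?ler0n //; apply: ler_sum.
rewrite -mulr_sumr -big_filter.
apply: (@le_trans _ _ (2 * (dg * l * (C * r ^+ n)))).
  rewrite ler_wpM2l ?ler0n // ler_wpM2l ?mulr_ge0 ?(ltW l0) //.
  apply: tail; first by rewrite filter_uniq // undup_uniq.
  move=> v; rewrite mem_filter => /andP[vA _]; apply: ltnW.
  by rewrite ltnNge -(mem_ball o Gconn mem_nb); apply: contra vA => /bA.
have [/andP[r0 r1]] := r01.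
have rn : r ^+ n <= eps / M.
  by apply: le_trans Hn0; rewrite /n exprD ler_piMr ?exprn_ge0 // exprn_ile1 // ltW.
have -> : 2 * (dg * l * (C * r ^+ n)) = (M - 1) * r ^+ n by rewrite /M; ring.
apply: (@le_trans _ _ (M * (eps / M))); last by rewrite mulrC divfK // gt_eqF.
apply: ler_pM => //; [|exact: exprn_ge0|by rewrite gerBl].
by rewrite /M addrK !mulr_ge0 // ltW.
Qed.

(** The case of a flow along a single path of a graph that need not be a tree. *)
Lemma path_energy (c : set V -> R) s f x p (r : V -> R) : positive G c ->
  covers nb s f -> f x = 1 -> f (last x p) = 0 -> path (adj G) x p -> uniq p ->
  (forall v, 0 <= r v) ->
  (forall i, (i < size p)%N ->
     1 <= r (nth x p i) * c [set nth x (x :: p) i; nth x p i]) ->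
  1 <= (\sum_(v <- p) r v) * energy G c s f.
Proof.
move=> c0 [us cov] fx fl xp up r0 rc.
pose prev v := nth x (x :: p) (index v p).
have prevE i : (i < size p)%N -> prev (nth x p i) = nth x (x :: p) i.
  by move=> ip; rewrite /prev index_uniq.
have prev_adj v : v \in p -> adj G (prev v) v.
  move=> vp; have ip : (index v p < size p)%N by rewrite index_mem.
  by have /(pathP x)/(_ _ ip) := xp; rewrite nth_index.
pose b v := f (prev v) - f v.
have tele : \sum_(v <- p) 1 * b v = 1.
  rewrite (big_nth x) /=.
  have := @telescope_sumr _ 0 (size p) (fun i => - f (nth x (x :: p) i)) (leq0n _).
  rewrite /= fx -[X in nth x (x :: p) X]/(size (x :: p)).-1 nth_last /= fl.
  rewrite oppr0 sub0r opprK => T; rewrite -[RHS]T.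
  rewrite big_nat [RHS]big_nat; apply: eq_bigr => i /= ip.
  by rewrite mul1r /b prevE //=; ring.
pose cc v := if v \in p then cond G c (prev v) v else 0.
have cc0 v : 0 <= cc v by rewrite /cc; case: ifP => // _; exact: cond_ge0.
pose a v : R := (v \in p)%:R.
have H := @Cauchy_Schwarz_weighted _ _ p a b r cc r0 cc0.
have : (\sum_(v <- p) a v * b v) ^+ 2 <=
    (\sum_(v <- p) r v * a v ^+ 2) * (\sum_(v <- p) cc v * b v ^+ 2).
  apply: H => v; rewrite /a /cc; case: ifP => [vp _|]; last by rewrite eqxx.
  have ip : (index v p < size p)%N by rewrite index_mem.
  have := rc _ ip; rewrite nth_index // /cond.
  by rewrite -/(prev v) prev_adj.
have -> : \sum_(v <- p) a v * b v = 1.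
  by rewrite -tele big_seq [RHS]big_seq; apply: eq_bigr => v vp; rewrite /a vp.
have -> : \sum_(v <- p) r v * a v ^+ 2 = \sum_(v <- p) r v.
  by rewrite big_seq [RHS]big_seq; apply: eq_bigr => v vp; rewrite /a vp expr1n mulr1.
rewrite expr1n => /le_trans; apply.
apply: ler_wpM2l; first by rewrite sumr_ge0.
pose T v := cc v * b v ^+ 2.
have T0 v : 0 <= T v by rewrite mulr_ge0 ?sqr_ge0.
have supp v : T v != 0 -> v \in s /\ prev v \in s.
  rewrite /T /cc; case: ifP => [vp|]; last by rewrite mul0r eqxx.
  have va := prev_adj v vp; rewrite /b => Tv.
  have [fv|/cov[vs nbs]] := eqVneq (f v) 0; last first.
    by split=> //; apply: nbs; rewrite mem_nb adj_sym.
  have [fp|/cov[vs nbs]] := eqVneq (f (prev v)) 0.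
    by rewrite fv fp subrr expr0n /= mulr0 eqxx in Tv.
  by split=> //; apply: nbs; rewrite mem_nb.
apply: (@le_trans _ _ (\sum_(v <- s) T v)).
  by apply: ler_sum_subset => // v _ Tv; have [] := supp v Tv.
rewrite /energy; apply: ler_sum => v _.
have E0 y : 0 <= cond G c v y * (f v - f y) ^+ 2.
  by rewrite mulr_ge0 ?sqr_ge0 ?cond_ge0.
have [Tv|Tv] := eqVneq (T v) 0; first by rewrite Tv sumr_ge0.
have [vs ps] := supp v Tv.
rewrite (bigD1_seq (prev v)) //= ler_wpDr ?sumr_ge0 //.
have vp : v \in p by apply: contraNT Tv => vt; rewrite /T /cc (negPf vt) mul0r.
by rewrite /T /cc vp /b -sqrrN opprB cond_sym.
Qed.

(** A finitely supported f vanishes somewhere on an infinite cluster, and the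
    path leading there has resistance at most C. *)
Lemma infinite_cluster_energy (c : set V -> R) (e : rel V) x (r : V -> R) C :
  positive G c -> subrel e (adj G) ->
  infinite_set [set y | exists p, path e x p /\ last x p = y] ->
  (forall v, 0 <= r v) -> (forall s, uniq s -> \sum_(v <- s) r v <= C) ->
  (forall u v, e u v -> 1 <= r v * c [set u; v]) ->
  ~ null_energy G nb c x.
Proof.
move=> c0 eG inf r0 rC rc nul.
have C0 : 0 <= C by have := rC [::] erefl; rewrite big_nil.
have C1 : 0 < C + 1 by rewrite ltr_wpDl.
have [|s [f [cov fx Ef]]] := nul (2 * (C + 1))^-1.
  by rewrite invr_gt0 mulr_gt0.
have [y [[p [ep py]] ys]] : exists y,
    (exists p, path e x p /\ last x p = y) /\ y \notin s.
  apply: contrapT => H; apply: inf; apply: (@sub_finite_set _ _ [set` s]).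
    move=> y Hy; apply: contrapT => ys; apply: H; exists y; split=> //.
    exact/negP.
  exact: finite_seq.
have fy : f y = 0 by apply: contraNeq ys => /(proj2 cov) [].
move: py; case/shortenP: ep => q eq_ uq _ qy.
have := @path_energy c s f x q r c0 cov fx.
rewrite qy => /(_ fy) H.
have {}H : 1 <= (\sum_(v <- q) r v) * energy G c s f.
  apply: H => //; first by apply: sub_path eq_.
    by case/andP: uq.
  move=> i iq; apply: rc; by have /(pathP x)/(_ _ iq) := eq_.
have uq' : uniq q by case/andP: uq.
have E0 : 0 <= energy G c s f.
  by rewrite sumr_ge0 // => u _; rewrite sumr_ge0 // => v _; rewrite mulr_ge0 ?sqr_ge0 ?cond_ge0.
have : (\sum_(v <- q) r v) * energy G c s f <= (C + 1) * (2 * (C + 1))^-1.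
  apply: ler_pM => //; first by rewrite sumr_ge0.
  by apply: (le_trans (rC q uq')); rewrite lerDl.
rewrite invfM mulrCA divff ?gt_eqF // mulr1; lra.
Qed.

Lemma covers_far s (f : V -> R) : covers nb s f ->
  exists N, forall n u, (N <= n)%N -> u \in level n -> f u = 0.
Proof.
move=> [us cov]; exists (\max_(v <- s) height v).+1 => n u Nn.
rewrite mem_level // => /eqP hu; apply/eqP; apply: contraTT Nn => /cov[us' _].
by rewrite -leqNgt -hu (big_rem u) //= leq_maxl.
Qed.

Lemma positive_Clambda (l : R) : 0 < l -> positive G (Clambda G o l).
Proof. by move=> l0 e _; rewrite /Clambda invr_gt0 exprn_gt0. Qed.

Lemma Clambda_parent (l : R) v : v != o ->
  Clambda G o l [set v; parent v] = l ^- (height v).-1.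
Proof.
move=> vo; have [_ hp] := parentP Gconn vo.
rewrite /Clambda edge_height2 // -/(height v) -/(height (parent v)) -hp /=.
by congr (_ ^- _); apply/minn_idPr.
Qed.

Hypothesis Vinf : infinite_set [set: V].

Lemma level_nonempty n : exists u, u \in level n.
Proof.
have [x hx] : exists x, (n <= height x)%N.
  apply/not_existsP => H; apply: Vinf.
  apply: (@sub_finite_set _ _ [set` ball n]); last exact: finite_seq.
  move=> x _ /=; rewrite mem_ball // leqNgt; apply/negP => /ltnW; exact: H.
by exists (anc n x); rewrite mem_level // height_anc.
Qed.

Lemma no_isolated_infinite : no_isolated nb.
Proof.
move=> x; apply/eqP => nbx; apply: Vinf.
apply: (@sub_finite_set _ _ [set x]); last exact: finite_set1.
move=> y _ /=; have [p [xp py]] := Gconn x y.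
case: p => [|z p] in xp py *; first by rewrite -py.
by move: xp => /= /andP[]; rewrite -mem_nb nbx.
Qed.

(** For l < 1 the edges of a geodesic ray have resistances l^k, whose sum
    converges. *)
Lemma ray_energy (l : R) : 0 < l < 1 -> ~ null_energy G nb (Clambda G o l) o.
Proof.
move=> /andP[l0 l1] nul.
have d0 : 0 < (1 - l) / 2 by rewrite divr_gt0 ?subr_gt0.
have [s [f [cov fo Ef]]] := nul _ d0.
have [N HN] := covers_far cov.
have [u uN] := level_nonempty N.
have hu : height u = N by apply/eqP; rewrite -(mem_level o Gconn mem_nb).
pose w v : R := (v == u)%:R.
have thE v : (height v <= N)%N -> through N w v = (anc (height v) u == v)%:R.
  move=> hv; rewrite /through big_mkcond (bigD1_seq u) ?level_uniq //= /w eqxx.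
  rewrite big1 ?addr0; first by case: ifP.
  by move=> v' /negPf ->; case: ifP.
have := @flow_energy _ _ _ _ _ Gconn nb_uniq mem_nb _ _ _ N w
  (fun v => l ^+ (height v).-1) (positive_Clambda l0) cov fo (fun v => HN N v (leqnn _)).
have -> : \sum_(v <- level N) w v = 1.
  rewrite (bigD1_seq u) ?level_uniq //= /w eqxx big1 ?addr0 //.
  by move=> v /negPf ->.
rewrite expr1n => H.
have {}H := H _ _.
have {H} : 1 <= (\sum_(v <- tree_vertices N) l ^+ (height v).-1 * through N w v ^+ 2) *
    energy G (Clambda G o l) s f.
  apply: H => [v|v]; first by rewrite exprn_ge0 // ltW.
  rewrite mem_tree_vertices // => /andP[v0 _] _.
  have vo : v != o by rewrite -(height_eq0 o Gconn) -lt0n.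
  by rewrite Clambda_parent // divff // expf_neq0 // gt_eqF.
have -> : \sum_(v <- tree_vertices N) l ^+ (height v).-1 * through N w v ^+ 2 =
    \sum_(k <- iota 0 N) l ^+ k.
  rewrite big_flatten big_map big_seq [RHS]big_seq; apply: eq_bigr => k.
  rewrite mem_iota add0n => /andP[_ kN].
  have ak : height (anc k.+1 u) = k.+1 by rewrite height_anc ?hu.
  transitivity (\sum_(v <- level k.+1 | anc k.+1 u == v) l ^+ (height v).-1); last first.
    by rewrite sum_pred_eq ?level_uniq ?mem_level ?ak.
  rewrite [RHS]big_mkcond big_seq [RHS]big_seq; apply: eq_bigr => v.
  rewrite mem_level // => /eqP hv; rewrite thE hv //.
  by case: ifP; rewrite ?expr1n ?mulr1 // expr0n mulr0.
move=> H.
have E0 : 0 <= energy G (Clambda G o l) s f.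
  rewrite sumr_ge0 // => a _; rewrite sumr_ge0 // => b _.
  by rewrite mulr_ge0 ?sqr_ge0 ?cond_ge0 //; exact: positive_Clambda.
have : (\sum_(k <- iota 0 N) l ^+ k) * energy G (Clambda G o l) s f <=
    (1 - l)^-1 * ((1 - l) / 2).
  apply: ler_pM => //; first by rewrite sumr_ge0 // => k _; rewrite exprn_ge0 // ltW.
  by apply: geometric_sum_le; rewrite (ltW l0).
rewrite mulrA mulVf ?mul1r; last by rewrite gt_eqF // subr_gt0.
lra.
Qed.

End Criteria.

(** * Means and independent edges *)

Section Expectation.
Variables (R : realType) (d : measure_display) (Omega : measurableType d).
Variable P : probability Omega R.

(** Means of nonnegative variables only, so that linearity needs no
    integrability condition. *)
Definition has_mean (f : Omega -> R) (m : R) :=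
  [/\ measurable_fun setT f, forall w, 0 <= f w & (\int[P]_w (f w)%:E = m%:E)%E].

Lemma has_mean_indic A : measurable A -> has_mean (\1_A) (pr P A).
Proof.
move=> mA; split=> [|w|]; first exact: measurable_indic.
  by rewrite indicE.
by rewrite integral_indic // setIT; exact: prE.
Qed.

Lemma has_mean_cst k : 0 <= k -> has_mean (fun=> k) k.
Proof.
move=> k0; split=> //.
rewrite integral_cst //=; transitivity (k%:E * 1)%E; last by rewrite mule1.
  by congr (_ * _)%E; exact: probability_setT.
Qed.

Lemma has_meanD f g m n : has_mean f m -> has_mean g n ->
  has_mean (fun w => f w + g w) (m + n).
Proof.
move=> [mf f0 If] [mg g0 Ig]; split.
- exact: measurable_funD.
- by move=> w; exact: addr_ge0.
- under eq_integral do rewrite EFinD.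
  rewrite ge0_integralD ?If ?Ig //.
  + by move=> w _; rewrite lee_fin.
  + exact/measurable_EFinP.
  + by move=> w _; rewrite lee_fin.
  + exact/measurable_EFinP.
Qed.

Lemma has_meanZ k f m : 0 <= k -> has_mean f m -> has_mean (fun w => k * f w) (k * m).
Proof.
move=> k0 [mf f0 If]; split.
- exact: measurable_funM.
- by move=> w; exact: mulr_ge0.
- under eq_integral do rewrite EFinM.
  rewrite ge0_integralZl ?If //; first exact/measurable_EFinP.
  by move=> w _; rewrite lee_fin.
Qed.

Lemma has_mean_sum (I : Type) (s : seq I) (Q : pred I) (f : I -> Omega -> R) m :
  (forall i, Q i -> has_mean (f i) (m i)) ->
  has_mean (fun w => \sum_(i <- s | Q i) f i w) (\sum_(i <- s | Q i) m i).
Proof.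
move=> H; elim: s => [|i s IH].
  rewrite big_nil (_ : (fun w => _) = fun=> 0); first exact: has_mean_cst.
  by apply/funext => w; rewrite big_nil.
rewrite big_cons (_ : (fun w => _) = fun w => if Q i then f i w + \sum_(j <- s | Q j) f j w
   else \sum_(j <- s | Q j) f j w); last by apply/funext => w; rewrite big_cons.
by case: ifP => // Qi; apply: has_meanD => //; exact: H.
Qed.

Lemma has_mean_le f g m n : has_mean f m -> has_mean g n ->
  (forall w, f w <= g w) -> m <= n.
Proof.
move=> [mf f0 If] [mg g0 Ig] fg; rewrite -lee_fin -If -Ig.
apply: ge0_le_integral => //.
- by move=> w _; rewrite lee_fin.
- exact/measurable_EFinP.
- exact/measurable_EFinP.
- by move=> w _; rewrite lee_fin.
Qed.

(** Write A for the event on the right. On A one has W <= C + W^2/(4C), off A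
    one has W <= r/2 + delta E/(2r) with r = t/2. Taking means, the four terms
    are at most C P(A), t/4, t/4 and t/8. This replaces the inequality of
    Paley and Zygmund and treats W and E at once. *)
Lemma second_moment (W E : Omega -> R) (t a b C delta : R) :
  has_mean W t -> has_mean (fun w => W w ^+ 2) a -> has_mean E b ->
  0 < t -> 0 < C -> a <= C * t -> b <= C * t -> delta = t / (8 * C) ->
  3 / 8 * t <= C * pr P [set w | delta * E w < W w ^+ 2].
Proof.
move=> mW mW2 mE t0 C0 aC bC dE.
have d0 : 0 < delta by rewrite dE divr_gt0 // mulr_gt0.
set A := [set w | _].
have mA : measurable A.
  have [_ _ _] := mW; case: mW2 => m2 _ _; case: mE => mE _ _.
  have := @measurable_fun_ltr _ _ _ setT (fun w => delta * E w) (fun w => W w ^+ 2).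
  move=> /(_ (measurable_funM (measurable_cst _) mE) m2) H.
  have := H measurableT [set true]; rewrite setTI => /(_ _).
  have -> : (fun w => delta * E w < W w ^+ 2) @^-1` [set true] = A.
    by apply/seteqP; split=> w.
  exact.
pose r := t / 2; have r0 : 0 < r by rewrite divr_gt0.
have main : has_mean (fun w => C * \1_A w + (4 * C)^-1 * W w ^+ 2 +
    (r / 2 + delta / (2 * r) * E w))
    (C * pr P A + (4 * C)^-1 * a + (r / 2 + delta / (2 * r) * b)).
  apply: has_meanD; apply: has_meanD.
  - by apply: has_meanZ (has_mean_indic mA); exact: ltW.
  - by apply: has_meanZ mW2; rewrite invr_ge0 mulr_ge0 // ltW.
  - by apply: has_mean_cst; rewrite divr_ge0 // ltW.
  - by apply: has_meanZ mE; rewrite divr_ge0 ?mulr_ge0 // ltW.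
have {main} : t <= C * pr P A + (4 * C)^-1 * a + (r / 2 + delta / (2 * r) * b).
  have [_ E0 _] := mE; have [_ W0 _] := mW.
  apply: (has_mean_le mW main) => w.
  have W2 s : 0 < s -> W w <= s / 2 + (2 * s)^-1 * W w ^+ 2.
    move=> s0; rewrite -subr_ge0.
    have -> : s / 2 + (2 * s)^-1 * W w ^+ 2 - W w = (s - W w) ^+ 2 / (2 * s).
      by field; rewrite gt_eqF.
    by rewrite divr_ge0 ?sqr_ge0 // mulr_ge0 // ltW.
  have [Aw|Aw] := pselect (A w).
    rewrite indicE mem_set // mulr1.
    have := W2 (2 * C); rewrite mulr_gt0 // => /(_ erefl).
    have -> : 2 * C / 2 = C by field.
    have -> : 2 * (2 * C) = 4 * C by ring.
    have : 0 <= r / 2 + delta / (2 * r) * E w.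
      by rewrite addr_ge0 ?mulr_ge0 ?invr_ge0 ?mulr_ge0 // ltW.
    lra.
  have W2E : W w ^+ 2 <= delta * E w by rewrite leNgt; apply/negP.
  rewrite indicE memNset // mulr0 add0r.
  have := W2 r r0.
  have : (2 * r)^-1 * W w ^+ 2 <= delta / (2 * r) * E w.
    by rewrite mulrAC -[X in _ <= X]mulrC ler_wpM2l // invr_ge0 mulr_ge0 // ltW.
  have : 0 <= (4 * C)^-1 * W w ^+ 2 by rewrite mulr_ge0 ?sqr_ge0 // invr_ge0 mulr_ge0 // ltW.
  lra.
have : (4 * C)^-1 * a <= t / 4.
  apply: (@le_trans _ _ ((4 * C)^-1 * (C * t))).
    by rewrite ler_wpM2l // invr_ge0 mulr_ge0 // ltW.
  by rewrite le_eqVlt; apply/orP; left; apply/eqP; field; rewrite gt_eqF.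
have : delta / (2 * r) * b <= t / 8.
  apply: (@le_trans _ _ (delta / (2 * r) * (C * t))).
    by rewrite ler_wpM2l // divr_ge0 ?mulr_ge0 // ltW.
  by rewrite le_eqVlt; apply/orP; left; apply/eqP; rewrite dE /r; field; rewrite !gt_eqF.
rewrite /r; lra.
Qed.

End Expectation.

Section OpenEdges.
Variables (R : realType) (V : choiceType) (G : graph V).
Variables (d : measure_display) (Omega : measurableType d).
Variable P : probability Omega R.
Variable U : set V -> {RV P >-> R}.
Hypothesis Uiid : iid_uniform G U.
Variable p : R.
Hypothesis p01 : 0 <= p <= 1.

Definition all_open (s : seq (set V)) : set Omega :=
  [set w | forall e, e \in s -> open_edge U p w e].

Lemma measurable_open e : measurable [set w | open_edge U p w e].
Proof.
have -> : [set w | open_edge U p w e] = U e @^-1` `]-oo, p].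
  by apply/seteqP; split=> w /=; rewrite in_itv.
by rewrite -[X in measurable X]setTI; exact: measurable_funP.
Qed.

Lemma measurable_all_open s : measurable (all_open s).
Proof.
elim: s => [|e s IH].
  by rewrite (_ : all_open _ = setT) //; apply/seteqP; split.
rewrite (_ : all_open _ = [set w | open_edge U p w e] `&` all_open s).
  by apply: measurableI => //; exact: measurable_open.
apply/seteqP; split=> w /=.
  by move=> H; split=> [|e' es]; apply: H; rewrite inE ?eqxx ?es ?orbT.
by move=> [He Hs] e'; rewrite inE => /orP[/eqP ->|/Hs].
Qed.

Lemma pr_iid (B : set R) (q : R) s : measurable B ->
  uniform_prob (@ltr01 R) B = q%:E -> uniq s -> (forall e, e \in s -> edges G e) ->
  pr P [set w | forall e, e \in s -> B (U e w)] = q ^+ size s.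
Proof.
move=> mB Bq us se; have [Ud Ui] := Uiid.
rewrite /pr (Ui s (fun=> B) us se (fun=> mB)) big_seq.
have -> : (\prod_(e <- s | e \in s) P [set w | B (U e w)])%E =
    (\prod_(e <- s | e \in s) q%:E)%E.
  by apply: eq_bigr => e es; rewrite -Bq; exact: Ud (se e es) _ mB.
by rewrite -big_seq prodEFin /= big_const_seq count_predT iter_mulr_1.
Qed.

Lemma measurable_le : measurable [set u : R | u <= p].
Proof. by rewrite (_ : [set u | u <= p] = `]-oo, p]%classic). Qed.

Lemma pr_all_open s : uniq s -> (forall e, e \in s -> edges G e) ->
  pr P (all_open s) = p ^+ size s.
Proof.
exact: (pr_iid measurable_le (uniform_prob01_le p01)).
Qed.

Lemma pr_all_closed s : uniq s -> (forall e, e \in s -> edges G e) ->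
  pr P [set w | forall e, e \in s -> ~ open_edge U p w e] = (1 - p) ^+ size s.
Proof.
apply: (pr_iid (B := ~` [set u | u <= p])).
  by apply: measurableC; exact: measurable_le.
transitivity (1 - uniform_prob (@ltr01 R) [set u | (u <= p)%R])%E.
  by apply: probability_setC; exact: measurable_le.
by rewrite uniform_prob01_le.
Qed.

End OpenEdges.

(** * Percolation on the breadth-first tree *)

Section TreePercolation.
Variables (R : realType) (V : choiceType) (G : graph V) (nb : V -> seq V) (o : V).
Hypothesis Gconn : connected_graph G.
Hypotheses (nb_uniq : forall x, uniq (nb x)).
Hypotheses (mem_nb : forall x y, (y \in nb x) = adj G x y).
Variables (d : measure_display) (Omega : measurableType d).
Variable P : probability Omega R.
Variable U : set V -> {RV P >-> R}.
Hypothesis Uiid : iid_uniform G U.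

Local Notation height := (height G o).
Local Notation parent := (parent G o).
Local Notation level := (level G nb o).
Local Notation anc := (anc G o).
Local Notation tree_vertices := (tree_vertices G nb o).
Local Notation through := (through G nb o).
Local Notation growth := (growth G nb o).
Local Notation cap := (cap G nb o).
Local Notation flow := (flow G nb o).

Definition tree_edge v : set V := [set v; parent v].

Lemma tree_edge_edge v : v != o -> edges G (tree_edge v).
Proof. by move=> vo; have [vp _] := parentP Gconn vo; exact: edge_adj. Qed.

Lemma tree_edge_inj v v' : v != o -> v' != o -> tree_edge v = tree_edge v' -> v = v'.
Proof.
move=> vo vo'; have [_ h] := parentP Gconn vo; have [_ h'] := parentP Gconn vo'.
rewrite /tree_edge => E.
have : [set v'; parent v'] v by rewrite -E; left.
have : [set v; parent v] v' by rewrite E; left.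
move=> [//|/= e1] [//|/= e2].
by move: h h'; rewrite -e1 -e2; clear; lia.
Qed.

Section Meets.
Variables (n : nat) (p : R).
Hypothesis p01 : 0 < p <= 1.

Let p01' : 0 <= p <= 1. Proof. by case/andP: p01 => /ltW -> ->. Qed.

Definition path_edges i m u := [seq tree_edge (anc j u) | j <- iota i m].

Definition path_open u : set Omega := all_open U p (path_edges 1 n u).

Lemma anc_neq_o j u : u \in level n -> (0 < j <= n)%N -> anc j u != o.
Proof.
rewrite mem_level // => /eqP hu /andP[j0 jn].
by rewrite -(height_eq0 o Gconn) height_anc ?hu // -lt0n.
Qed.

Lemma path_edges_in i m u e : e \in path_edges i m u ->
  exists2 j, (i <= j < i + m)%N & e = tree_edge (anc j u).
Proof. by move=> /mapP[j]; rewrite mem_iota => ij ->; exists j. Qed.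

Lemma path_edges_edges i m u e : u \in level n -> (0 < i)%N -> (i + m <= n.+1)%N ->
  e \in path_edges i m u -> edges G e.
Proof.
move=> ul i0 im /path_edges_in[j ij ->]; apply: tree_edge_edge.
by apply: anc_neq_o => //; move: ij i0 im; clear; lia.
Qed.

Lemma path_edges_uniq i m u : u \in level n -> (0 < i)%N -> (i + m <= n.+1)%N ->
  uniq (path_edges i m u).
Proof.
move=> ul i0 im; rewrite map_inj_in_uniq ?iota_uniq // => j j'.
rewrite !mem_iota => ij ij' E.
have hu : height u = n by apply/eqP; move: ul; rewrite mem_level.
have jn : (0 < j <= n)%N by move: ij i0 im; clear; lia.
have jn' : (0 < j' <= n)%N by move: ij' i0 im; clear; lia.
have := tree_edge_inj (anc_neq_o ul jn) (anc_neq_o ul jn') E.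
move=> /(congr1 height); rewrite !height_anc ?hu //.
  by case/andP: jn'.
by case/andP: jn.
Qed.

Lemma pr_path_open u : u \in level n -> pr P (path_open u) = p ^+ n.
Proof.
move=> ul; rewrite (pr_all_open Uiid) //.
- by rewrite size_map size_iota.
- exact: path_edges_uniq.
- by move=> e; exact: path_edges_edges.
Qed.

(** Two branches of the tree share exactly their first k0 edges, where k0 is
    the height of their last common vertex, so both are open with probability
    p^(2n - k0); the bound keeps every common vertex above height k instead of
    the last one alone, which makes it summable vertex by vertex. *)
Lemma pr_two_paths k u u' : u \in level n -> u' \in level n -> (k <= n)%N ->
  anc k u == anc k u' ->
  p ^- n * p ^- n * pr P (path_open u `&` path_open u') <=
  \sum_(i <- iota k (n - k).+1 | anc i u == anc i u') p ^- i.
Proof.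
have /andP[p0 p1] := p01; move=> ul ul' kn ek.
have hu : height u = n by apply/eqP; move: ul; rewrite mem_level.
have hu' : height u' = n by apply/eqP; move: ul'; rewrite mem_level.
have exP : exists i, (i <= n)%N && (anc i u == anc i u') by exists k; rewrite kn.
have ub i : (i <= n)%N && (anc i u == anc i u') -> (i <= n)%N by case/andP.
case: (ex_maxnP exP ub) => k0 /andP[k0n e0] k0max.
have kk0 : (k <= k0)%N by apply: k0max; rewrite kn.
have E : path_open u `&` path_open u' =
    all_open U p (path_edges 1 n u ++ path_edges k0.+1 (n - k0) u').
  apply/seteqP; split=> w /=.
    move=> [H H'] e; rewrite mem_cat => /orP[/H//|/mapP[j]].
    rewrite mem_iota => jk ->; apply: H'; apply: map_f; rewrite mem_iota.
    by move: jk k0n; clear; lia.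
  move=> H; split=> e He; first by apply: H; rewrite mem_cat He.
  case/mapP: He => j; rewrite mem_iota => jn ->.
  have [jk|jk] := leqP j k0; last first.
    apply: H; rewrite mem_cat; apply/orP; right; apply: map_f; rewrite mem_iota.
    by move: jn jk k0n; clear; lia.
  have -> : anc j u' = anc j u.
    by rewrite -(anc_anc Gconn jk) ?hu' // -(eqP e0) anc_anc ?hu.
  apply: H; rewrite mem_cat; apply/orP; left; apply: map_f; by rewrite mem_iota.
have k0n' : (k0.+1 + (n - k0) <= n.+1)%N by move: k0n; clear; lia.
rewrite E (pr_all_open Uiid) //; last 2 first.
- rewrite cat_uniq !path_edges_uniq //= andbT; apply/hasPn => e.
  move=> /path_edges_in[j jk ->]; apply/negP => /=.
  move=> /path_edges_in[i i_n Eij].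
  have jn : (0 < j <= n)%N by move: jk k0n; clear; lia.
  have i_n' : (0 < i <= n)%N by move: i_n; clear; lia.
  have ea := tree_edge_inj (anc_neq_o ul' jn) (anc_neq_o ul i_n') Eij.
  have ij : j = i.
    have := congr1 height ea; rewrite !height_anc ?hu ?hu' //.
      by case/andP: i_n'.
    by case/andP: jn.
  have : (j <= k0)%N.
    apply: k0max; case/andP: jn => _ ->; by rewrite ea -ij eqxx.
  by move: jk; clear; lia.
- move=> e; rewrite mem_cat => /orP[|]; first exact: path_edges_edges.
  exact: path_edges_edges.
rewrite size_cat !size_map !size_iota.
have -> : p ^- n * p ^- n * p ^+ (n + (n - k0)) = p ^- k0.
  rewrite -[in p ^- k0](subKn k0n) -{3}(subnK k0n).
  rewrite -invfM -exprD mulrC; apply: (@mulIf _ (p ^+ (n + n))).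
    by rewrite expf_neq0 // gt_eqF.
  rewrite divfK ?expf_neq0 ?gt_eqF // subnK // subKn //.
  rewrite mulrC -[X in X / _](_ : p ^+ (n + (n - k0)) * p ^+ k0 = _).
    by rewrite mulfK // expf_neq0 // gt_eqF.
  by rewrite -exprD; congr (p ^+ _); move: k0n; clear; lia.
rewrite big_mkcond (bigD1_seq k0) ?iota_uniq //; last first.
  by rewrite mem_iota; move: kk0 k0n kn; clear; lia.
rewrite /= e0 lerDl sumr_ge0 // => i _; case: ifP => // _.
by rewrite invr_ge0 exprn_ge0 // ltW.
Qed.

End Meets.

Section SecondMoment.
Variables (l l' p : R).
Hypotheses (l1 : 1 < l) (l'0 : 0 < l') (p01 : 0 < p < 1).
Hypotheses (pl1 : 1 < p * l) (pl' : l' < p * l).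

Let p0 : 0 < p. Proof. by case/andP: p01. Qed.
Let p01' : 0 < p <= 1. Proof. by case/andP: p01 => -> /ltW. Qed.
Let rho := (p * l)^-1.
Let rho01 : 0 <= rho < 1.
Proof.
have pl0 : 0 < p * l by exact: lt_trans pl1.
by rewrite /rho invr_ge0 ltW //= invf_lt1.
Qed.
Let rho0 : 0 <= rho. Proof. by case/andP: rho01. Qed.
Let rho1 : rho <= 1. Proof. by case/andP: rho01 => _ /ltW. Qed.
Let lr01 : 0 <= l' * rho < 1.
Proof.
have pl0 : 0 < p * l by exact: lt_trans pl1.
by rewrite /rho mulr_ge0 ?invr_ge0 ?(ltW l'0) ?(ltW pl0) //= ltr_pdivrMr // mul1r.
Qed.
Let C := (1 - rho)^-1 * (1 - l' * rho)^-1.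

Variable n : nat.
Let theta u := flow l n u.
Let t := cap l n o.

Let weight u (w : Omega) : R := theta u * p ^- n * \1_(path_open n p u) w.
Let Q k (w : Omega) : R :=
  \sum_(u <- level n) \sum_(u' <- level n | anc k u == anc k u') weight u w * weight u' w.

Let mopen u : measurable (path_open n p u).
Proof. exact: measurable_all_open. Qed.

Let theta0 u : 0 <= theta u.
Proof. exact: flow_ge0 (ltW l1) _ _. Qed.

Let pn0 k : 0 <= p ^- k.
Proof. by rewrite invr_ge0 exprn_ge0 // ltW. Qed.

Lemma mean_weight u : u \in level n -> has_mean P (weight u) (theta u).
Proof.
move=> ul; have := has_meanZ (mulr_ge0 (theta0 u) (pn0 n)) (has_mean_indic P (mopen u)).
rewrite pr_path_open // -mulrA mulVf ?mulr1 // expf_neq0 // gt_eqF //.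
Qed.

Lemma mean_mass : has_mean P (fun w => \sum_(u <- level n) weight u w) t.
Proof.
have := @has_mean_sum _ _ _ P _ (level n) (fun u => u \in level n) weight theta mean_weight.
rewrite -big_seq (flow_level o Gconn mem_nb (ltW l1) (leqnn n)).
by congr (has_mean P _ _); apply/funext => w; rewrite -big_seq.
Qed.

Let q k : R := \sum_(u <- level n) \sum_(u' <- level n | anc k u == anc k u')
    theta u * theta u' * (p ^- n * p ^- n * pr P (path_open n p u `&` path_open n p u')).

Lemma mean_Q k : has_mean P (Q k) (q k).
Proof.
apply: has_mean_sum => u _; apply: has_mean_sum => u' _.
have := has_meanZ (mulr_ge0 (mulr_ge0 (theta0 u) (theta0 u'))
   (mulr_ge0 (pn0 n) (pn0 n)))
  (has_mean_indic P (measurableI _ _ (mopen u) (mopen u'))).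
rewrite -!mulrA; congr (has_mean P _ _); apply/funext => w.
by rewrite /weight indicI /=; ring.
Qed.

Let t0 : 0 <= t. Proof. exact: cap_ge0 (ltW l1) _ _. Qed.

(** Summing over pairs of branches that meet at z gives the square of the flow
    through z, and one of the two factors is at most l^-|z|; the other ones
    add up to t on each level. *)
Lemma q_le k : (k <= n)%N -> q k <= rho ^+ k * ((1 - rho)^-1 * t).
Proof.
move=> kn.
apply: (@le_trans _ _ (\sum_(i <- iota k (n - k).+1) p ^- i *
   \sum_(u <- level n) \sum_(u' <- level n | anc i u == anc i u') theta u * theta u')).
  apply: (@le_trans _ _ (\sum_(u <- level n) \sum_(u' <- level n)
     \sum_(i <- iota k (n - k).+1 | anc i u == anc i u') p ^- i * (theta u * theta u'))).
    rewrite /q big_seq [leRHS]big_seq; apply: ler_sum => u ul.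
    rewrite big_mkcond /= big_seq [leRHS]big_seq; apply: ler_sum => u' ul'.
    case: ifP => [ek|_]; last by rewrite sumr_ge0 // => i _; rewrite !mulr_ge0.
    by rewrite -mulr_suml mulrC ler_wpM2r ?mulr_ge0 // pr_two_paths.
  rewrite le_eqVlt; apply/orP; left; apply/eqP.
  under eq_bigr do rewrite (exchange_big_dep xpredT) //=.
  rewrite exchange_big /=; apply: eq_bigr => i _.
  by rewrite mulr_sumr; apply: eq_bigr => u _; rewrite mulr_sumr.
apply: (@le_trans _ _ (\sum_(i <- iota k (n - k).+1) rho ^+ i * t)).
  rewrite big_seq [leRHS]big_seq; apply: ler_sum => i.
  rewrite mem_iota => /andP[_ i_n]; have {}i_n : (i <= n)%N by move: i_n kn; clear; lia.
  rewrite /rho exprVn exprMn invfM -mulrA ler_wpM2l //.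
  have -> : \sum_(u <- level n) \sum_(u' <- level n | anc i u == anc i u') theta u * theta u'
      = \sum_(z <- level i) theta z * theta z.
    transitivity (\sum_(u <- level n) theta u * through n theta (anc i u)).
      rewrite big_seq [RHS]big_seq; apply: eq_bigr => u ul.
      have hu : height u = n by apply/eqP; move: ul; rewrite mem_level.
      rewrite /through height_anc ?hu // mulr_sumr.
      by apply: eq_bigl => u'; rewrite eq_sym.
    rewrite sum_by_anc // big_seq [RHS]big_seq; apply: eq_bigr => z.
    rewrite mem_level // => /eqP hz.
    by rewrite through_flow ?hz // ltW.
  rewrite /t -(flow_level o Gconn mem_nb (ltW l1) i_n) mulr_sumr.
  rewrite big_seq [leRHS]big_seq; apply: ler_sum => z.
  rewrite mem_level // => /eqP hz; rewrite ler_wpM2r //.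
  by rewrite -hz; apply: flow_le => //; rewrite ?hz // ltW.
rewrite -mulr_suml mulrA ler_wpM2r // -[k in iota k]addn0 iotaDl big_map.
under eq_bigr do rewrite exprD.
by rewrite -mulr_sumr ler_wpM2l ?geometric_sum_le // exprn_ge0.
Qed.

Let En w := \sum_(k <- iota 0 n) l' ^+ k * Q k.+1 w.

Lemma mean_En : exists2 b, has_mean P En b & b <= C * t.
Proof.
exists (\sum_(k <- iota 0 n) l' ^+ k * q k.+1).
  apply: has_mean_sum => k _; apply: has_meanZ (mean_Q _).
  by rewrite exprn_ge0 // ltW.
apply: (@le_trans _ _ (\sum_(k <- iota 0 n) (l' * rho) ^+ k * ((1 - rho)^-1 * t))).
  rewrite big_seq [leRHS]big_seq; apply: ler_sum => k.
  rewrite mem_iota add0n => /andP[_ kn].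
  rewrite exprMn -mulrA ler_wpM2l ?exprn_ge0 ?(ltW l'0) //.
  apply: le_trans (q_le kn) _; rewrite exprS -mulrA ler_piMl //.
    by apply: mulr_ge0; [exact: exprn_ge0|rewrite mulr_ge0 // invr_ge0 subr_ge0].
rewrite -mulr_suml /C mulrA [X in _ <= X * t]mulrC ler_wpM2r //.
by rewrite ler_wpM2r ?geometric_sum_le // invr_ge0 subr_ge0.
Qed.

Lemma C_gt0 : 0 < C.
Proof.
by rewrite mulr_gt0 // invr_gt0 subr_gt0; [case/andP: rho01|case/andP: lr01].
Qed.

Lemma q0_le : q 0 <= C * t.
Proof.
apply: le_trans (q_le (leq0n n)) _; rewrite expr0 mul1r ler_wpM2r //.
rewrite ler_peMr ?invr_ge0 ?subr_ge0 //.
have /andP[a b] := lr01.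
by rewrite invf_ge1 ?subr_gt0 // gerBl.
Qed.

Variables (c2 : set V -> R).
Hypothesis c2_pos : positive G c2.

Let network w := disordered U (Clambda G o l') c2 p w.

Lemma positive_disordered w : positive G (network w).
Proof.
move=> e ee; rewrite /network /disordered; case: ifP => _; last exact: c2_pos.
exact: positive_Clambda.
Qed.

Lemma En_energy w s f : covers nb s f -> f o = 1 ->
  (forall u, u \in level n -> f u = 0) ->
  (\sum_(u <- level n) weight u w) ^+ 2 <= En w * energy G (network w) s f.
Proof.
move=> cov fo fn.
have := @flow_energy _ _ _ _ _ Gconn nb_uniq mem_nb _ _ _ n (weight^~ w)
  (fun v => l' ^+ (height v).-1) (positive_disordered w) cov fo fn.
move=> H; have {}H := H _ _.
have -> : En w = \sum_(v <- tree_vertices n) l' ^+ (height v).-1 * through n (weight^~ w) v ^+ 2.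
  rewrite big_flatten big_map /En big_seq [RHS]big_seq; apply: eq_bigr => k.
  rewrite mem_iota add0n => /andP[_ kn].
  transitivity (l' ^+ k * \sum_(u <- level n) weight u w * through n (weight^~ w) (anc k.+1 u)).
    congr (_ * _); rewrite /Q big_seq [RHS]big_seq; apply: eq_bigr => u ul.
    have hu : height u = n by apply/eqP; move: ul; rewrite mem_level.
    rewrite /through height_anc ?hu // mulr_sumr.
    by apply: eq_bigl => u'; rewrite eq_sym.
  rewrite sum_by_anc // mulr_sumr big_seq [RHS]big_seq; apply: eq_bigr => v.
  by rewrite mem_level // => /eqP ->.
apply: H => [v|v vt tv]; first by rewrite exprn_ge0 // ltW.
have /andP[v0 vn] : (0 < height v <= n)%N by rewrite -(mem_tree_vertices o Gconn mem_nb).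
have vo : v != o by rewrite -(height_eq0 o Gconn) -lt0n.
have op : open_edge U p w (tree_edge v).
  apply: contraNT tv => nop; rewrite /through big_seq_cond big1 // => u /andP[ul /eqP au].
  rewrite /weight indicE memNset ?mulr0 // => Hu.
  move/negP: nop; apply; apply: Hu; rewrite -au; apply: map_f.
  by rewrite mem_iota v0 add1n ltnS.
rewrite /network /disordered -/(tree_edge v) op Clambda_parent //.
by rewrite divff // expf_neq0 // gt_eqF.
Qed.

(** Where the squared strength exceeds delta times the energy of the open
    flow, every test function has energy at least delta. *)
Lemma good_event (e0 : R) : 0 < e0 -> e0 <= t ->
  exists A : set Omega, [/\ measurable A, 3 / 8 * e0 <= C * pr P A &
   forall w, A w -> forall s f, covers nb s f -> f o = 1 ->
     (forall u, u \in level n -> f u = 0) ->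
     e0 / (8 * C) <= energy G (network w) s f].
Proof.
move=> e00 e0t; have [b mE bC] := mean_En; have C0 := C_gt0.
have tpos : 0 < t by exact: lt_le_trans e0t.
have mW2 : has_mean P (fun w => (\sum_(u <- level n) weight u w) ^+ 2) (q 0).
  have := mean_Q 0; congr (has_mean P _ _); apply/funext => w.
  rewrite /Q expr2 mulr_suml; apply: eq_bigr => u _.
  by rewrite mulr_sumr; apply: eq_bigl => u'; rewrite !anc0 // eqxx.
set delta := t / (8 * C).
exists [set w | delta * En w < (\sum_(u <- level n) weight u w) ^+ 2]; split.
- have := @measurable_fun_ltr _ _ _ setT (fun w => delta * En w)
    (fun w => (\sum_(u <- level n) weight u w) ^+ 2).
  case: mE => mE _ _; case: mW2 => m2 _ _.
  move=> /(_ (measurable_funM (measurable_cst _) mE) m2) H.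
  have := H measurableT [set true]; rewrite setTI => /(_ _).
  rewrite (_ : _ @^-1` [set true] = [set w | delta * En w <
    (\sum_(u <- level n) weight u w) ^+ 2]); first by apply.
  by apply/seteqP; split=> w.
- have := second_moment mean_mass mW2 mE tpos C0 q0_le bC erefl.
  apply: le_trans; by rewrite ler_wpM2l.
move=> w Aw s f cov fo fn; have H := En_energy w cov fo fn.
have E0 : 0 <= En w by case: mE.
have d0 : 0 < delta by rewrite divr_gt0 // mulr_gt0.
apply: (@le_trans _ _ delta).
  by rewrite /delta ler_wpM2r // invr_ge0 mulr_ge0 // ltW.
have En0 : 0 < En w.
  rewrite lt_neqAle E0 andbT; apply/eqP => E; move: Aw H => /=.
  by rewrite -E mulr0 mul0r => /lt_le_trans/[apply]; rewrite ltxx.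
rewrite -(ler_pM2l En0) mulrC; apply: le_trans H; exact: ltW.
Qed.

End SecondMoment.

(** The good events of all generations n have probabilities bounded below, so
    with positive probability infinitely many of them occur, and each finitely
    supported f vanishes on all far generations. *)
Lemma tree_percolation_transient (l l' p : R) (c2 : set V -> R) D :
  homogeneous G nb o D -> ~ growth l -> 1 < l -> 0 < l' -> 0 < p < 1 ->
  1 < p * l -> l' < p * l -> positive G c2 ->
  ~ {ae P, forall w, null_energy G nb (disordered U (Clambda G o l') c2 p w) o}.
Proof.
move=> hom ngr l1 l'0 p01 pl1 pl' c20.
have l0 : 0 < l by exact: lt_trans l1.
pose e0 := l ^- D / 2.
have e00 : 0 < e0 by rewrite divr_gt0 // invr_gt0 exprn_gt0.
have capge n : e0 <= cap l n o.
  rewrite leNgt; apply/negP => H; apply: ngr.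
  apply: (cap_growth Gconn nb_uniq mem_nb (ltW l1) (j := n) hom); exact: ltW.
have /choice[A AP] := fun n => good_event l1 l'0 p01 pl1 pl' c20 e00 (capge n).
set C := _^-1 * _^-1 in AP.
have C0 : 0 < C by exact: C_gt0.
clearbody C.
pose F N := \bigcup_(n in [set n | (N <= n)%N]) A n.
have mA n : measurable (A n) by have [] := AP n.
have mF N : measurable (F N) by apply: bigcup_measurable => n _; exact: mA.
have pF N : 3 / 8 * e0 / C <= pr P (F N).
  have [_ H _] := AP N; rewrite ler_pdivrMr // [leRHS]mulrC; apply: (le_trans H).
  by rewrite ler_pM2l //; apply: pr_le => // w Aw; exists N => /=.
have pB : 3 / 8 * e0 / C <= pr P (\bigcap_N F N).
  have cv : pr P (F N) @[N --> \oo] --> pr P (\bigcap_N F N).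
    apply: pr_bigcap_ni => //; apply/nonincreasing_seqP => N; apply/subsetPset.
    by move=> w [n /= Nn An]; exists n => //=; exact: ltnW.
  rewrite -(cvg_lim _ cv) //; apply: limr_ge; last by apply: nearW.
  by apply/cvg_ex; eexists; exact: cv.
move=> [B [mB PB0 subB]].
have mcap : measurable (\bigcap_N F N) by apply: bigcap_measurable => //; exists 0%N.
have : pr P (\bigcap_N F N) <= pr P B.
  apply: pr_le => // w Fw; apply: subB => /= nul.
  have d0 : 0 < e0 / (16 * C) by rewrite divr_gt0 // mulr_gt0.
  have [s [f [cov fo Ef]]] := nul _ d0.
  have [N HN] := covers_far o Gconn mem_nb cov.
  have [n /= Nn An] := Fw N Logic.I.
  have [_ _ H] := AP n.
  have := H w An s f cov fo (fun u => HN n u Nn).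
  move=> /le_trans/(_ Ef); apply/negP; rewrite -ltNge ltr_pM2l //.
  by rewrite ltf_pV2 ?posrE ?mulr_gt0 // ltr_pM2r // ltr_nat.
rewrite {2}/pr PB0 /= => /(le_trans pB).
by apply/negP; rewrite -ltNge divr_gt0 // mulr_gt0.
Qed.

End TreePercolation.

(** * Measurability of recurrence and the zero-one law *)

Section Measurability.
Variables (R : realType) (V : choiceType) (G : graph V) (nb : V -> seq V) (o : V).
Hypothesis Gconn : connected_graph G.
Hypotheses (nb_uniq : forall x, uniq (nb x)).
Hypotheses (mem_nb : forall x y, (y \in nb x) = adj G x y).
Hypothesis noiso : no_isolated nb.
Variables (d : measure_display) (T : measurableType d) (c : T -> set V -> R).
Hypothesis c0 : forall w, positive G (c w).
Hypothesis mc : forall e, edges G e -> measurable_fun setT (c^~ e).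

Lemma measurable_cond x y : measurable_fun setT (fun w => cond G (c w) x y).
Proof.
rewrite /cond; case: (boolP (adj G x y)) => [xy|_]; last exact: measurable_cst.
exact/mc/edge_adj.
Qed.

Lemma measurable_step x y : measurable_fun setT (fun w => step G nb (c w) x y).
Proof.
have -> : (fun w => step G nb (c w) x y) =
    (fun w => cond G (c w) x y * (vcond G nb (c w) x) `^ (-1)).
  apply/funext => w; rewrite powR_inv1 //.
  exact/ltW/(vcond_gt0 mem_nb noiso).
apply: measurable_funM; first exact: measurable_cond.
apply: (measurableT_comp (measurable_powR _)).
by apply: measurable_sum => z; exact: measurable_cond.
Qed.

Lemma measurable_hit x n y : measurable_fun setT (fun w => hit G nb (c w) x n y).
Proof.
elim: n y => [|n IH] y /=; first exact: measurable_cst.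
case: (y == x); first exact: measurable_cst.
apply: measurable_sum => z; apply: measurable_funM => //.
exact: measurable_step.
Qed.

Lemma measurable_ret x n : measurable_fun setT (fun w => ret G nb (c w) x n).
Proof.
apply: measurable_sum => z; apply: measurable_funM.
  exact: measurable_step.
exact: measurable_hit.
Qed.

(** Return probabilities within n steps are rational functions of finitely
    many conductances, so the criterion in terms of them is a countable
    combination of measurable conditions. *)
Lemma measurable_null_energy x : measurable [set w | null_energy G nb (c w) x].
Proof.
have -> : [set w | null_energy G nb (c w) x] =
    \bigcap_k \bigcup_n [set w | 1 - k.+1%:R^-1 <= ret G nb (c w) x n].
  apply/seteqP; split=> w.
    move=> /(null_energyP nb_uniq mem_nb noiso _ (c0 w)) H k _.
    have [|n Hn] := H k.+1%:R^-1; first by rewrite invr_gt0 ltr0n.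
    by exists n.
  move=> H; apply/(null_energyP nb_uniq mem_nb noiso _ (c0 w)) => eps e0.
  have [k Hk] : exists k : nat, k.+1%:R^-1 <= eps.
    exists (Num.truncn eps^-1); rewrite -[leRHS]invrK lef_pV2 ?posrE ?invr_gt0 //.
    exact/ltW/truncnS_gt.
  have [n _ /= Hn] := H k Logic.I; exists n; apply: le_trans Hn.
  by rewrite lerD2l lerN2.
apply: bigcapT_measurable => k; apply: bigcupT_measurable => n.
rewrite -[X in measurable X]setTI.
have := @measurable_fun_ler _ _ _ setT (fun=> 1 - k.+1%:R^-1) _ (measurable_cst _)
   (measurable_ret x n).
move=> /(_ measurableT [set true]); apply => //.
Qed.

Lemma measurable_recurrent : measurable [set w | forall x, null_energy G nb (c w) x].
Proof.
have -> : [set w | forall x, null_energy G nb (c w) x] =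
    \bigcap_n \bigcap_i [set w | null_energy G nb (c w) (nth o (ball G nb o n) i)].
  apply/seteqP; split=> w H; first by move=> n _ i _; exact: H.
  move=> x; have xb : x \in ball G nb o (height G o x) by rewrite mem_ball.
  by have := H (height G o x) Logic.I (index x (ball G nb o (height G o x))) Logic.I;
    rewrite /= nth_index.
apply: bigcapT_measurable => n; apply: bigcapT_measurable => i.
exact: measurable_null_energy.
Qed.

End Measurability.

Section Independence.
Variables (R : realType) (V : choiceType) (G : graph V).
Variables (d : measure_display) (Omega : measurableType d).
Variable P : probability Omega R.
Variable U : set V -> {RV P >-> R}.
Hypothesis Uiid : iid_uniform G U.
Variable p : R.
Hypothesis p01 : 0 <= p <= 1.

(** Finite intersections of events that single edges are open: a pi-system
    generating the information carried by the edges in I. *)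
Definition cylinders (I : set (set V)) : set (set Omega) :=
  [set B | exists2 s, (forall e, e \in s -> edges G e /\ I e) & B = all_open U p s].

Lemma cylinders_setI I : setI_closed (cylinders I).
Proof.
move=> _ _ [s Hs ->] [t Ht ->]; exists (s ++ t).
  by move=> e; rewrite mem_cat => /orP[/Hs|/Ht].
apply/seteqP; split=> w /=.
  by move=> [H1 H2] e; rewrite mem_cat => /orP[/H1|/H2].
by move=> H; split=> e He; apply: H; rewrite mem_cat He ?orbT.
Qed.

Lemma sigma_cylinders_measurable I B : <<s cylinders I >> B -> measurable B.
Proof.
apply: smallest_sub; first exact: sigma_algebra_measurable.
by move=> _ [s _ ->]; exact: measurable_all_open.
Qed.

Lemma pr_setC A : measurable A -> pr P (~` A) = 1 - pr P A.
Proof.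
move=> mA; have := pr_splitI P measurableT mA.
by rewrite prT !setTI => ->; ring.
Qed.

Lemma independent_bigcup A (F : (set Omega)^nat) : measurable A ->
  trivIset [set: nat] F ->
  (forall n, measurable (F n) /\ pr P (A `&` F n) = pr P A * pr P (F n)) ->
  measurable (\bigcup_k F k) /\
  pr P (A `&` \bigcup_k F k) = pr P A * pr P (\bigcup_k F k).
Proof.
move=> mA tF HF; have mF n : measurable (F n) by have [] := HF n.
split; first exact: bigcupT_measurable.
pose Gn n := \big[setU/set0]_(k < n.+1) F k.
have mG n : measurable (Gn n) by apply: bigsetU_measurable => k _.
have UG : \bigcup_n Gn n = \bigcup_n F n by exact: bigcup_bigsetU_bigcup.
have ndG : nondecreasing_seq Gn.
  by move=> m n mn; apply/subsetPset; apply: subset_bigsetU.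
have HG n : pr P (A `&` Gn n) = pr P A * pr P (Gn n).
  rewrite /Gn; elim: n.+1 => [|m IH].
    by rewrite big_ord0 setI0 pr0 mulr0.
  have dis : \big[setU/set0]_(k < m) F k `&` F m = set0.
    rewrite -bigcup_mkord setI_bigcupl bigcup0 // => k /= km.
    by move/trivIsetP: tF; apply => //; rewrite ltn_eqF.
  rewrite big_ord_recr /= setIUr !prU ?mulrDr ?IH.
  - by have [_ ->] := HF m.
  - by apply: bigsetU_measurable.
  - exact: mF.
  - exact: dis.
  - by apply: measurableI => //; apply: bigsetU_measurable.
  - exact: measurableI.
  - by rewrite setIACA setIid dis setI0.
rewrite -UG; have c1 : pr P (Gn n) @[n --> \oo] --> pr P (\bigcup_n Gn n).
  exact: pr_bigcup_nd.
have c2 : pr P (A `&` Gn n) @[n --> \oo] --> pr P (A `&` \bigcup_n Gn n).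
  rewrite setI_bigcupr; apply: pr_bigcup_nd => [n|m n mn].
    exact: measurableI.
  by apply/subsetPset; apply: setIS; apply/subsetPset; exact: ndG.
have c3 : pr P (A `&` Gn n) @[n --> \oo] --> pr P A * pr P (\bigcup_n Gn n).
  by under eq_fun do rewrite HG; exact: cvgMr.
exact: (cvg_unique _ c2 c3).
Qed.

Lemma independent_sigma I A : measurable A ->
  (forall B, cylinders I B -> pr P (A `&` B) = pr P A * pr P B) ->
  forall B, <<s cylinders I >> B -> pr P (A `&` B) = pr P A * pr P B.
Proof.
move=> mA H B sB.
suff [] : measurable B /\ pr P (A `&` B) = pr P A * pr P B by [].
move: B sB; apply: (@dynkin_induction _ (g_sigma_algebraType (cylinders I)) (cylinders I)
  (fun B : set Omega => measurable B /\ pr P (A `&` B) = pr P A * pr P B)) => //.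
- exact: cylinders_setI.
- by rewrite setIT prT mulr1.
- move=> B cB; split; last exact: H.
  by apply: (@sigma_cylinders_measurable I); exact: sub_gen_smallest.
- move=> B _ [mB HB]; split; first exact: measurableC.
  rewrite pr_setC // mulrBr mulr1 -HB.
  by rewrite (pr_splitI P mA mB); ring.
- by move=> F _ tF HF; exact: independent_bigcup.
Qed.

(** The product rule holds on the generating pi-systems; it extends to one
    generated sigma-algebra at a time. *)
Lemma independent_cylinders I J A B : (forall e, I e -> ~ J e) ->
  <<s cylinders I >> A -> <<s cylinders J >> B ->
  pr P (A `&` B) = pr P A * pr P B.
Proof.
move=> IJ sA; have mA := sigma_cylinders_measurable sA.
apply: independent_sigma => // _ [t Ht ->].
rewrite setIC mulrC; move: A sA {mA}; apply: independent_sigma.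
  exact: measurable_all_open.
have und (s : seq (set V)) : all_open U p s = all_open U p (undup s).
  apply/seteqP; split=> w H e He; apply: H; first by rewrite mem_undup in He.
  by rewrite mem_undup.
move=> _ [s Hs ->]; rewrite (und s) (und t).
have -> : all_open U p (undup t) `&` all_open U p (undup s) =
    all_open U p (undup t ++ undup s).
  apply/seteqP; split=> w /=.
    by move=> [H1 H2] e; rewrite mem_cat => /orP[/H1|/H2].
  by move=> H; split=> e He; apply: H; rewrite mem_cat He ?orbT.
rewrite !(pr_all_open Uiid) ?undup_uniq //.
- by rewrite size_cat exprD.
- by move=> e; rewrite mem_undup => /Hs[].
- by move=> e; rewrite mem_undup => /Ht[].
- rewrite cat_uniq !undup_uniq andbT /=; apply/hasPn => e; rewrite mem_undup => /Hs[_ Ie].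
  by rewrite /= mem_undup; apply/negP => /Ht[_]; exact: IJ.
- by move=> e; rewrite mem_cat !mem_undup => /orP[/Ht[]|/Hs[]].
Qed.

End Independence.

Section ZeroOne.
Variables (R : realType) (V : choiceType) (G : graph V) (nb : V -> seq V) (o : V).
Hypothesis Gconn : connected_graph G.
Hypotheses (nb_uniq : forall x, uniq (nb x)).
Hypotheses (mem_nb : forall x y, (y \in nb x) = adj G x y).
Hypothesis noiso : no_isolated nb.
Variables (d : measure_display) (Omega : measurableType d).
Variable P : probability Omega R.
Variable U : set V -> {RV P >-> R}.
Hypothesis Uiid : iid_uniform G U.
Variable p : R.
Hypothesis p01 : 0 <= p <= 1.
Variables c1 c2 : set V -> R.
Hypotheses (c1_pos : positive G c1) (c2_pos : positive G c2).

(** The ratio of two positive conductance functions that differ on finitely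
    many edges is bounded. *)
Lemma null_energy_finite (c c' : set V -> R) (S : seq (set V)) x :
  positive G c -> positive G c' -> (forall e, e \notin S -> c e = c' e) ->
  null_energy G nb c x -> null_energy G nb c' x.
Proof.
move=> c0 c'0 cc.
pose k := 1 + \sum_(e <- S | `[< edges G e >]) c' e / c e.
have s0 : 0 <= \sum_(e <- S | `[< edges G e >]) c' e / c e.
  by apply: sumr_ge0 => e /asboolP ee; rewrite divr_ge0 // ltW; [|exact: c'0| |exact: c0].
apply: (@null_energy_le _ _ _ _ _ _ k); first by rewrite ltr_wpDr.
move=> e ee; have [eS|eS] := boolP (e \in S); last first.
  by rewrite cc // ler_peMl ?lerDl // ltW // c'0.
rewrite -ler_pdivrMr ?c0 // /k (big_rem e) //= asboolT // addrCA lerDl.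
rewrite addr_ge0 // sumr_ge0 // => e' /asboolP ee'.
by rewrite divr_ge0 // ltW; [|exact: c'0| |exact: c0].
Qed.

Let network w := disordered U c1 c2 p w.
Let rec := [set w | forall x, null_energy G nb (network w) x].

Let network_pos w : positive G (network w).
Proof. by move=> e ee; rewrite /network /disordered; case: ifP => _; [exact: c1_pos|exact: c2_pos]. Qed.

(** Closing the edges of S changes neither recurrence nor positivity and
    removes the dependence on their state. *)
Lemma recurrent_tail (S : seq (set V)) :
  <<s cylinders G U p [set e | e \notin S] >> rec.
Proof.
pose nS w e := if e \in S then c2 e else network w e.
have nS0 w : positive G (nS w).
  by move=> e ee; rewrite /nS; case: ifP => _; [exact: c2_pos|exact: network_pos].
have -> : rec = [set w | forall x, null_energy G nb (nS w) x].
  apply/seteqP; split=> w H x; apply: (null_energy_finite (S := S)) (H x) => //.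
    by move=> e /negPf eS; rewrite /nS eS.
  by move=> e /negPf eS; rewrite /nS eS.
set I := [set e | e \notin S].
apply: (@measurable_recurrent R V G nb o Gconn nb_uniq mem_nb noiso _
  (g_sigma_algebraType (cylinders G U p I)) nS nS0) => e ee.
rewrite /nS; case: (boolP (e \in S)) => eS; first exact: measurable_cst.
have mO : <<s cylinders G U p I >> [set w | open_edge U p w e].
  apply: sub_gen_smallest; exists [:: e].
    by move=> e'; rewrite inE => /eqP ->.
  apply/seteqP; split=> w /=; first by move=> H e'; rewrite inE => /eqP ->.
  by apply; rewrite mem_head.
rewrite /network /disordered.
apply: (@measurable_fun_ifT _ _ (g_sigma_algebraType (cylinders G U p I))).
- apply: (measurable_fun_bool true); rewrite setTI.
  exact: mO.
- exact: measurable_cst.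
- exact: measurable_cst.
Qed.

(** Recurrence is independent of every finite family of edges, hence of the
    sigma-algebra that they generate, hence of itself. *)
Lemma recurrent_zero_one :
  {ae P, forall w, forall x, null_energy G nb (network w) x} \/
  {ae P, forall w, ~ forall x, null_energy G nb (network w) x}.
Proof.
have mr : measurable rec := sigma_cylinders_measurable (@recurrent_tail [::]).
have rr : pr P rec = pr P rec * pr P rec.
  rewrite -{1}(setIid rec).
  apply: (@independent_sigma R V G d Omega P U p [set e | e \notin [::]]) => //;
    last exact: recurrent_tail.
  move=> _ [s Hs ->].
  apply: (@independent_cylinders _ _ G _ _ _ _ Uiid p p01 [set e | e \notin s]
    [set e | e \in s]).
  - by move=> e /negP.
  - exact: recurrent_tail.
  - by apply: sub_gen_smallest; exists s => // e es; have [ee _] := Hs e es.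
have [z|nz] := eqVneq (pr P rec) 0; [right|left].
  have : pr P (~` rec) = 1; last by move/(pr_ae P (measurableC mr)).
  by rewrite pr_setC // z subr0.
apply/(pr_ae P mr); apply: (mulfI nz); by rewrite mulr1 -rr.
Qed.

End ZeroOne.

(** * Closed cutsets and virtually cyclic groups *)

Section Cutsets.
Variables (R : realType) (V : choiceType) (G : graph V).
Variables (d : measure_display) (Omega : measurableType d).
Variable P : probability Omega R.
Variable U : set V -> {RV P >-> R}.
Hypothesis Uiid : iid_uniform G U.
Variable p : R.
Hypothesis p01 : 0 <= p < 1.

Let p01' : 0 <= p <= 1. Proof. by case/andP: p01 => -> /ltW. Qed.

Let closed (s : seq (set V)) := [set w | forall e, e \in s -> ~ open_edge U p w e].

Lemma sigma_closed (s : seq (set V)) : (forall e, e \in s -> edges G e) ->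
  <<s cylinders G U p [set e | e \in s] >> (closed s).
Proof.
move=> se.
have H (t : seq (set V)) : {subset t <= s} -> (closed t) =
    ~` \bigcup_(e in [set` t]) [set w | open_edge U p w e].
  move=> ts; apply/seteqP; split=> w /=.
    by move=> H [e /= et oe]; exact: H oe.
  by move=> H e et oe; apply: H; exists e.
rewrite (H s) //; apply: (@measurableC _ (g_sigma_algebraType (cylinders G U p [set e | e \in s]))).
apply: fin_bigcup_measurable => [|e /= es]; first exact: finite_seq.
apply: sub_gen_smallest; exists [:: e].
  by move=> e'; rewrite inE => /eqP ->; split=> //; exact: se.
apply/seteqP; split=> w /=; first by move=> He e'; rewrite inE => /eqP ->.
by apply; rewrite mem_head.
Qed.

(** Each block is closed with probability at least (1 - p)^M, independently of
    the previous ones. *)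
Lemma some_block_closed (K : nat -> seq (set V)) M :
  (forall m e, e \in K m -> edges G e) -> (forall m, (size (K m) <= M)%N) ->
  (forall m, uniq (K m)) ->
  (forall m m' e, e \in K m -> e \in K m' -> m = m') ->
  {ae P, forall w, exists m, closed (K m) w}.
Proof.
move=> Ke KM uK Kdis; case/andP: p01 => p0 p1.
have q01 : 0 <= 1 - p <= 1 by rewrite subr_ge0 ltW //= gerBl.
pose k := (1 - p) ^+ M.
have k01 : 0 < k <= 1 by rewrite exprn_gt0 ?subr_gt0 //= exprn_ile1 //; case/andP: q01.
pose I n : set (set V) := [set e | exists2 m, (m < n)%N & e \in K m].
pose D n : set Omega := [set w | forall m, (m < n)%N -> ~ closed (K m) w].
have mono (J J' : set (set V)) : J `<=` J' ->
    <<s cylinders G U p J >> `<=` <<s cylinders G U p J' >>.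
  move=> IJ; apply: (@sub_sigma_algebra2 Omega setT) => _ [s Hs ->]; exists s => // e es.
  by have [ee Ie] := Hs e es; split=> //; exact: IJ.
have DS n : D n.+1 = D n `&` ~` closed (K n).
  apply/seteqP; split=> w /=.
    by move=> H; split=> [m mn|]; apply: H => //; exact: leqW.
  move=> [H1 H2] m; rewrite ltnS leq_eqVlt => /orP[/eqP -> //|]; exact: H1.
have sD n : <<s cylinders G U p (I n) >> (D n).
  elim: n => [|n IH].
    rewrite (_ : D 0 = setT); last by apply/seteqP; split=> w.
    exact: (@measurableT _ (g_sigma_algebraType (cylinders G U p (I 0)))).
  rewrite DS.
  apply: (@measurableI _ (g_sigma_algebraType (cylinders G U p (I n.+1)))).
    by apply: mono IH => e [m mn em]; exists m => //; exact: leqW.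
  apply: (@measurableC _ (g_sigma_algebraType (cylinders G U p (I n.+1)))).
  have := sigma_closed (Ke n); apply: mono => e /= en; by exists n.
have mD n : measurable (D n) := sigma_cylinders_measurable (sD n).
have mcl n : measurable (closed (K n)) := sigma_cylinders_measurable (sigma_closed (Ke n)).
have prD n : pr P (D n) <= (1 - k) ^+ n.
  elim: n => [|n IH]; first by rewrite expr0 pr_le1.
  rewrite exprSr.
  have ind : pr P (D n `&` closed (K n)) = pr P (D n) * pr P (closed (K n)).
    apply: (independent_cylinders Uiid p01' _ (sD n) (sigma_closed (Ke n))).
    move=> e [m mn em] /= en.
    by move: mn; rewrite (Kdis _ _ _ em en) ltnn.
  have -> : pr P (D n.+1) = pr P (D n) * (1 - pr P (closed (K n))).
    rewrite DS mulrBr mulr1 -ind; have := pr_splitI P (mD n) (mcl n); lra.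
  apply: ler_pM => //; first exact: pr_ge0.
    by rewrite subr_ge0 pr_le1.
  rewrite lerD2l lerN2 (pr_all_closed Uiid p01') //; last exact: Ke.
  by apply: ler_wiXn2l => //; case/andP: q01.
have mcap : measurable (\bigcap_n D n) by exact: bigcapT_measurable.
have cap0 : pr P (\bigcap_n D n) = 0.
  apply/eqP; rewrite eq_le pr_ge0 andbT; apply/ler_addgt0Pr => e e0.
  have [|n Hn] := @expr_small R (1 - k) e _ e0.
    by case/andP: k01 => a b; rewrite subr_ge0 b gtrBl a.
  rewrite add0r; apply: le_trans Hn; apply: le_trans (prD n).
  by apply: pr_le => // w; apply.
have : pr P (~` \bigcap_n D n) = 1 by rewrite pr_setC // cap0 subr0.
move/(pr_ae P (measurableC mcap)); apply: filterS => w H.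
by apply: contrapT => K'; apply: H => n _ m _ Hm; apply: K'; exists m.
Qed.

Section Lipschitz.
Variables (phi : V -> int) (L N : nat) (F : int -> seq V).
Hypothesis L0 : (0 < L)%N.
Hypothesis lip : forall x y, adj G x y -> (`|phi x - phi y| <= L)%N.
Hypothesis mem_F : forall x a, (x \in F a) = (phi x == a).
Hypothesis size_F : forall a, (size (F a) <= N)%N.

Let slab (a : int) := flatten [seq F (a - L%:Z + i%:Z)%R | i <- iota 0 (2 * L)].

Let mem_slab a x : (x \in slab a) = (a - L%:Z <= phi x < a + L%:Z)%R.
Proof.
apply/flatten_mapP/andP => [[i]|[h1 h2]].
  by rewrite mem_iota mem_F => /andP[_ iL] /eqP ->; split; lia.
by exists (absz (phi x - (a - L%:Z))%R); rewrite ?mem_iota ?mem_F; lia.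
Qed.

Let size_slab a : (size (slab a) <= 2 * L * N)%N.
Proof.
rewrite /slab size_flatten /shape -map_comp sumnE big_map.
apply: (@leq_trans (\sum_(i <- iota 0 (2 * L)) N)).
  by apply: leq_sum => i _; exact: size_F.
by rewrite big_const_seq count_predT size_iota iter_addn_0 mulnC.
Qed.

Let cut a := undup [seq e <- [seq [set x; y] | x <- slab a, y <- slab a] | `[< edges G e >]].

Let mem_cut a u v : adj G u v -> (phi u < a)%R -> (a <= phi v)%R -> [set u; v] \in cut a.
Proof.
move=> uv ua va; rewrite mem_undup mem_filter asboolT /=; last exact: edge_adj.
have Huv := lip uv.
by apply: allpairs_f; rewrite mem_slab; move: ua va Huv L0; clear; lia.
Qed.

(** The edges across a level a join vertices with coordinates within L of a,
    so the cuts at levels 2 L apart are disjoint and of bounded size. *)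
Lemma closed_cut_above (n : nat) :
  {ae P, forall w, exists a : int, (n%:Z <= a)%R /\ forall u v, adj G u v ->
     (phi u < a)%R -> (a <= phi v)%R -> ~ open_edge U p w [set u; v]}.
Proof.
pose a m : int := (n%:Z + (2 * L * m)%N%:Z)%R.
have H : {ae P, forall w, exists m, closed (cut (a m)) w}.
  apply: (@some_block_closed (fun m => cut (a m)) ((2 * L * N) * (2 * L * N))).
  - by move=> m e; rewrite mem_undup mem_filter => /andP[/asboolP].
  - move=> m; apply: leq_trans (size_undup _) _; rewrite size_filter.
    apply: leq_trans (count_size _ _) _; rewrite size_allpairs.
    by apply: leq_mul; exact: size_slab.
  - by move=> m; exact: undup_uniq.
  - move=> m m' e; rewrite !mem_undup !mem_filter => /andP[_ /allpairsP[[x y] /= [xs _ ->]]].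
    move=> /andP[_ /allpairsP[[x' y'] /= [xs' ys' E]]].
    have : [set x'; y'] x by rewrite -E; left.
    have key z : z \in slab (a m') -> x = z -> m = m'.
      move=> zs xz; move: xs zs; rewrite -xz !mem_slab /a; clear -L0.
      move=> /andP[h1 h2] /andP[h3 h4].
      have h5 : (2 * L * m < 2 * L * m'.+1)%N by rewrite mulnSr; lia.
      have h6 : (2 * L * m' < 2 * L * m.+1)%N by rewrite mulnSr; lia.
      have L2 : (0 < 2 * L)%N by rewrite muln_gt0.
      by move: h5 h6; rewrite !ltn_pmul2l // !ltnS; clear; lia.
    by move=> [/= xx|/= xy]; [exact: (key x')|exact: (key y')].
apply: filterS H => w [m Hm]; exists (a m); split; first by rewrite /a; lia.
by move=> u v uv ua va; apply: Hm; exact: mem_cut.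
Qed.

End Lipschitz.

(** A closed cut on either side confines a cluster to finitely many fibres. *)
Lemma no_infinite_cluster (phi : V -> int) (L N : nat) (F : int -> seq V) :
  (0 < L)%N -> (forall x y, adj G x y -> (`|phi x - phi y| <= L)%N) ->
  (forall x a, (x \in F a) = (phi x == a)) -> (forall a, (size (F a) <= N)%N) ->
  {ae P, forall w, ~ exists x, infinite_set (open_cluster G U p w x)}.
Proof.
move=> L0 lip memF sizeF.
have up := fun n => @closed_cut_above phi L N F L0 lip memF sizeF n.
have dn : forall n : nat, {ae P, forall w, exists a : int, (n%:Z <= a)%R /\
    forall u v, adj G u v ->
     (- phi u < a)%R -> (a <= - phi v)%R -> ~ open_edge U p w [set u; v]}.
  apply: (@closed_cut_above (fun x => - phi x)%R L N (fun a => F (- a)%R)) => //.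
    by move=> x y xy; have := lip x y xy; lia.
  by move=> x a; rewrite memF; lia.
have cross w (psi : V -> int) (a : int) x y :
   (forall u v, adj G u v -> (psi u < a)%R -> (a <= psi v)%R ->
     ~ open_edge U p w [set u; v]) -> (psi x < a)%R ->
   open_cluster G U p w x y -> (psi y < a)%R.
  move=> H xa [s []]; elim: s x xa => [|z s IH] x xa /=; first by move=> _ <-.
  move=> /andP[/andP[xz oz] zs] sy; apply: (IH z) => //.
  rewrite ltNge; apply/negP => az; exact: (H x z xz xa az oz).
have := (ae_foralln up); have := (ae_foralln dn).
apply: filterS2 => w Hdn Hup [x]; apply.
have [a [na Ha]] := Hup (absz (phi x)).+1.
have [b [nb' Hb]] := Hdn (absz (phi x)).+1.
pose sq := flatten [seq F (i%:Z - b)%R | i <- iota 0 (absz (a + b)%R).+1].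
apply: (@sub_finite_set _ _ [set` sq]); last exact: finite_seq.
move=> y xy; suff : y \in sq by [].
have ya : (phi y < a)%R by apply: (cross w phi a x y Ha) => //; lia.
have yb : (- phi y < b)%R by apply: (cross w (fun x => - phi x)%R b x y Hb) => //; lia.
apply/flatten_mapP; exists (absz (phi y + b)%R); first by rewrite mem_iota; lia.
by rewrite memF; lia.
Qed.

End Cutsets.

Section VirtuallyZ.
Variables (gT : groupType) (S : set gT).
Hypotheses (Sfin : finite_set S) (Sgen : generates S).

Local Notation G := (cayley_graph S).

Lemma cayley_adjP x y : adj G x y <-> x <> y /\ exists2 s, S s & (y = x * s)%g \/ (x = y * s)%g.
Proof. by split=> [/asboolP|H]; [|apply/asboolP]. Qed.

Lemma cayley_adj_mul g x y : adj G (g * x)%g (g * y)%g = adj G x y.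
Proof.
apply/idP/idP => /cayley_adjP[xy [s Ss H]]; apply/cayley_adjP; split.
- by move=> e; apply: xy; rewrite e.
- by exists s => //; case: H => /eqP; rewrite -mulgA => /eqP/mulgI ->; [left|right].
- by move=> /mulgI.
- by exists s => //; rewrite -!mulgA; case: H => ->; [left|right].
Qed.

Lemma cayley_path_mul g x p : path (adj G) x p ->
  path (adj G) (g * x)%g [seq (g * y)%g | y <- p].
Proof.
rewrite path_map; apply: sub_path => u v uv.
by have := cayley_adj_mul g u v; rewrite uv => H; exact: H.
Qed.

Lemma cayley_connected : connected_graph G.
Proof.
pose H : set gT := [set x | exists p, path (adj G) 1%g p /\ last 1%g p = x].
have HT : H = setT.
  apply: Sgen => [|s Ss]; last first.
    have [->|s1] := eqVneq s 1%g; first by exists [::].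
    exists [:: s]; rewrite /= andbT; split=> //; apply/cayley_adjP.
    by split; [exact/nesym/eqP|exists s => //; left; rewrite mul1g].
  split; first by exists [::].
  move=> x y [q [q1 qx]] [r [r1 ry]].
  have := cayley_path_mul y^-1%g (path_revG r1); rewrite ry mulVg => r2.
  have := cayley_path_mul x r2; rewrite mulg1 => r3.
  exists (q ++ [seq (x * z)%g | z <- [seq (y^-1 * z)%g | z <- rev (belast 1%g r)]]).
  rewrite cat_path q1 qx r3 last_cat qx; split=> //.
  have e1 : last y (rev (belast 1%g r)) = 1%g by rewrite -{1}ry last_rev_belast.
  have e2 : last 1%g [seq (y^-1 * z)%g | z <- rev (belast 1%g r)] = y^-1%g.
    have := last_map (fun z => y^-1 * z)%g (rev (belast 1%g r)) y.
    by rewrite e1 mulVg mulg1.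
  have := last_map (fun z => x * z)%g [seq (y^-1 * z)%g | z <- rev (belast 1%g r)] 1%g.
  by rewrite e2 mulg1.
move=> x y; have [p [p1 py]] : H (x^-1 * y)%g by rewrite HT.
exists [seq (x * z)%g | z <- p]; have := cayley_path_mul x p1; rewrite mulg1 => ->.
split=> //; have := last_map (fun z => x * z)%g p 1%g.
by rewrite py mulg1 mulgA mulgV mul1g.
Qed.

Lemma cayley_locally_finite : locally_finite G.
Proof.
have /finite_seqP[s Ss] := Sfin.
move=> x; apply: (@sub_finite_set _ _ [set` [seq (x * t)%g | t <- s] ++ [seq (x * t^-1)%g | t <- s]]).
  move=> y /= /cayley_adjP[_ [t]]; rewrite Ss /= => ts H; rewrite mem_cat.
  case: H => [->|->]; first by rewrite map_f.
  by apply/orP; right; apply/mapP; exists t => //; rewrite mulgK.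
exact: finite_seq.
Qed.

Lemma cayley_quasi_transitive : quasi_transitive G.
Proof.
apply: (@sub_finite_set _ _ [set setT]); last exact: finite_set1.
move=> _ [x _ <-] /=; apply/seteqP; split=> // y _.
exists (fun z => (y * x^-1 * z)%g); last by rewrite -mulgA mulVg mulg1.
split; last by move=> u v; exact: cayley_adj_mul.
split=> //; first by move=> u v _ _ /mulgI.
by move=> u _; exists ((y * x^-1)^-1 * u)%g => //; rewrite mulgA mulgV mul1g.
Qed.

Hypothesis VZ : virtually_Z gT.

Lemma virtually_Z_infinite : infinite_set [set: gT].
Proof.
have [H [_ _ [f [[_ fi _] _]]]] := VZ => fin.
have : finite_set [set: int] by apply: (finite_preimage (f := f)) fin => x y *; exact: fi.
have inf : infinite_set [set: int].
  move=> /finite_seqP[s Hs].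
  have [m Hm] : exists m : nat, forall x : int, x \in s -> (`|x| < m)%N.
    exists (\max_(x <- s) `|x|%N).+1 => x xs; by rewrite ltnS (big_rem x) //= leq_maxl.
  have : [set: int] m%:Z by [].
  by rewrite Hs => /Hm; rewrite ltnn.
exact: inf.
Qed.

(** Write x = f(m) r^-1 with r from a finite list, and let m be the
    coordinate. The element r is chosen as a function of the coset x^-1 H, so
    left multiplication by f(n) shifts the coordinate by n; right
    multiplication by a generator therefore changes it by one of finitely many
    amounts. *)
Lemma virtually_Z_coordinate : exists (phi : gT -> int) (L N : nat) (F : int -> seq gT),
  [/\ (0 < L)%N, forall x y, adj G x y -> (`|phi x - phi y| <= L)%N,
   forall x a, (x \in F a) = (phi x == a) & forall a, (size (F a) <= N)%N].
Proof.
have [H [[H1 HM] /finite_seqP[cs Hcs] [f [[fH fi fs] fM]]]] := VZ.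
have /finite_seqP[s Ss] := Sfin.
have f0 : f 0 = 1%g.
  by apply: (@mulgI _ (f 0)); rewrite -fM addr0 mulg1.
pose coset x := [set (x * h)%g | h in H].
have HV x : H x -> H x^-1%g by move=> Hx; have := HM _ _ H1 Hx; rewrite mul1g.
have HMul x y : H x -> H y -> H (x * y)%g.
  by move=> Hx Hy; have := HM _ _ Hx (HV _ Hy); rewrite invgK.
have coset_mul x h : H h -> coset (x * h)%g = coset x.
  move=> Hh; apply/seteqP; split=> _ [k Hk <-].
    by exists (h * k)%g; [exact: HMul|rewrite mulgA].
  by exists (h^-1 * k)%g; [apply: HMul => //; exact: HV|rewrite mulgA mulgK].
pose pick C : gT := xget 1%g C.
(* Cosets are nonempty, so the default value of the choice is never taken. *)
pose rho x := pick (coset x^-1%g).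
have rhoP x : H (x * rho x)%g.
  have [h Hh e] : coset x^-1%g (rho x).
    by apply: (@xgetI _ 1%g _ x^-1%g); exists 1%g => //; rewrite mulg1.
  by rewrite -e mulgA mulgV mul1g.
pose rs := [seq pick C | C <- cs].
have rho_in x : rho x \in rs.
  apply: map_f; have : [set` cs] (coset x^-1%g) by rewrite -Hcs; exists x^-1%g.
  by [].
pose psi h : int := xget 0 [set n | f n = h].
have psiP h : H h -> f (psi h) = h.
  move=> Hh; have [n _ e] := fs h Hh.
  exact: (@xgetI _ 0 [set n | f n = h] n e).
have psif n : psi (f n) = n by apply: fi; rewrite ?inE // psiP //; exact: fH.
pose phi x := psi (x * rho x)%g.
have xE x : x = (f (phi x) * (rho x)^-1)%g by rewrite psiP // mulgK.
have phi_mul n x : phi (f n * x)%g = n + phi x.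
  have rE : rho (f n * x)%g = rho x.
    by rewrite /rho invgM coset_mul //; apply: HV; exact: fH.
  by rewrite /phi rE -[RHS]psif fM psiP // mulgA.
pose L := (\max_(r <- rs) \max_(t <- s) `|phi (r^-1 * t)%g|%N).+1.
have lip1 x t : t \in s -> (`|phi x - phi (x * t)%g| <= L)%N.
  move=> ts; rewrite {2}(xE x) -mulgA phi_mul opprD addNKr abszN.
  rewrite /L leqW // (big_rem (rho x)) //= (leq_trans _ (leq_maxl _ _)) //.
  by rewrite (big_rem t) //= leq_maxl.
exists phi, L, (size rs), (fun a => [seq x <- undup [seq (f a * r^-1)%g | r <- rs] | phi x == a]).
split=> //.
- move=> x y /cayley_adjP[_ [t]]; rewrite Ss /= => ts [->|->]; first exact: lip1.
  by rewrite distnC; exact: lip1.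
- move=> x a; rewrite mem_filter; case: eqVneq => //= <-.
  by rewrite mem_undup {1}(xE x); apply/mapP; exists (rho x).
- move=> a; rewrite size_filter (leq_trans (count_size _ _)) //.
  by rewrite (leq_trans (size_undup _)) // size_map.
Qed.

End VirtuallyZ.

(** * The phase transition *)

Lemma scaling_probability (R : realType) (m l : R) : 0 < m < l ->
  exists2 p, 0 < p < 1 & m < p * l.
Proof.
move=> /andP[m0 ml]; have l0 : 0 < l by exact: lt_trans ml.
have r0 : 0 < m / l by exact: divr_gt0.
have r1 : m / l < 1 by rewrite ltr_pdivrMr // mul1r.
exists ((m / l + 1) / 2); first by apply/andP; split; lra.
have -> : (m / l + 1) / 2 * l = (m + l) / 2 by field; rewrite gt_eqF.
lra.
Qed.

Section PhaseTransition.
Variables (R : realType) (V : choiceType) (G : graph V) (nb : V -> seq V) (o : V).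
Hypothesis Gconn : connected_graph G.
Hypothesis Vinf : infinite_set [set: V].
Hypotheses (nb_uniq : forall x, uniq (nb x)).
Hypotheses (mem_nb : forall x y, (y \in nb x) = adj G x y).
Variable D : nat.
Hypothesis hom : homogeneous G nb o D.
Variables (d : measure_display) (Omega : measurableType d).
Variable P : probability Omega R.
Variable U : set V -> {RV P >-> R}.
Hypothesis Uiid : iid_uniform G U.

Local Notation growth := (growth G nb o).
Local Notation C := (@Clambda R V G o).

Let noiso : no_isolated nb.
Proof. exact: no_isolated_infinite Gconn mem_nb Vinf. Qed.

Let recP (c : set V -> R) : positive G c ->
  recurrent G c <-> forall x, null_energy G nb c x.
Proof. exact: recurrentP. Qed.

Lemma Clambda_growth_recurrent (l l' : R) : growth l' -> 1 < l -> 0 <= l' < l ->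
  recurrent G (C l).
Proof.
move=> gl l1 ll; have l0 : 0 < l by exact: lt_trans l1.
apply/recP => [|x]; first exact: positive_Clambda.
apply: (null_energy_cut Gconn nb_uniq mem_nb x (positive_Clambda o l0) hom gl l1 ll) => n.
by exists (ball G nb o n); split.
Qed.

Lemma Clambda_transient_lt1 (l : R) : 0 < l < 1 -> transient G (C l).
Proof.
move=> l01; have /andP[l0 _] := l01 => /(recP (positive_Clambda o l0)) H.
exact: (ray_energy Gconn nb_uniq mem_nb Vinf l01).
Qed.

Lemma lambda_c_ub (l : R) : 0 < l -> transient G (C l) -> (l%:E <= lambda_c R G o)%E.
Proof. by move=> l0 tl; apply: ereal_sup_ubound; exists l. Qed.

Lemma recurrent_above (l : R) : 0 < l -> (lambda_c R G o < l%:E)%E -> recurrent G (C l).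
Proof.
move=> l0 ll; apply: contrapT => tl.
by have := lambda_c_ub l0 tl; rewrite leNgt ll.
Qed.

(** Above lambda_c the network is recurrent, so by percolation on the tree
    with equal conductances for open and closed edges it cannot have faster
    growth; lambda_c >= 1 because of geodesic rays. *)
Lemma growth_above (l2 : R) : (lambda_c R G o < l2%:E)%E ->
  1 < l2 /\ exists l', 0 <= l' < l2 /\ growth l'.
Proof.
move=> ll2.
have lt1 (l : R) : 0 < l < 1 -> l < l2.
  move=> l01; have /andP[l0 _] := l01.
  rewrite -lte_fin; apply: le_lt_trans ll2.
  exact: lambda_c_ub l0 (Clambda_transient_lt1 l01).
have [r rE] : exists r : R, lambda_c R G o = r%:E.
  have h : ((2^-1)%:E <= lambda_c R G o)%E.
    apply: lambda_c_ub; first by rewrite invr_gt0.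
    by apply: Clambda_transient_lt1; apply/andP; split; lra.
  by case: (lambda_c R G o) ll2 h => [r| |] //; exists r.
rewrite rE lte_fin in ll2.
have r1 : 1 <= r.
  rewrite leNgt; apply/negP => r1.
  have h : 2^-1 <= r.
    rewrite -lee_fin -rE; apply: lambda_c_ub; first by rewrite invr_gt0.
    by apply: Clambda_transient_lt1; apply/andP; split; lra.
  have : (((r + 1) / 2)%:E <= lambda_c R G o)%E.
    apply: lambda_c_ub; first lra.
    by apply: Clambda_transient_lt1; apply/andP; split; lra.
  by rewrite rE lee_fin; lra.
split; first lra.
(* Two intermediate values: C_a is recurrent, and the growth is compared
   with l' > a. *)
pose a := (r + l2) / 2; pose l' := (a + l2) / 2.
have a1 : 1 < a by rewrite /a; lra.
have al' : a < l' by rewrite /l' /a; lra.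
have l'l2 : l' < l2 by rewrite /l' /a; lra.
exists l'; split; first by apply/andP; split; lra.
apply: contrapT => ngr.
have l'0 : 0 < l' by lra.
have a0 : 0 < a by lra.
have [|p p01 apl] := @scaling_probability R a l'; first by rewrite a0.
apply: (@tree_percolation_transient R V G nb o Gconn nb_uniq mem_nb d Omega P U Uiid
  l' a p (C a) D hom ngr) => //.
- exact: lt_trans al'.
- exact: lt_trans apl.
- exact: positive_Clambda.
apply: aeW => w.
have -> : disordered U (C a) (C a) p w = C a.
  by apply/funext => e; rewrite /disordered; case: ifP.
have ra : r < a by rewrite /a; lra.
have /(recP (positive_Clambda o a0)) : recurrent G (C a); last exact.
by apply: recurrent_above => //; rewrite rE lte_fin.
Qed.

Section Network.
Variables (l1 l2 : R).
Hypotheses (l10 : 0 < l1) (l12 : l1 <= l2).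

Let l20 : 0 < l2. Proof. exact: lt_le_trans l12. Qed.

Local Notation network p w := (disordered U (C l1) (C l2) p w).

Let network_pos p w : positive G (network p w).
Proof.
move=> e ee; rewrite /disordered.
by case: ifP => _; exact: positive_Clambda.
Qed.

Lemma recurrent_mono p q w : p <= q -> recurrent G (network q w) ->
  recurrent G (network p w).
Proof.
move=> pq /(recP (network_pos q w)) H; apply/(recP (network_pos p w)) => x.
apply: (@null_energy_le _ _ _ _ _ _ 1) (H x) => // e ee; rewrite mul1r.
rewrite /disordered.
have le21 : C l2 e <= C l1 e.
  by rewrite /Clambda lef_pV2 ?posrE ?exprn_gt0 // lerXn2r // nnegrE ltW.
case: ifP => op; case: ifP => oq //.
by move: oq; rewrite /open_edge (le_trans op pq).
Qed.

(** The union of the clusters that meet a ball is finite, and edges leaving it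
    are closed. *)
Lemma finite_clusters_recurrent p w : (lambda_c R G o < l2%:E)%E ->
  ~ (exists x, infinite_set (open_cluster G U p w x)) -> recurrent G (network p w).
Proof.
move=> ll2 fin; have [l21 [l' [ll gl]]] := growth_above ll2.
apply/(recP (network_pos p w)) => x.
apply: (null_energy_cut Gconn nb_uniq mem_nb x (network_pos p w) hom gl l21 ll) => n.
have finU : finite_set (\bigcup_(v in [set` ball G nb o n]) open_cluster G U p w v).
  apply: bigcup_finite => [|v _]; first exact: finite_seq.
  by apply: contrapT => H; apply: fin; exists v.
have /finite_seqP[A AE] := finU.
have memA v : v \in A <-> (exists2 u, u \in ball G nb o n & open_cluster G U p w u v).
  split=> [vA|[u ub uv]].
    have : [set` A] v by [].
    by rewrite -AE => -[u /= ub uv]; exists u.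
  have : [set` A] v by rewrite -AE; exists u.
  by [].
exists A; split=> [v vb|u v uA vA uv].
  by apply/memA; exists v => //; exists [::].
rewrite /disordered; case: ifP => // op; case/negP: vA.
have [z zb [s [zs su]]] := (memA u).1 uA.
apply/memA; exists z => //; exists (rcons s v).
by rewrite rcons_path last_rcons zs su uv op.
Qed.

(** Charging each edge of a path to its second endpoint v gives resistance at
    most l1^(|v| - 1), and these are summable over all vertices. *)
Lemma infinite_cluster_transient p w l' : growth l' -> 0 <= l' < l1^-1 -> l1 < 1 ->
  (exists x, infinite_set (open_cluster G U p w x)) -> transient G (network p w).
Proof.
move=> gl ll l11 [x inf] /(recP (network_pos p w))/(_ x).
have i0 : 0 < l1^-1 by rewrite invr_gt0.
have [K [r [K0 r01 tail]]] := growth_tail Gconn nb_uniq mem_nb gl i0 ll.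
pose rr v := l1 ^+ (height G o v) / l1.
apply: (@infinite_cluster_energy R V G nb mem_nb (network p w)
  (fun u v => adj G u v && open_edge U p w [set u; v]) x rr (K / l1)) => //.
- by move=> u v /andP[].
- by move=> v; rewrite /rr divr_ge0 ?exprn_ge0 // ltW.
- move=> s us; rewrite /rr -mulr_suml ler_wpM2r ?(ltW i0) //.
  have := tail 0%N s us (fun v _ => leq0n _); rewrite expr0 mulr1; apply: le_trans.
  by rewrite le_eqVlt; apply/orP; left; apply/eqP; apply: eq_bigr => v _; rewrite exprVn invrK.
- move=> u v /andP[uv op]; rewrite /disordered op /Clambda /rr.
  rewrite edge_height2 // -/(height G o u) -/(height G o v).
  have hv : (height G o v <= (minn (height G o u) (height G o v)).+1)%N.
    have : (height G o v <= (height G o u).+1)%N by apply: dist_adj_le => //; rewrite adj_sym.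
    by move: (height G o u) (height G o v) => a b; clear; lia.
  rewrite -mulrA -invfM -exprS ler_pdivlMr ?mul1r ?exprn_gt0 //.
  by rewrite ler_wiXn2l // ltW.
Qed.

Let pcset := [set p : R | 0 <= p <= 1 /\
  {ae P, forall w, ~ exists x, infinite_set (open_cluster G U p w x)}].

Let pstarset := [set p : R | 0 <= p <= 1 /\
  {ae P, forall w, forall q, 0 <= q < p -> recurrent G (network q w)}].

Lemma pstarset_has_sup : has_sup pstarset.
Proof.
split; last by exists 1 => p [/andP[]].
exists 0; split; first by rewrite lexx ler01.
by apply: aeW => w q /andP[q0 q1]; lra.
Qed.

Lemma pcset_le_pstar p : (lambda_c R G o < l2%:E)%E -> pcset p ->
  p <= p_c_star G U o l1 l2.
Proof.
move=> ll2 [p01 H]; apply: ub_le_sup; first by have [] := pstarset_has_sup.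
split=> //; apply: filterS H => w fin q /andP[q0 qp].
by apply: recurrent_mono (ltW qp) _; exact: finite_clusters_recurrent.
Qed.

Lemma pc_le_pstar : (lambda_c R G o < l2%:E)%E -> 0 < p_c G U ->
  p_c G U <= p_c_star G U o l1 l2.
Proof.
move=> ll2 pc0; apply: ge_sup; last by move=> p; exact: pcset_le_pstar.
apply/set0P/negP => /eqP e; move: pc0.
by rewrite /p_c e sup0 ltxx.
Qed.

Lemma pstar_le p : 0 <= p -> ~ {ae P, forall w, recurrent G (network p w)} ->
  p_c_star G U o l1 l2 <= p.
Proof.
move=> p0 H; apply: ge_sup; first by have [] := pstarset_has_sup.
move=> q [/andP[q0 q1] Hq]; rewrite leNgt; apply/negP => pq; apply: H.
by apply: filterS Hq => w; apply; rewrite p0.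
Qed.

(** If some C_mu with mu > max(1, l1) is transient, the growth rate is at
    least mu and percolation on the tree applies. Otherwise lambda_c <= 1,
    hence l1 < 1, and any infinite cluster is transient. *)
Lemma exists_transient_parameter : 0 < p_c G U < 1 -> (l1%:E < lambda_c R G o)%E ->
  exists2 p, 0 <= p < 1 & ~ {ae P, forall w, recurrent G (network p w)}.
Proof.
move=> /andP[pc0 pc1] ll1.
have [[mu [mu1 mul1 tmu]]|none] := pselect (exists mu : R,
    [/\ 1 < mu, l1 < mu & transient G (C mu)]).
  pose m := Num.max 1 l1; pose l := (m + mu) / 2.
  have m1 : 1 <= m by rewrite le_max lexx.
  have lm : l1 <= m by rewrite le_max lexx orbT.
  have mmu : m < mu by rewrite gt_max mu1.
  have ngr : ~ growth l.
    move=> gl; apply: tmu; apply: (Clambda_growth_recurrent gl mu1).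
    by apply/andP; rewrite /l; split; lra.
  have l0 : 0 < l by rewrite /l; lra.
  have ml : m < l by rewrite /l; lra.
  have m0 : 0 < m by exact: lt_le_trans m1.
  have [|p p01 mpl] := @scaling_probability R m l; first by rewrite m0.
  have /andP[p0 p1] := p01; exists p; first by rewrite (ltW p0).
  move=> H; apply: (@tree_percolation_transient R V G nb o Gconn nb_uniq mem_nb d
    Omega P U Uiid l l1 p (C l2) D hom ngr) => //.
  - exact: le_lt_trans ml.
  - exact: le_lt_trans mpl.
  - exact: le_lt_trans mpl.
  - exact: positive_Clambda.
  - by apply: filterS H => w /(recP (network_pos p w)); exact.
have lc1 : (lambda_c R G o <= 1)%E.
  apply: ub_ereal_sup => _ [mu [mu0 tmu] <-]; rewrite lee_fin leNgt; apply/negP => mu1.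
  have [lmu|mul] := ltP l1 mu; first by apply: none; exists mu.
  have [_ [nu [nu0 tnu] <-]] := ereal_sup_gt ll1.
  rewrite lte_fin => l1nu; apply: none; exists nu; split=> //.
  exact: lt_trans mu1 (le_lt_trans mul l1nu).
have l11 : l1 < 1 by rewrite -lte_fin; exact: lt_le_trans lc1.
have i1 : (1 < (l1^-1)%:E :> \bar R)%E by rewrite lte_fin invf_gt1.
have [_ [l' [ll gl]]] := growth_above (le_lt_trans lc1 i1).
pose p := (p_c G U + 1) / 2.
exists p; first by rewrite /p; apply/andP; split; lra.
move=> H; have : pcset p.
  split; first by rewrite /p; apply/andP; split; lra.
  apply: filterS H => w rw inf; exact: (infinite_cluster_transient gl ll l11 inf) rw.
have ubc : has_ubound pcset by exists 1 => q [/andP[]].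
by move=> /(ub_le_sup ubc); rewrite -/(p_c G U) /p; lra.
Qed.

(** Recurrence for all smaller q is part of the definition of the threshold;
    just above it, recurrence with positive probability would be almost sure
    by the zero-one law, contradicting the supremum. *)
Lemma sharp_threshold : {ae P, forall w, forall p, 0 <= p <= 1 ->
   (p < p_c_star G U o l1 l2 -> recurrent G (network p w)) /\
   (p_c_star G U o l1 l2 < p -> transient G (network p w))}.
Proof.
set ps := p_c_star G U o l1 l2.
have inv_small (e : R) : 0 < e -> exists n : nat, n.+1%:R^-1 < e.
  move=> e0; exists (Num.truncn e^-1); rewrite -[ltRHS]invrK ltf_pV2 ?posrE ?invr_gt0 //.
  exact: truncnS_gt.
have below n : {ae P, forall w, forall q, 0 <= q <= ps - n.+1%:R^-1 ->
    recurrent G (network q w)}.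
  have [|p [p01 Hp] pn] := @sup_adherent R pstarset n.+1%:R^-1 _ pstarset_has_sup.
    by rewrite invr_gt0 ltr0n.
  apply: filterS Hp => w H q /andP[q0 qn]; apply: H; rewrite q0 /=.
  exact: le_lt_trans pn.
have above n : {ae P, forall w, ps + n.+1%:R^-1 <= 1 ->
    transient G (network (ps + n.+1%:R^-1) w)}.
  set q := ps + _; have [q1|q1] := leP q 1; last by apply: aeW.
  have n0 : 0 < n.+1%:R^-1 :> R by rewrite invr_gt0 ltr0n.
  have ps0 : 0 <= ps.
    apply: ub_le_sup; first by have [] := pstarset_has_sup.
    split; first by rewrite lexx ler01.
    by apply: aeW => w r /andP[r0 r1]; lra.
  have q01 : 0 <= q <= 1 by rewrite q1 andbT /q addr_ge0 // ltW.
  have [H|H] := @recurrent_zero_one R V G nb o Gconn nb_uniq mem_nb noiso d Omega P U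
    Uiid q q01 (C l1) (C l2) (positive_Clambda o l10) (positive_Clambda o l20); last first.
    by apply: filterS H => w H _ /(recP (network_pos q w)).
  have : pstarset q.
    split=> //; apply: filterS H => w H r /andP[r0 rq].
    by apply: recurrent_mono (ltW rq) _; apply/(recP (network_pos q w)).
  have [_ ub] := pstarset_has_sup.
  move=> /(ub_le_sup ub) qps; have {}qps : q <= ps by exact: qps.
  by exfalso; move: qps; rewrite /q gerDl leNgt n0.
have := ae_foralln below; have := ae_foralln above.
apply: filterS2 => w Ha Hb p /andP[p0 p1]; split=> [pps|psp].
  have [|n Hn] := inv_small (ps - p); first by rewrite subr_gt0.
  by apply: (Hb n); rewrite p0 /= lerBrDr addrC -lerBrDr ltW.
have [|n Hn] := inv_small (p - ps); first by rewrite subr_gt0.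
have le_p : ps + n.+1%:R^-1 <= p by rewrite addrC -lerBrDr ltW.
move=> rp; apply: (Ha n); first exact: le_trans p1.
exact: recurrent_mono rp.
Qed.

End Network.

End PhaseTransition.

Lemma neighbour_lists (V : choiceType) (G : graph V) : locally_finite G ->
  exists nb : V -> seq V, (forall x, uniq (nb x)) /\
    forall x y, (y \in nb x) = adj G x y.
Proof.
move=> lf; have /choice[nb nbP] : forall x, exists s : seq V, uniq s /\
    forall y, (y \in s) = adj G x y.
  move=> x; have /finite_seqP[s Hs] := lf x.
  exists (undup s); split; first exact: undup_uniq.
  move=> y; rewrite mem_undup; apply/idP/idP => H.
    by have : [set` s] y by []; rewrite -Hs.
  have : [set y | adj G x y] y by [].
  by rewrite Hs.
by exists nb; split=> x; have [] := nbP x.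
Qed.

Lemma phase_transition (R : realType) (V : choiceType) (G : graph V) (o : V)
    (d : measure_display) (Omega : measurableType d)
    (P : probability Omega R) (U : set V -> {RV P >-> R}) (l1 l2 : R) :
  connected_graph G -> quasi_transitive G -> locally_finite G ->
  infinite_set [set: V] -> iid_uniform G U -> 0 < p_c G U < 1 -> 0 < l1 ->
  (l1%:E < lambda_c R G o)%E -> (lambda_c R G o < l2%:E)%E ->
  0 < p_c_star G U o l1 l2 < 1 /\
  {ae P, forall w, forall p, 0 <= p <= 1 ->
    (p < p_c_star G U o l1 l2 ->
       recurrent G (disordered U (Clambda G o l1) (Clambda G o l2) p w)) /\
    (p_c_star G U o l1 l2 < p ->
       transient G (disordered U (Clambda G o l1) (Clambda G o l2) p w))}.
Proof.
move=> Gc Gqt Glf Vinf Uiid pc01 l10 ll1 ll2; have /andP[pc0 _] := pc01.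
have [nb [nbu nbm]] := neighbour_lists Glf.
have [D hom] := quasi_transitive_homogeneous o Gc nbm Gqt.
have l12 : l1 <= l2 by rewrite -lee_fin; exact/ltW/(lt_trans ll1).
split; last exact: (sharp_threshold o Gc Vinf nbu nbm Uiid l10 l12).
rewrite (lt_le_trans pc0) /=; last exact: (pc_le_pstar Gc Vinf nbu nbm hom Uiid l10 l12).
have [p /andP[p0 p1] H] := exists_transient_parameter Gc Vinf nbu nbm hom Uiid l10 l12 pc01 ll1.
exact: le_lt_trans (pstar_le p0 H) p1.
Qed.

Lemma no_phase_transition (R : realType) (gT : groupType) (S : set gT) (o : gT)
    (d : measure_display) (Omega : measurableType d)
    (P : probability Omega R) (U : set gT -> {RV P >-> R}) (l1 l2 : R) :
  virtually_Z gT -> finite_set S -> generates S ->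
  iid_uniform (cayley_graph S) U -> 0 < l1 ->
  (l1%:E < lambda_c R (cayley_graph S) o)%E ->
  (lambda_c R (cayley_graph S) o < l2%:E)%E ->
  p_c_star (cayley_graph S) U o l1 l2 = 1 /\ p_c (cayley_graph S) U = 1.
Proof.
move=> VZ Sfin Sgen Uiid l10 ll1 ll2.
have Gc := cayley_connected Sgen.
have Vinf := virtually_Z_infinite VZ.
have [nb [nbu nbm]] := neighbour_lists (cayley_locally_finite Sfin).
have [D hom] := quasi_transitive_homogeneous o Gc nbm (cayley_quasi_transitive S).
have l12 : l1 <= l2 by rewrite -lee_fin; exact/ltW/(lt_trans ll1).
have [phi [L [N [F [L0 lip memF sizeF]]]]] := virtually_Z_coordinate Sfin VZ.
have fin p : 0 <= p < 1 ->
    {ae P, forall w, ~ exists x, infinite_set (open_cluster (cayley_graph S) U p w x)}.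
  by move=> p01; exact: (no_infinite_cluster Uiid p01 L0 lip memF sizeF).
have pc1 : p_c (cayley_graph S) U = 1.
  have ub : ubound [set p : R | 0 <= p <= 1 /\ {ae P, forall w,
      ~ exists x, infinite_set (open_cluster (cayley_graph S) U p w x)}] 1.
    by move=> p [/andP[]].
  apply/eqP; rewrite eq_le; apply/andP; split.
    apply: ge_sup => //; exists 0; split; first by rewrite lexx ler01.
    by apply: fin; rewrite lexx ltr01.
  apply/ler_addgt0Pr => e e0; rewrite -lerBlDr.
  have [e1|e1] := leP e 1.
    apply: ub_le_sup; first by exists 1.
    split; first by apply/andP; split; lra.
    by apply: fin; apply/andP; split; lra.
  apply: (@le_trans _ _ 0); first lra.
  apply: ub_le_sup; first by exists 1.
  split; first by rewrite lexx ler01.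
  by apply: fin; rewrite lexx ltr01.
split=> //; apply/eqP; rewrite eq_le; apply/andP; split.
  apply: ge_sup; first by have [] := @pstarset_has_sup R gT (cayley_graph S) o d Omega P U l1 l2.
  by move=> p [/andP[]].
by rewrite -pc1; apply: (pc_le_pstar Gc Vinf nbu nbm hom Uiid l10 l12) => //; rewrite pc1.
Qed.

Theorem theorem2p1 (R : realType) :
  (forall (V : Type) (G : graph V) (o : V)
      (d : measure_display) (Omega : measurableType d)
      (P : probability Omega R) (U : set V -> {RV P >-> R})
      (lambda1 lambda2 : R),
    connected_graph G -> quasi_transitive G -> locally_finite G ->
    infinite_set [set: V] ->
    iid_uniform G U ->
    0 < p_c G U < 1 ->
    0 < lambda1 ->
    (lambda1%:E < lambda_c R G o)%E -> (lambda_c R G o < lambda2%:E)%E ->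
    0 < p_c_star G U o lambda1 lambda2 < 1 /\
    {ae P, forall w, forall p, 0 <= p <= 1 ->
      (p < p_c_star G U o lambda1 lambda2 ->
       recurrent G
         (disordered U (Clambda G o lambda1) (Clambda G o lambda2) p w)) /\
      (p_c_star G U o lambda1 lambda2 < p ->
       transient G
         (disordered U (Clambda G o lambda1) (Clambda G o lambda2) p w))})
  /\
  (forall (gT : groupType) (S : set gT) (o : gT)
      (d : measure_display) (Omega : measurableType d)
      (P : probability Omega R) (U : set gT -> {RV P >-> R})
      (lambda1 lambda2 : R),
    virtually_Z gT ->
    finite_set S -> generates S ->
    iid_uniform (cayley_graph S) U ->
    0 < lambda1 ->
    (lambda1%:E < lambda_c R (cayley_graph S) o)%E ->
    (lambda_c R (cayley_graph S) o < lambda2%:E)%E ->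
    p_c_star (cayley_graph S) U o lambda1 lambda2 = 1 /\
    p_c (cayley_graph S) U = 1).
Proof.
split=> [V|gT]; last exact: no_phase_transition.
exact: (@phase_transition R {classic V}).
Qed.
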